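(* Let $\varphi,\psi:[0,1]\to\mathbb R$ be continuously differentiable. Under the standing assumption and Assumption 2, with $h=h_n\to0$ and $nh_n\to\infty$, $$Z_n^T(u^* )=Z_n^{T*}(u^* )+R_n^T(u^* ),\qquad u^*\in[h,1-h],$$ where $Z_n^T(u^* )=\sqrt{nh}\,(\hat T_h(u^* )-T(u^* ))/\hat q_h(u^* )$, $Z_n^{T*}(u^* )=-\varphi(u^* )A(u^* )\mathbb G_{n,h}(u^* )$, and $\sup_{u^*\in[h,1-h]}|R_n^T(u^* )|=O_{a.s.}\big(n^{1/2}h^{3/2}+h^{1/2}+h^{-1/2}n^{-1/4}\ell(n)\big)$.
   Context: Standing assumption: $b_1,\dots,b_n$ i.i.d. bids with continuous CDF $F$, quantile function $Q=F^{-1}$ twice continuously differentiable on $[0,1]$, $q=Q'>0$ on $[0,1]$. $p_1,\dots,p_M$ fixed known nonnegative numbers, $A_1(u)=\sum_{m=1}^Mp_mu^{m-1}$ with $A_1'\ne0$ on $[0,1]$, $A=A_1/A_1'$. $v(u)=Q(u)+A(u)q(u)$. Counterfactual: $T(u^* )=\varphi(u^* )v(u^* )+\int_{u^*}^1\psi(x)v(x)\,dx$. Estimators: $b_{(i)}$ order statistics; $\hat Q(u)=b_{(\lfloor nu\rfloor+1)}$ ($u<1$), $\hat Q(1)=b_{(n)}$; $K_h(z)=h^{-1}K(z/h)$; $\hat q_h(u)=\sum_{i=1}^{n-1}K_h(u-i/n)(b_{(i+1)}-b_{(i)})$; $\hat v_h=\hat Q+A\hat q_h$; $\chi_\psi=(1-A')\psi-A\psi'$;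 $\hat S_\psi(u^* )=\int_{u^*}^1\chi_\psi(u)\hat Q(u)du-A(u^* )\psi(u^* )\hat Q(u^* )+A(1)\psi(1)\hat Q(1)$; $\hat T_h(u^* )=\varphi(u^* )\hat v_h(u^* )+\hat S_\psi(u^* )$. $\mathbb G_{n,h}(u)=\sqrt{nh}\,\frac1n\sum_{i=1}^n[K_h(u-F(b_i))-\mathbb EK_h(u-F(b_i))]$; $\ell(n)=(\log n)^{1/2}(\log\log n)^{1/4}$. Assumption 2: $K$ nonnegative, $\int K=1$, $\int K^2<\infty$, Lipschitz, supported on $[-1,1]$. $X_n=O_{a.s.}(r_n)$ means $|X_n|\le Cr_n$ for all large $n$ with $C$ an a.s. finite random variable. *)

(* Defs.v *)
From HB Require Import structures.
From mathcomp Require Import all_boot all_order all_algebra.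
From mathcomp Require Import all_classical all_reals all_analysis.
Set Implicit Arguments. Unset Strict Implicit. Unset Printing Implicit Defensive.
Import Order.TTheory GRing.Theory Num.Theory.
Import numFieldNormedType.Exports.
Local Open Scope classical_set_scope.
Local Open Scope ring_scope.

Section Defs.
Context {R : realType}.

Definition mutually_independent {d} {T : measurableType d}
    (P : probability T R) (X : nat -> T -> R) : Prop :=
  forall (s : seq nat) (B : nat -> set R), uniq s ->
    (forall i, measurable (B i)) ->
    P (\big[setI/setT]_(i <- s) (X i @^-1` B i)) =
    (\prod_(i <- s) fine (P (X i @^-1` B i)))%:E.

(** k-th smallest (0-based) among b_0(t), ..., b_{n-1}(t);
    i.e. ostat b n t k = b_{(k+1)} in the paper's 1-based notation *)
Definition ostat {T : Type} (b : nat -> T -> R) (n : nat) (t : T) (k : nat) : R :=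
  nth 0 (sort <=%R (mkseq (fun i => b i t) n)) k.

Definition Qhat {T : Type} (b : nat -> T -> R) (n : nat) (t : T) (u : R) : R :=
  if u < 1 then ostat b n t (Num.truncn (n%:R * u)) else ostat b n t n.-1.

Definition Kh (K : R -> R) (h z : R) : R := h^-1 * K (z / h).

Definition qhat {T : Type} (K : R -> R) (b : nat -> T -> R) (n : nat) (h : R)
    (t : T) (u : R) : R :=
  \sum_(1 <= i < n) Kh K h (u - i%:R / n%:R) * (ostat b n t i - ostat b n t i.-1).

Definition A1poly (M : nat) (p : nat -> R) : {poly R} :=
  \sum_(1 <= m < M.+1) (p m)%:P * 'X^(m.-1).

Definition A1 (M : nat) (p : nat -> R) (u : R) : R := (A1poly M p).[u].
Definition A1' (M : nat) (p : nat -> R) (u : R) : R := (deriv (A1poly M p)).[u].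

Definition Afun (M : nat) (p : nat -> R) (u : R) : R := A1 M p u / A1' M p u.

Definition vfun (M : nat) (p : nat -> R) (Q q : R -> R) (u : R) : R :=
  Q u + Afun M p u * q u.

Definition Tcf (M : nat) (p : nat -> R) (Q q phi psi : R -> R) (us : R) : R :=
  phi us * vfun M p Q q us +
  \int[lebesgue_measure]_(x in `[us, 1]) (psi x * vfun M p Q q x).

(** chi_psi = (1 - A') psi - A psi'  (dpsi is the derivative of psi) *)
Definition chi (M : nat) (p : nat -> R) (psi dpsi : R -> R) (u : R) : R :=
  (1 - derive1 (Afun M p) u) * psi u - Afun M p u * dpsi u.

Definition vhat {T : Type} (M : nat) (p : nat -> R) (K : R -> R)
    (b : nat -> T -> R) (n : nat) (h : R) (t : T) (u : R) : R :=
  Qhat b n t u + Afun M p u * qhat K b n h t u.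

Definition Shat {T : Type} (M : nat) (p : nat -> R) (psi dpsi : R -> R)
    (b : nat -> T -> R) (n : nat) (t : T) (us : R) : R :=
  \int[lebesgue_measure]_(u in `[us, 1]) (chi M p psi dpsi u * Qhat b n t u)
  - Afun M p us * psi us * Qhat b n t us + Afun M p 1 * psi 1 * Qhat b n t 1.

Definition That {T : Type} (M : nat) (p : nat -> R) (K : R -> R)
    (phi psi dpsi : R -> R) (b : nat -> T -> R) (n : nat) (h : R) (t : T)
    (us : R) : R :=
  phi us * vhat M p K b n h t us + Shat M p psi dpsi b n t us.

Definition Gnh {d} {T : measurableType d} (P : probability T R)
    (K F : R -> R) (b : nat -> T -> R) (n : nat) (h : R) (t : T) (u : R) : R :=
  Num.sqrt (n%:R * h) * (n%:R^-1 *
    \sum_(i < n) (Kh K h (u - F (b i t))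
                  - \int[P]_(w in setT) Kh K h (u - F (b i w)))).

Definition ell (n : nat) : R :=
  Num.sqrt (ln (n%:R : R)) * powR (ln (ln (n%:R : R))) (4%:R^-1).

Definition rate (n : nat) (h : R) : R :=
  powR (n%:R) (2%:R^-1) * powR h (3%:R / 2%:R) + powR h (2%:R^-1)
  + powR h (- 2%:R^-1) * powR (n%:R) (- 4%:R^-1) * ell n.

End Defs.

(* Main.v *)
(** With U_i = F(b_i) uniform, the estimator qhat/q(u) is, up to a relative error O(h + sup|U_(i) - i/n|),
    the kernel-weighted sum of spacings W = sum K_h(u - i/n) (U_(i+1) - U_(i)), while
    1 + G_{n,h}(u) / sqrt(nh) is the kernel density estimate E = (1/n) sum K_h(u - U_i).
    Summation by parts against the Lipschitz kernel turns W + E - 2 into an average of the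
    Bahadur-Kiefer sums (U_(j) - j/n) + (F_n(j/n) - j/n), hence W + E - 2 = O(h^-1 n^-3/4 ell(n)); as
    E W - 1 = E (W + E - 2) - (E - 1)^2, the ratio 1/W, that is q/qhat, is E up to the stated rate.
    The remaining part of T^ - T is linear in Qhat - Q after an integration by parts.

    The Bahadur-Kiefer bound rests on the law of the iterated logarithm for the empirical process
    (dyadic chaining in time and space at once, so that no maximal inequality is needed) and on its
    modulus of continuity. When h^-1 n^-3/4 ell(n) is not small, W need not be close to 1: it is then
    enough to bound W from below, by the modulus of continuity when nh is of order log n or more, and
    otherwise because no interval of length about n^-9/8 contains 32 sample points. *)
Require Import Defs.
From HB Require Import structures.
From mathcomp Require Import all_boot all_order all_algebra.
From mathcomp Require Import all_classical all_reals all_analysis.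
From mathcomp Require Import measurable_realfun ring lra.
Set Implicit Arguments.
Unset Strict Implicit.
Unset Printing Implicit Defensive.
Import Order.TTheory GRing.Theory Num.Theory.
Import numFieldNormedType.Exports.
Local Open Scope classical_set_scope.
Local Open Scope ring_scope.

(** All randomness enters through four almost sure statements: the sample lies in the range of [Q],
    the iterated logarithm bound, the modulus of continuity on the grid j/n, and the absence of
    clusters. They are uniform in the point, so what follows them is a set of deterministic
    inequalities for one outcome and one n, and the supremum over u costs nothing. The last three
    come from union bounds over finitely many events with explicit tails, then Borel-Cantelli.

    Put be = n^(1/4) ell(n) / (nh). Two errors appear: eta = h + O(sqrt(loglog n / n)), from
    freezing the density at u, and be, from the averages. The rate dominates sqrt(nh) (h + be), and
    the arithmetic-geometric mean inequality absorbs the iterated logarithm term into h + be.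

    Since nh -> oo does not imply nh / log n -> oo, neither average need converge to 1. When be is
    not small, constants are multiples of be, but the denominator qhat may degenerate; what is
    needed is that W be stays away from 0, and this is what shapes the two lower bounds for W. *)

(** * Outer probability and Borel-Cantelli *)

Section OuterProbability.
Context {d} {T : measurableType d} {R : realType} (P : probability T R).
Implicit Types (A B : set T) (e C : R).

(* A bound on the outer probability, so that [A] need not be measurable. *)
Definition prob_le A e := exists B, [/\ measurable B, A `<=` B & (P B <= e%:E)%E].

Lemma prob_leS A B e e' : A `<=` B -> e <= e' -> prob_le B e -> prob_le A e'.
Proof.
move=> AB ee' [D [mD BD PD]]; exists D; split => //; first exact: subset_trans BD.
by apply: le_trans PD _; rewrite lee_fin.
Qed.

Lemma prob_leU A B e e' : prob_le A e -> prob_le B e' -> prob_le (A `|` B) (e + e').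
Proof.
move=> [D [mD AD PD]] [E [mE BE PE]]; exists (D `|` E); split.
- exact: measurableU.
- exact: setUSS.
- by rewrite EFinD; apply: le_trans (measureU2 _ mD mE) (leeD PD PE).
Qed.

Lemma prob_le_ex (I : eqType) (s : seq I) (A : I -> set T) e :
  (forall i, i \in s -> prob_le (A i) e) ->
  prob_le [set t | exists2 i, i \in s & A i t] ((size s)%:R * e).
Proof.
elim: s => [_|i s IH Ae].
  by exists set0; split => //; [move=> t []|rewrite measure0 mul0r].
have -> : (size (i :: s))%:R * e = e + (size s)%:R * e.
  by rewrite /= -natr1 mulrDl mul1r addrC.
apply: (@prob_leS _ (A i `|` [set t | exists2 j, j \in s & A j t])) (lexx _) _.
  by move=> t [j]; rewrite inE => /predU1P[->|js] Aj; [left|right; exists j].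
apply: prob_leU; first by apply: Ae; rewrite mem_head.
by apply: IH => j js; apply: Ae; rewrite inE js orbT.
Qed.

Lemma sum_inv_sqr n : \sum_(i < n) (i.+1%:R ^+ 2 : R)^-1 <= 2.
Proof.
(* The sharper bound 2 - 1/(m+1) is what the induction can carry: 1/(m+2)^2 is below 1/(m+1) -
   1/(m+2). *)
suff S m : \sum_(i < m.+1) (i.+1%:R ^+ 2 : R)^-1 <= 2 - m.+1%:R^-1.
  case: n => [|n]; first by rewrite big_ord0.
  by apply: le_trans (S n) _; rewrite gerBl.
elim: m => [|m IH]; first by rewrite big_ord_recr big_ord0 /= expr1n invr1 add0r; lra.
rewrite big_ord_recr /=; apply: le_trans (lerD IH (lexx _)) _.
rewrite -[m.+2%:R]natr1 -[m.+1%:R]natr1; have : 0 <= m%:R :> R by [].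
move: (m%:R) => x x0; set y := x + 1 + 1; set z := x + 1.
have y0 : 0 < y by rewrite /y; lra.
have z0 : 0 < z by rewrite /z; lra.
rewrite -addrA lerD2l -subr_ge0.
have -> : - y^-1 - (- z^-1 + (y ^+ 2)^-1) = (z * y ^+ 2)^-1.
  by rewrite /y -/z; field; rewrite /z; apply/andP; split; lra.
by rewrite invr_ge0 mulr_ge0 ?exprn_ge0 ?ltW.
Qed.

(** The measurable covers of the [A n] have summable probabilities, so their limsup is a measurable
    null set; it contains every outcome lying in infinitely many [A n]. *)
Lemma prob_le_BC (A : nat -> set T) C :
  (\forall n \near \oo, prob_le (A n) (C / n%:R ^+ 2)) ->
  {ae P, forall t, \forall n \near \oo, ~ A n t}.
Proof.
move=> [n0 _ An0].
(* A measurable cover where the bound holds, the empty set where it fails, which can only happen for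
   n below [n0]. *)
pose D n := if pselect (prob_le (A n) (C / n%:R ^+ 2)) is left h then sval (cid h) else set0.
have mD n : measurable (D n).
  by rewrite /D; case: pselect => // h; case: cid => B /= [].
have PD n : (P (D n.+1) <= (`|C| / n.+1%:R ^+ 2)%:E)%E.
  rewrite /D; case: pselect => [h|_]; last first.
    by rewrite measure0 lee_fin divr_ge0 ?exprn_ge0.
  case: cid => B /= [_ _ /le_trans]; apply; rewrite lee_fin.
  by rewrite ler_wpM2r ?invr_ge0 ?exprn_ge0// ler_norm.
exists (lim_sup_set (fun n => D n.+1)); split.
- apply: bigcap_measurable => // k _; exact: bigcup_measurable.
- apply: lim_sup_set_cvg0 => //.
  apply: (@le_lt_trans _ _ (`|C| * 2)%:E); last exact: ltry.
  apply: lime_le; first by apply: is_cvg_nneseries.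
  apply: nearW => n; rewrite big_mkord.
  apply: le_trans (lee_sum _ (fun (i : 'I_n) _ => PD i)) _.
  by rewrite sumEFin lee_fin -mulr_sumr ler_wpM2l ?sum_inv_sqr.
- move=> t /= nA k _; apply: contrapT => nD; apply: nA.
  exists (maxn n0 k).+1 => // n /= nk At; apply: nD.
  case: n nk At => // n; rewrite ltnS geq_max => /andP[nn0 nk] At.
  exists n => //; rewrite /D; case: pselect => [h|[]].
    by case: cid => B /= [_ + _]; exact.
  by apply: An0 => /=; exact: leqW.
Qed.

End OuterProbability.

(** * Moments of products over independent events *)

Section Chernoff.
Context {d} {T : measurableType d} {R : realType} (P : probability T R).
Variables (b : nat -> T -> R).
Hypothesis hb : forall i, measurable_fun setT (b i).
Hypothesis hind : mutually_independent P b.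
Variables (B : set R) (p : R).
Hypothesis mB : measurable B.
Hypothesis hp : forall i, P (b i @^-1` B) = p%:E.

Let I i t : R := \1_B (b i t).

Let mI i : measurable_fun setT (I i).
Proof. by apply: measurableT_comp => //; exact: measurable_indic. Qed.

Let mf c (r s : seq nat) :
  measurable_fun setT (fun t => \prod_(i <- r) I i t * \prod_(i <- s) (1 + c * I i t)).
Proof.
apply: measurable_funM; first by apply: measurable_prod => i _; exact: mI.
apply: measurable_prod => i _; apply: measurable_funD => //.
by apply: measurable_funM => //; exact: mI.
Qed.

Let I01 i t : 0 <= I i t <= 1.
Proof. by rewrite /I indicE; case: (_ \in _); rewrite ?lexx ?ler01. Qed.

Let intf c r s : P.-integrable setT
  (EFin \o (fun t => \prod_(i <- r) I i t * \prod_(i <- s) (1 + c * I i t))).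
Proof.
apply: measurable_bounded_integrable => //; first by rewrite (le_lt_trans (probability_le1 P measurableT))// ltry.
exists ((1 + `|c|) ^+ size s); split; first exact: num_real.
move=> x xM t _ /=; apply: ltW; apply: le_lt_trans xM.
rewrite normrM !normr_prod -[leRHS]mul1r ler_pM ?prodr_ge0//.
  elim: r => [|i r IH]; first by rewrite big_nil.
  rewrite big_cons -[leRHS]mul1r ler_pM ?prodr_ge0//.
  by have /andP[? ?] := I01 i t; rewrite ger0_norm.
elim: s => [|i s IH]; first by rewrite big_nil expr0.
rewrite big_cons exprS ler_pM ?prodr_ge0//.
apply: le_trans (ler_normD _ _) _; rewrite normr1 lerD2l normrM.
by have /andP[? ?] := I01 i t; rewrite [`|I i t|]ger0_norm// ler_piMr.
Qed.

(* Peeling off one factor 1 + c 1_i moves the index [i] from [s] to [r]. *)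
Let expect_prod c r s : uniq (r ++ s) ->
  \int[P]_t (\prod_(i <- r) I i t * \prod_(i <- s) (1 + c * I i t)) =
  p ^+ size r * (1 + c * p) ^+ size s.
Proof.
elim: s r => [|j s IH] r urs.
  rewrite cats0 in urs; rewrite expr0 mulr1.
  have := hind (B := fun=> B) urs (fun=> mB).
  have -> : \prod_(i <- r) fine (P (b i @^-1` B)) = p ^+ size r.
    by under eq_bigr do rewrite hp /=; rewrite big_const_seq count_predT iter_mulr_1.
  move=> hr.
  have -> : (fun t => \prod_(i <- r) I i t * \prod_(i <- [::]) (1 + c * I i t)) =
            \1_(\big[setI/setT]_(i <- r) (b i @^-1` B)) :> (T -> R).
    apply/funext => t; rewrite big_nil mulr1; elim: r {urs hr} => [|i r IHr].
      by rewrite !big_nil indicT.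
    by rewrite !big_cons IHr indicI.
  rewrite /Rintegral integral_indic//; last first.
    by apply: bigsetI_measurable => i _; rewrite -[X in measurable X]setTI; exact: hb.
  by rewrite setIT; exact: (congr1 fine hr).
have -> : (fun t => \prod_(i <- r) I i t * \prod_(i <- j :: s) (1 + c * I i t)) =
  (fun t => \prod_(i <- r) I i t * \prod_(i <- s) (1 + c * I i t) +
        c * (\prod_(i <- j :: r) I i t * \prod_(i <- s) (1 + c * I i t))).
  by apply/funext => t; rewrite !big_cons; ring.
have ujrs : uniq ((j :: r) ++ s) by move: urs; rewrite -cat1s uniq_catCA.
rewrite RintegralD//; last first.
  exact: (@integrableZl _ _ _ P setT measurableT c _ (intf c (j :: r) s)).
rewrite RintegralZl//.
rewrite !IH//=; last by move: ujrs => /= /andP[].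
by rewrite exprS exprS; ring.
Qed.

(** Markov's inequality for the product of the 1 + c 1_B, nonnegative because c >= -1. The mean of a
    product of indicators is given directly by independence of events, so no independence of
    functions is involved; with 1 + c = exp(lam) this is the exponential moment, and c < 0 gives the
    lower tail. *)
Lemma prod_tail c y (s : seq nat) : uniq s -> -1 <= c -> 0 < y ->
  prob_le P [set t | y <= \prod_(i <- s) (1 + c * \1_B (b i t))]
    ((1 + c * p) ^+ size s / y).
Proof.
move=> us c1 y0.
set g := fun t => \prod_(i <- s) (1 + c * I i t).
have gE : g = (fun t => \prod_(i <- [::]) I i t * \prod_(i <- s) (1 + c * I i t)).
  by apply/funext => t; rewrite big_nil mul1r.
have mg : measurable_fun setT g by rewrite gE.
have ig : P.-integrable setT (EFin \o g) by rewrite gE; exact: intf.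
have Eg : \int[P]_t g t = (1 + c * p) ^+ size s by rewrite gE expect_prod// mul1r.
have g0 t : 0 <= g t.
  by apply: prodr_ge0 => i _; have /andP[? ?] := I01 i t; nra.
have mE : measurable [set t | y <= g t].
  rewrite (_ : [set t | _] = setT `&` g @^-1` `[y, +oo[); first exact: mg.
  by apply/seteqP; split => t /=; rewrite in_itv/= andbT//; case.
exists [set t | y <= g t]; split => //.
have fP : P [set t | y <= g t] \is a fin_num by exact: fin_num_measure.
rewrite -(fineK fP) lee_fin ler_pdivlMr// mulrC -Eg.
have iE : P.-integrable setT (EFin \o (\1_[set t | y <= g t] : T -> R)).
  by apply: integrable_indic => //; rewrite setIT -ge0_fin_numE.
have <- : \int[P]_t (\1_[set t | y <= g t] t : R) = fine (P [set t | y <= g t]).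
  by rewrite /Rintegral integral_indic// setIT.
rewrite -RintegralZl//; apply: le_Rintegral => //; first exact: (@integrableZl _ _ _ P setT measurableT y _ iE).
move=> t _; rewrite indicE; have [|] := boolP (_ \in _) => [|_]; last by rewrite mulr0.
by rewrite inE /= mulr1.
Qed.

End Chernoff.

(** Squaring and inverting 1 - x/2 <= exp(-x/2) bounds exp(x) by (1 - x/2)^-2, and (1 + x + 2x^2)(1
    - x/2)^2 exceeds 1 by a product of nonnegative factors. *)
Lemma expR_le_quad {R : realType} (x : R) : `|x| <= 1 -> expR x <= 1 + x + 2 * x ^+ 2.
Proof.
move=> x1; have /andP[xN1 x1'] : -1 <= x <= 1 by rewrite -ler_norml.
have E : 1 - x / 2 <= expR (- (x / 2)) by exact: expR_ge1Dx.
have -> : expR x = (expR (- (x / 2)) ^+ 2)^-1.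
  by rewrite -expRM_natl -expRN; congr expR; field.
have y0 : 0 < expR (- (x / 2)) by exact: expR_gt0.
rewrite -[leLHS]mul1r ler_pdivrMr ?exprn_gt0//.
have : (1 - x / 2) ^+ 2 <= expR (- (x / 2)) ^+ 2.
  by rewrite ler_sqr ?nnegrE ?expR_ge0//; lra.
move=> /(ler_wpM2l (_ : 0 <= 1 + x + 2 * x ^+ 2)) H.
apply: le_trans (H _); last by nra.
have -> : (1 + x + 2 * x ^+ 2) * (1 - x / 2) ^+ 2 =
  1 + x ^+ 2 * (1 - x) * (5 / 4 - x / 2) by field.
rewrite lerDl; apply: mulr_ge0; last lra.
by apply: mulr_ge0; [exact: sqr_ge0|lra].
Qed.

(** * Bernstein and Poisson-type tail bounds *)

Section Bernstein.
Context {d} {T : measurableType d} {R : realType} (P : probability T R).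
Variables (b : nat -> T -> R).
Hypothesis hb : forall i, measurable_fun setT (b i).
Hypothesis hind : mutually_independent P b.
Variables (B : set R) (p : R).
Hypothesis mB : measurable B.
Hypothesis hp : forall i, P (b i @^-1` B) = p%:E.

Let p0 : 0 <= p. Proof. by rewrite -lee_fin -(hp 0). Qed.

Let prod_expE (lam : R) (s : seq nat) t :
  \prod_(i <- s) (1 + (expR lam - 1) * \1_B (b i t)) =
  expR (lam * \sum_(i <- s) \1_B (b i t)).
Proof.
elim: s => [|i s IH]; first by rewrite !big_nil mulr0 expR0.
rewrite !big_cons IH mulrDr expRD indicE; congr (_ * _).
by case: (_ \in _); rewrite ?(mulr1, mulr0) ?expR0; ring.
Qed.

Let one_sided (lam z V : R) (s : seq nat) : uniq s -> `|lam| <= 1 ->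
  (size s)%:R * p <= V ->
  prob_le P [set t | z <= lam * \sum_(i <- s) (\1_B (b i t) - p)]
    (expR (2 * V * lam ^+ 2 - z)).
Proof.
move=> us lam1 sV.
have c1 : -1 <= expR lam - 1 by rewrite -subr_ge0 opprK subrK expR_ge0.
have := prod_tail hb hind mB hp us c1 (expR_gt0 (z + lam * ((size s)%:R * p))).
apply: prob_leS.
  move=> t /=; rewrite prod_expE sumrB big_const_seq count_predT iter_addr_0.
  by rewrite ler_expR -mulr_natl mulrBr; lra.
rewrite ler_pdivrMr ?expR_gt0// -expRD.
apply: (@le_trans _ _ (expR ((size s)%:R * ((expR lam - 1) * p)))).
  rewrite expRM_natl; apply: lerXn2r; rewrite ?nnegrE ?expR_ge0 ?expR_ge1Dx//.
  have /andP[? ?] : 0 <= p <= 1.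
    by rewrite p0 -lee_fin -(hp 0) probability_le1// -[X in measurable X]setTI; exact: hb.
  by have := expR_ge0 lam; nra.
rewrite ler_expR addrA subrK.
have := expR_le_quad lam1; have : 0 <= (size s)%:R * p by rewrite mulr_ge0.
rewrite (_ : (size s)%:R * ((expR lam - 1) * p) = (expR lam - 1) * ((size s)%:R * p)); last by ring.
move: ((size s)%:R * p) sV (expR lam) => q qV e q0 el.
have : 0 <= lam ^+ 2 by exact: sqr_ge0.
by move: (lam ^+ 2) el => l2; nra.
Qed.

(** [V] is any upper bound for the mean of the count, so it can be enlarged to meet z <= 4V, which
    keeps the optimal lam = z/(4V) in [0,1]. *)
Lemma bernstein (z V : R) (s : seq nat) : uniq s -> (size s)%:R * p <= V -> 0 < V ->
  0 <= z <= 4 * V ->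
  prob_le P [set t | z <= `|\sum_(i <- s) (\1_B (b i t) - p)|]
    (2 * expR (- (z ^+ 2 / (8 * V)))).
Proof.
move=> us sV V0 /andP[z0 zV].
pose lam := z / (4 * V).
have lam0 : 0 <= lam by rewrite divr_ge0// mulr_ge0// ltW.
have lam1 : `|lam| <= 1 by rewrite ger0_norm// ler_pdivrMr ?mul1r// mulr_gt0.
have E : 2 * V * lam ^+ 2 - lam * z = - (z ^+ 2 / (8 * V)).
  by rewrite /lam; field; rewrite gt_eqF.
have H1 := one_sided (lam * z) us lam1 sV.
have := one_sided (lam := - lam) (lam * z) us _ sV.
rewrite normrN => /(_ lam1) H2; rewrite sqrrN E in H2; rewrite E in H1.
rewrite mulr_natl mulr2n; apply: prob_leS (lexx _) (prob_leU H1 H2).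
move=> t /=; rewrite ler_normr => /orP[H|H].
  left; exact: ler_wpM2l.
by right; rewrite mulNr -mulrN; exact: ler_wpM2l.
Qed.

(** For means far below 1, where a large c pays: k points gain a factor (1 + c)^-k while exp(c mean)
    stays bounded. *)
Lemma count_tail (c : R) k (s : seq nat) : uniq s -> 0 <= c ->
  prob_le P [set t | k%:R <= \sum_(i <- s) (\1_B (b i t) : R)]
    (expR (c * ((size s)%:R * p)) / (1 + c) ^+ k).
Proof.
move=> us c0.
have c1 : -1 <= c by lra.
have y0 : 0 < (1 + c) ^+ k by rewrite exprn_gt0//; lra.
apply: prob_leS (prod_tail hb hind mB hp us c1 y0).
  move=> t /=; have [lam lamE] : exists lam, expR lam = 1 + c.
    by apply: expR_total; lra.
  have -> : c = expR lam - 1 by rewrite lamE; ring.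
  rewrite prod_expE (_ : 1 + _ = expR lam); last by ring.
  rewrite -expRM_natr ler_expR => H; apply: ler_wpM2l H.
  by rewrite leNgt -expR_lt1 lamE -leNgt; lra.
rewrite ler_wpM2r ?invr_ge0 ?(ltW y0)//.
rewrite (_ : c * _ = (size s)%:R * (c * p)); last by ring.
rewrite expRM_natl; apply: lerXn2r; rewrite ?nnegrE ?expR_ge0 ?expR_ge1Dx//.
by rewrite addr_ge0// mulr_ge0.
Qed.

End Bernstein.

(** * The empirical process, indexed by sample block and level *)

Section EmpiricalProcess.
Context {d} {T : measurableType d} {R : realType} (P : probability T R).
Variables (b : nat -> T -> R) (F Q : R -> R).
Hypothesis hb : forall i, measurable_fun setT (b i).
Hypothesis hind : mutually_independent P b.
Hypothesis hF : forall i x, P (b i @^-1` `]-oo, x]) = (F x)%:E.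
Hypothesis hFQ : forall u : R, u \in `[0, 1] -> F (Q u) = u.

Lemma cdf_homo (x y : R) : x <= y -> F x <= F y.
Proof.
move=> xy; rewrite -lee_fin -!(hF 0); apply: le_measure; rewrite ?inE.
- by rewrite -[X in measurable X]setTI; exact: hb.
- by rewrite -[X in measurable X]setTI; exact: hb.
- by move=> t /=; rewrite !in_itv/= => /le_trans; apply.
Qed.

Lemma quantile_lt (u v : R) : 0 <= u -> v <= 1 -> u < v -> Q u < Q v.
Proof.
move=> u0 v1 uv; rewrite ltNge; apply/negP => /cdf_homo.
have -> : F (Q u) = u by rewrite hFQ// in_itv/=; apply/andP; split; lra.
have -> : F (Q v) = v by rewrite hFQ// in_itv/=; apply/andP; split; lra.
by rewrite leNgt uv.
Qed.

Lemma quantile_le (u v : R) : 0 <= u -> v <= 1 -> u <= v -> Q u <= Q v.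
Proof.
move=> u0 v1; rewrite le_eqVlt => /predU1P[->//|uv].
by apply/ltW/quantile_lt.
Qed.

Lemma prob_itv (u v : R) i : 0 <= u -> u <= v -> v <= 1 ->
  P (b i @^-1` `]Q u, Q v]) = (v - u)%:E.
Proof.
move=> u0 uv v1.
have m x : measurable (b i @^-1` `]-oo, x]).
  by rewrite -[X in measurable X]setTI; exact: hb.
have -> : b i @^-1` `]Q u, Q v] = b i @^-1` `]-oo, Q v] `\` b i @^-1` `]-oo, Q u].
  apply/seteqP; split => t /=; rewrite !in_itv/= ltNge.
    by move=> /andP[/negP ? ?].
  by move=> [? /negP ->].
have AB : b i @^-1` `]-oo, Q v] `&` b i @^-1` `]-oo, Q u] = b i @^-1` `]-oo, Q u].
  rewrite setIidr// => t /=; rewrite !in_itv/= => /le_trans; apply.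
  exact: quantile_le.
have D : (P (b i @^-1` `]-oo, Q v]) < +oo)%E ->
    P (b i @^-1` `]-oo, Q v] `\` b i @^-1` `]-oo, Q u]) =
    (P (b i @^-1` `]-oo, Q v]) - P (b i @^-1` `]-oo, Q v] `&` b i @^-1` `]-oo, Q u]))%E.
  exact: measureD.
move: D; rewrite AB !hF => ->; last exact: ltry.
by rewrite !hFQ// in_itv/=; apply/andP; split; lra.
Qed.

(** The sum runs over a block m <= i < n of the sample because the chaining also moves in the sample
    size. *)
Definition csum m n u t : R := \sum_(m <= i < n) ((b i t <= Q u)%R%:R - u).
Definition csum2 m n u v t : R :=
  \sum_(m <= i < n) ((Q u < b i t <= Q v)%R%:R - (v - u)).

Lemma csum2E m n (u v : R) t : 0 <= u -> u <= v -> v <= 1 ->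
  csum m n v t = csum m n u t + csum2 m n u v t.
Proof.
move=> u0 uv v1; rewrite -big_split /=; apply: eq_bigr => i _.
have [bu|bu] := leP (b i t) (Q u); last by rewrite /= mulr0n; lra.
by rewrite (le_trans bu (quantile_le u0 v1 uv)) /= mulr0n mulr1n; lra.
Qed.

Lemma csum_cat m n k u t : (m <= n)%N -> (n <= k)%N ->
  csum m k u t = csum m n u t + csum n k u t.
Proof. by move=> mn nk; rewrite /csum (big_cat_nat mn nk). Qed.

Lemma csum2_bern m n (u v z V : R) : 0 <= u -> u <= v -> v <= 1 ->
  (n - m)%N%:R * (v - u) <= V -> 0 < V -> 0 <= z <= 4 * V ->
  prob_le P [set t | z <= `|csum2 m n u v t|] (2 * expR (- (z ^+ 2 / (8 * V)))).
Proof.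
move=> u0 uv v1 hV V0 hz.
apply: prob_leS (lexx _) (bernstein (P := P) hb hind (B := `]Q u, Q v]%classic) (p := v - u)
  _ _ (iota_uniq m (n - m)) _ V0 hz) => //.
- move=> t /=; rewrite /csum2; under eq_bigr do rewrite indicE mem_setE in_itv/=.
  by [].
- by move=> i; exact: prob_itv.
- by rewrite size_iota.
Qed.

Lemma csum_bern m n (u z V : R) : 0 <= u <= 1 ->
  (n - m)%N%:R * u <= V -> 0 < V -> 0 <= z <= 4 * V ->
  prob_le P [set t | z <= `|csum m n u t|] (2 * expR (- (z ^+ 2 / (8 * V)))).
Proof.
move=> u01 hV V0 hz.
apply: prob_leS (lexx _) (bernstein (P := P) hb hind (B := `]-oo, Q u]%classic) (p := u)
  _ _ (iota_uniq m (n - m)) _ V0 hz) => //.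
- move=> t /=; rewrite /csum; under eq_bigr do rewrite indicE mem_setE in_itv/=.
  by [].
- by move=> i; rewrite hF hFQ.
- by rewrite size_iota.
Qed.

End EmpiricalProcess.

(** n^(1/8) as nested square roots, so that its powers stay algebraic. It measures how much finer
    than 1/n the clustering cells are, and it eventually dominates (log n)^2. *)
Definition root8 {R : realType} (n : nat) : R := Num.sqrt (Num.sqrt (Num.sqrt n%:R)).

Lemma root8_pow {R : realType} n : root8 n ^+ 8 = n%:R :> R.
Proof. by rewrite /root8 (exprM _ 2 4) sqr_sqrtr// (exprM _ 2 2) sqr_sqrtr// sqr_sqrtr. Qed.

Lemma root8_ge0 {R : realType} n : 0 <= root8 n :> R.
Proof. exact: sqrtr_ge0. Qed.

Lemma root8_le {R : realType} n : (0 < n)%N -> root8 n <= n%:R :> R.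
Proof.
move=> n0; rewrite -[in leRHS]root8_pow -{1}[root8 n]expr1 ler_weXn2l//.
by rewrite -(@ler_pXn2r _ 8)// ?nnegrE ?root8_ge0// root8_pow expr1n ler1n.
Qed.

(** * Almost sure modulus of continuity and absence of clusters *)

Section EmpiricalTails.
Context {d} {T : measurableType d} {R : realType} (P : probability T R).
Variables (b : nat -> T -> R) (F Q : R -> R).
Hypothesis hb : forall i, measurable_fun setT (b i).
Hypothesis hind : mutually_independent P b.
Hypothesis hF : forall i x, P (b i @^-1` `]-oo, x]) = (F x)%:E.
Hypothesis hFQ : forall u : R, u \in `[0, 1] -> F (Q u) = u.

Let grid01 (i n : nat) : (i <= n)%N -> 0 <= (i%:R / n%:R : R) <= 1.
Proof.
case: n => [|n] iN; first by rewrite invr0 mulr0 lexx ler01.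
by rewrite divr_ge0//= ler_pdivrMr ?ltr0n// mul1r ler_nat.
Qed.

(** A union bound over the (n+1)^2 grid pairs: z^2 = 32 V log n with V = j - i + 2 log n gives a
    tail 2 n^-4 by [bernstein]. The summand 2 log n ensures z <= 4V even for neighbouring grid
    points. *)
Lemma oscillation : {ae P, forall t, \forall n \near \oo, forall i j, (i <= j <= n)%N ->
  `|csum2 b Q 0 n (i%:R / n%:R) (j%:R / n%:R) t| <=
    Num.sqrt (32 * ((j - i)%N%:R + 2 * ln n%:R) * ln n%:R)}.
Proof.
pose V (n i j : nat) : R := (j - i)%N%:R + 2 * ln n%:R.
pose z n i j : R := Num.sqrt (32 * V n i j * ln n%:R).
pose A n := [set t | exists2 i, i \in iota 0 n.+1 & [set t | exists2 j, j \in iota 0 n.+1 &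
  [set t | (i <= j)%N /\ z n i j <= `|csum2 b Q 0 n (i%:R / n%:R) (j%:R / n%:R) t|] t] t].
suff: {ae P, forall t, \forall n \near \oo, ~ A n t}.
  apply: filterS => t; apply: filterS => n nA i j /andP[ij jn].
  rewrite leNgt; apply/negP => /ltW zj; apply: nA.
  by exists i; [rewrite mem_iota ltnS (leq_trans ij)|exists j; [rewrite mem_iota ltnS|]].
apply: (prob_le_BC (C := 8)); exists 2%N => // n /= n2.
have n0 : 0 < n%:R :> R by rewrite ltr0n (leq_trans _ n2).
have l0 : 0 < ln n%:R :> R by rewrite ln_gt0// ltr1n.
have n1 : 1 <= n%:R :> R by rewrite ler1n (leq_trans _ n2).
pose e : R := 2 * (n%:R ^+ 4)^-1.
apply: (@prob_leS _ _ _ _ _ _ ((size (iota 0 n.+1))%:R * ((size (iota 0 n.+1))%:R * e))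
  _ (@subset_refl _ _)).
  rewrite size_iota /e -natr1 -subr_ge0.
  have -> : 8 / n%:R ^+ 2 - (n%:R + 1) * ((n%:R + 1) * (2 / n%:R ^+ 4)) =
    (8 * n%:R ^+ 2 - 2 * (n%:R + 1) ^+ 2) / n%:R ^+ 4 :> R by field; rewrite gt_eqF.
  by rewrite divr_ge0 ?exprn_ge0//; nra.
apply: prob_le_ex => i; rewrite mem_iota add0n ltnS => /andP[_ iN].
apply: prob_le_ex => j; rewrite mem_iota add0n ltnS => /andP[_ jN].
have [ij|ji] := leqP i j; last first.
  exists set0; split => //; first by move=> t [].
  by rewrite measure0 lee_fin mulr_ge0// invr_ge0 exprn_ge0.
have Vpos : 0 < V n i j by rewrite /V ltr_wpDl// mulr_gt0.
have /andP[i0 _] := grid01 iN; have /andP[_ j1] := grid01 jN.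
have ijn : i%:R / n%:R <= j%:R / n%:R :> R by rewrite ler_pM2r ?invr_gt0// ler_nat.
have z2 : z n i j ^+ 2 = 32 * V n i j * ln n%:R.
  by rewrite sqr_sqrtr// !mulr_ge0// ltW.
have := @csum2_bern _ _ _ P b F Q hb hind hF hFQ 0 n _ _ (z n i j) (V n i j) i0 ijn j1.
rewrite subn0 => /(_ _ Vpos) H; apply: prob_leS (H _ _).
- by move=> t [].
- rewrite z2 /e (_ : 32 * V n i j * ln n%:R / (8 * V n i j) = 4%:R * ln n%:R); last by field; rewrite gt_eqF.
  by rewrite expRN expRM_natl lnK ?posrE.
- rewrite -mulrBl mulrCA divff ?gt_eqF// mulr1 /V natrB// lerDl.
  by rewrite mulr_ge0// ltW.
- rewrite sqrtr_ge0 /= -(@ler_pXn2r _ 2)// ?nnegrE ?sqrtr_ge0 ?mulr_ge0 ?(ltW Vpos)// z2.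
  have : 2 * ln n%:R <= V n i j by rewrite /V lerDr.
  by move: (ln _) (V n i j) l0 Vpos => l v l0 v0 lV; nra.
Qed.

(** Cells of width about n^(-9/8), with expected count about n^(-1/8) each. *)
Definition cells n : nat := (n * (Num.truncn (root8 n : R)).+1)%N.

(** With r the second factor of [cells], a cell has mean count 1/r, and [count_tail] with c = r, k =
    32 gives at most e / r^32 <= e n^-4, as r >= n^(1/8). There are at most 2 n^2 cells. *)
Lemma spacing : {ae P, forall t, \forall n \near \oo, forall i, (i < cells n)%N ->
  \sum_(0 <= k < n) (Q (i%:R / (cells n)%:R) < b k t <= Q (i.+1%:R / (cells n)%:R))%R%:R
    < 32 :> R}.
Proof.
pose A n := [set t | exists2 i, i \in iota 0 (cells n) & [set t | 32%:R <=
  \sum_(0 <= k < n) (Q (i%:R / (cells n)%:R) < b k t <= Q (i.+1%:R / (cells n)%:R))%R%:R :> R] t].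
suff: {ae P, forall t, \forall n \near \oo, ~ A n t}.
  apply: filterS => t; apply: filterS => n nA i iG.
  by rewrite ltNge; apply/negP => H; apply: nA; exists i => //; rewrite mem_iota.
apply: (prob_le_BC (C := 2 * expR 1)); exists 1%N => // n /= n1.
pose r : R := (Num.truncn (root8 n : R)).+1%:R.
have rn : root8 n <= r by apply/ltW; exact: truncnS_gt.
have r0 : 0 < r by rewrite ltr0n.
have n0 : 0 < n%:R :> R by rewrite ltr0n.
have GE : (cells n)%:R = n%:R * r by rewrite /cells natrM.
have G0 : 0 < (cells n)%:R :> R by rewrite GE mulr_gt0.
apply: (@prob_leS _ _ _ _ _ _ ((size (iota 0 (cells n)))%:R * (expR 1 / n%:R ^+ 4))
  _ (@subset_refl _ _)).
  rewrite size_iota GE.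
  have r2 : r <= 2 * n%:R.
    rewrite /r -natr1; have /andP[+ _] := truncn_itv (root8_ge0 (R := R) n).
    have := root8_le (R := R) n1; have : 1 <= n%:R :> R by rewrite ler1n.
    by lra.
  rewrite -subr_ge0.
  have -> : 2 * expR 1 / n%:R ^+ 2 - n%:R * r * (expR 1 / n%:R ^+ 4) =
    (2 * n%:R - r) * (expR 1 / n%:R ^+ 3) by field; rewrite gt_eqF.
  by rewrite mulr_ge0 ?subr_ge0// divr_ge0 ?exprn_ge0 ?expR_ge0.
apply: prob_le_ex => i; rewrite mem_iota add0n => /andP[_ iG].
have /andP[i0 _] : 0 <= (i%:R / (cells n)%:R : R) <= 1 by apply: grid01; exact: ltnW.
have /andP[_ i1] : 0 <= (i.+1%:R / (cells n)%:R : R) <= 1 by apply: grid01.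
have ii : i%:R / (cells n)%:R <= i.+1%:R / (cells n)%:R :> R.
  by rewrite ler_pM2r ?invr_gt0// ler_nat.
apply: prob_leS (count_tail (P := P) hb hind
  (B := `]Q (i%:R / (cells n)%:R), Q (i.+1%:R / (cells n)%:R)]%classic) _
  (fun k => prob_itv hb hF hFQ k i0 ii i1) 32 (iota_uniq 0 (n - 0)) (ltW r0)) => //.
- move=> t /=; under [X in _ -> _ <= X]eq_bigr do rewrite indicE mem_setE in_itv/=.
  by [].
- rewrite size_iota subn0 -mulrBl -natr1 addrAC subrr add0r mul1r.
  rewrite (_ : r * _ = 1); last by rewrite GE; field; rewrite !gt_eqF.
  rewrite ler_pM2l ?expR_gt0// lef_pV2 ?posrE ?exprn_gt0//; last by lra.
  rewrite -[n%:R]root8_pow -exprM; apply: lerXn2r; rewrite ?nnegrE ?root8_ge0//; lra.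
Qed.

End EmpiricalTails.

(** * Law of the iterated logarithm by dyadic chaining *)

Section IteratedLogarithm.
Context {d} {T : measurableType d} {R : realType} (P : probability T R).
Variables (b : nat -> T -> R) (F Q : R -> R).
Hypothesis hb : forall i, measurable_fun setT (b i).
Hypothesis hind : mutually_independent P b.
Hypothesis hF : forall i x, P (b i @^-1` `]-oo, x]) = (F x)%:E.
Hypothesis hFQ : forall u : R, u \in `[0, 1] -> F (Q u) = u.

(** The horizon 4^j is cut into 2^l blocks of this length, matching the 2^l cells of [0,1] at level
    l. A sum over one block, and an increment over one cell up to any block end, then both have mean
    count at most [tau j l]. *)
Let tau (j l : nat) : nat := (2 ^ (2 * j - l))%N.
(* Chaining thresholds: they are summable in [l], while lev^2 / (8 tau) grows like
   (49/32)^l log j, which beats the 4^l nodes of level [l]. *)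
Let lev (j l : nat) : R := 8 * 2 ^+ j * Num.sqrt (ln j%:R) * (7 / 8) ^+ l.
Let node (l c : nat) : R := c%:R / 2 ^+ l.

Let node01 l c : (c <= 2 ^ l)%N -> 0 <= node l c <= 1.
Proof.
move=> c2; rewrite divr_ge0 ?exprn_ge0//= ler_pdivrMr ?exprn_gt0// mul1r.
by rewrite -natrX ler_nat.
Qed.

Let nodeS l c : node l c <= node l c.+1.
Proof. by rewrite ler_pM2r ?invr_gt0 ?exprn_gt0// ler_nat. Qed.

Let bad j := [set t | exists2 l, l \in iota 0 j.+1 &
  [set t | exists2 a, a \in iota 0 (2 ^ l).+1 & [set t | exists2 c, c \in iota 0 (2 ^ l).+1 &
    ([set t | lev j l <= `|csum b Q (a * tau j l) (a.+1 * tau j l) (node l c) t|] `|`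
     [set t | (c < 2 ^ l)%N /\
       lev j l <= `|csum2 b Q 0 (a * tau j l) (node l c) (node l c.+1) t|]) t] t] t].

Let bernoulli (x : R) l : 0 <= x -> 1 + l%:R * x <= (1 + x) ^+ l.
Proof.
move=> x0; elim: l => [|l IH]; first by rewrite mul0r expr0; lra.
have : 0 <= l%:R * x by rewrite mulr_ge0.
by rewrite exprS -natr1; move: IH; move: (_ ^+ l) (l%:R) => y m; nra.
Qed.

Let lnj0 j : (196 <= j)%N -> 1 <= ln j%:R :> R.
Proof.
move=> j196; have e4 : expR 1 <= 4 :> R.
  by apply: le_trans (expR_le_quad _) _; rewrite ?normr1//; lra.
rewrite -[leLHS]expRK ler_ln ?posrE ?expR_gt0 ?ltr0n//; last exact: leq_trans j196.
by apply: le_trans e4 _; rewrite ler_nat; exact: leq_trans j196.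
Qed.

(** The condition z <= 4V of [bernstein] at every level. It comes down to 2 sqrt(log j) <= (8/7)^j,
    which follows from 4j <= (j/7)^2; hence the threshold 196, which is 4 times 49. *)
Let levV j l : (196 <= j)%N -> (l <= j)%N -> lev j l <= 4 * (tau j l)%:R.
Proof.
move=> j196 lj; have l1 := lnj0 j196.
have jR : 196 <= j%:R :> R by rewrite ler_nat.
rewrite /lev /tau natrX.
have -> : 2 ^+ (2 * j - l) = 2 ^+ j * (2 ^+ j / 2 ^+ l) :> R.
  rewrite mulrA -exprD addnn -mul2n -expfB_cond ?pnatr_eq0//=.
  by rewrite (leq_trans lj)// leq_pmull.
have p0 : 0 < 2 ^+ j :> R by rewrite exprn_gt0.
have q0 : 0 < 2 ^+ l :> R by rewrite exprn_gt0.
have -> : 4 * (2 ^+ j * (2 ^+ j / 2 ^+ l)) = 4 * 2 ^+ j * (2 ^+ j / 2 ^+ l) :> R by ring.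
have -> : 8 * 2 ^+ j * Num.sqrt (ln j%:R) * (7 / 8) ^+ l =
  4 * 2 ^+ j * (2 * Num.sqrt (ln j%:R) * (7 / 8) ^+ l) :> R by ring.
rewrite ler_pM2l ?mulr_gt0// ler_pdivlMr// -[leLHS]mulrA -exprMn.
rewrite (_ : 7 / 8 * 2 = 7 / 4 :> R); last by field.
have -> : 2 ^+ j = (8 / 7) ^+ j * (7 / 4) ^+ j :> R.
  by rewrite -exprMn; congr (_ ^+ _); field.
apply: ler_pM; rewrite ?mulr_ge0 ?sqrtr_ge0 ?exprn_ge0//; last first.
  by apply: ler_weXn2l => //; lra.
have : 1 + j%:R * (1 / 7) <= (1 + 1 / 7) ^+ j :> R by exact: bernoulli.
rewrite (_ : 1 + 1 / 7 = 8 / 7 :> R); last by field.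
apply: le_trans.
rewrite -(@ler_pXn2r _ 2)// ?nnegrE ?mulr_ge0 ?sqrtr_ge0 ?addr_ge0//.
rewrite exprMn sqr_sqrtr; last lra.
have : ln j%:R < j%:R :> R by apply: ln_sublinear; lra.
by move: (ln _) => y; nra.
Qed.

(** The exponent is 8 (49/32)^l log j >= (8 + 4l) log j by Bernoulli's inequality, and j >= 4 turns
    j^(-4l) into 4^-l. *)
Let lev_tail j l : (196 <= j)%N -> (l <= j)%N ->
  expR (- (lev j l ^+ 2 / (8 * (tau j l)%:R))) <= (4 ^+ l)^-1 * (j%:R ^+ 8)^-1.
Proof.
move=> j196 lj; have l1 := lnj0 j196.
have jR : 196 <= j%:R :> R by rewrite ler_nat.
have p0 : 0 < 2 ^+ l :> R by rewrite exprn_gt0.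
have -> : lev j l ^+ 2 / (8 * (tau j l)%:R) = 8 * ln j%:R * (49 / 32) ^+ l.
  rewrite /lev /tau natrX; have -> : 2 ^+ (2 * j - l) = 2 ^+ j * 2 ^+ j / 2 ^+ l :> R.
    rewrite -exprD addnn -mul2n -expfB_cond ?pnatr_eq0//=.
    by rewrite (leq_trans lj)// leq_pmull.
  have -> : (49 / 32) ^+ l = (7 / 8) ^+ l * (7 / 8) ^+ l * 2 ^+ l :> R.
    by rewrite -!exprMn; congr (_ ^+ _); field.
  set y := Num.sqrt (ln j%:R).
  have -> : ln j%:R = y ^+ 2 by rewrite sqr_sqrtr//; lra.
  by field; rewrite !expf_neq0.
have j0 : 0 < j%:R :> R by lra.
rewrite expRN -invfM lef_pV2 ?posrE ?expR_gt0 ?mulr_gt0 ?exprn_gt0//.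
apply: (@le_trans _ _ (expR ((8 + l * 4)%N%:R * ln j%:R))); last first.
  rewrite ler_expR mulrAC ler_wpM2r//; first lra.
  rewrite natrD natrM.
  have l0 : 0 <= l%:R :> R by [].
  have : 1 + l%:R * (17 / 32) <= (1 + 17 / 32) ^+ l :> R by apply: bernoulli; lra.
  rewrite (_ : 1 + 17 / 32 = 49 / 32 :> R); last by field.
  by move: (l%:R : R) l0 (_ ^+ l) => x x0 y; lra.
rewrite expRM_natl lnK ?posrE// exprD [leLHS]mulrC ler_wpM2l ?exprn_ge0 ?(ltW j0)//.
rewrite mulnC exprM; apply: lerXn2r; rewrite ?nnegrE ?exprn_ge0 ?(ltW j0)//.
have : j%:R <= j%:R ^+ 4 :> R by apply: ler_eXnr => //; lra.
by lra.
Qed.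

(** At level l the (2^l + 1)^2 pairs of nodes are absorbed by the factor 4^-l, so each of the j + 1
    levels contributes at most 16 j^-8. *)
Lemma prob_bad j : (196 <= j)%N -> prob_le P (bad j) (32 / j%:R ^+ 2).
Proof.
move=> j196.
have jR : 196 <= j%:R :> R by rewrite ler_nat.
pose e l : R := 4 * ((4 ^+ l)^-1 * (j%:R ^+ 8)^-1).
apply: (@prob_leS _ _ _ _ _ _ ((size (iota 0 j.+1))%:R * (16 / j%:R ^+ 8)) _ (@subset_refl _ _)).
  rewrite size_iota -natr1 -subr_ge0.
  have -> : 32 / j%:R ^+ 2 - (j%:R + 1) * (16 / j%:R ^+ 8) =
    16 * (2 * j%:R ^+ 6 - (j%:R + 1)) / j%:R ^+ 8 :> R by field; rewrite gt_eqF//; lra.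
  rewrite divr_ge0 ?exprn_ge0// mulr_ge0// subr_ge0.
  have : j%:R <= j%:R ^+ 6 :> R by apply: ler_eXnr => //; lra.
  by lra.
apply: prob_le_ex => l; rewrite mem_iota add0n ltnS => /andP[_ lj].
have L := lev_tail j196 lj.
have V0 : 0 < (tau j l)%:R :> R by rewrite ltr0n expn_gt0.
have hz : 0 <= lev j l <= 4 * (tau j l)%:R.
  by rewrite levV// andbT !mulr_ge0 ?sqrtr_ge0 ?exprn_ge0//; lra.
apply: (@prob_leS _ _ _ _ _ _ ((size (iota 0 (2 ^ l).+1))%:R *
   ((size (iota 0 (2 ^ l).+1))%:R * e l)) _ (@subset_refl _ _)).
  rewrite size_iota /e -natr1 natrX.
  have -> : 4 ^+ l = 2 ^+ l * 2 ^+ l :> R by rewrite -exprMn; congr (_ ^+ _); ring.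
  have p1 : 1 <= 2 ^+ l :> R by rewrite exprn_ege1// ler1n.
  have q0 : 0 < j%:R ^+ 8 :> R by rewrite exprn_gt0//; lra.
  move: (2 ^+ l) (j%:R ^+ 8) p1 q0 => x y x1 y0.
  rewrite -subr_ge0.
  have -> : 16 / y - (x + 1) * ((x + 1) * (4 * ((x * x)^-1 / y))) =
    4 * ((2 * x - (x + 1)) * (2 * x + (x + 1))) / (x * x * y).
    by field; rewrite !gt_eqF//; lra.
  by rewrite divr_ge0 ?mulr_ge0//; lra.
apply: prob_le_ex => a; rewrite mem_iota add0n ltnS => /andP[_ a2].
apply: prob_le_ex => c; rewrite mem_iota add0n ltnS => /andP[_ c2].
have /andP[c0 c1] := node01 c2.
rewrite (_ : e l = 2 * ((4 ^+ l)^-1 * (j%:R ^+ 8)^-1) + 2 * ((4 ^+ l)^-1 * (j%:R ^+ 8)^-1)); last first.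
  by rewrite /e; ring.
apply: prob_leU.
  apply: (@prob_leS _ _ _ _ _ _ _ _ (@subset_refl _ _))
    (csum_bern hb hind hF hFQ (V := (tau j l)%:R) _ _ V0 hz).
  - by rewrite ler_pM2l.
  - exact: node01.
  - by rewrite mulSn addnK ler_piMr.
have [c2'|c2'] := ltnP c (2 ^ l); last first.
  exists set0; split => //; first by move=> t [].
  by rewrite measure0 lee_fin !mulr_ge0// invr_ge0 exprn_ge0.
have /andP[_ c1'] := node01 c2'.
apply: (@prob_leS _ _ _ _ _ _ _ _ _)
    (csum2_bern hb hind hF hFQ (m := 0) (n := a * tau j l) (V := (tau j l)%:R) c0 (nodeS _ _) c1' _ V0 hz).
- by move=> t [].
- by rewrite ler_pM2l.
- rewrite subn0 /node -mulrBl -natr1 addrAC subrr add0r natrM mul1r mulrAC ler_piMl//.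
  by rewrite ler_pdivrMr ?exprn_gt0// mul1r -natrX ler_nat.
Qed.

(** Dropping the last binary digits of a and c moves a grid point of level l+1 to level l at the
    price of at most one time block and one spatial cell, each bounded by [lev j l.+1]. The
    right-hand side is the geometric sum of 2 [lev j i] over i <= l. *)
Lemma chain j t : ~ bad j t -> forall l a c, (l <= j)%N -> (a <= 2 ^ l)%N -> (c <= 2 ^ l)%N ->
  `|csum b Q 0 (a * tau j l) (node l c) t| <= 16 * lev j 0 * (1 - (7 / 8) ^+ l.+1).
Proof.
move=> nbad.
have time l a c : (l <= j)%N -> (a <= 2 ^ l)%N -> (c <= 2 ^ l)%N ->
  `|csum b Q (a * tau j l) (a.+1 * tau j l) (node l c) t| <= lev j l.
  move=> lj a2 c2; rewrite leNgt; apply/negP => /ltW H; apply: nbad.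
  exists l; first by rewrite mem_iota add0n ltnS.
  exists a; first by rewrite mem_iota add0n ltnS.
  by exists c; [rewrite mem_iota add0n ltnS|left].
have space l a c : (l <= j)%N -> (a <= 2 ^ l)%N -> (c < 2 ^ l)%N ->
  `|csum2 b Q 0 (a * tau j l) (node l c) (node l c.+1) t| <= lev j l.
  move=> lj a2 c2; rewrite leNgt; apply/negP => /ltW H; apply: nbad.
  exists l; first by rewrite mem_iota add0n ltnS.
  exists a; first by rewrite mem_iota add0n ltnS.
  by exists c; [rewrite mem_iota add0n ltnS (ltnW c2)|right].
have lev0 : 0 <= lev j 0 by rewrite !mulr_ge0 ?sqrtr_ge0 ?exprn_ge0.
elim=> [|l IH] a c lj.
  rewrite expn0 => a1 c1.
  have -> : 16 * lev j 0 * (1 - (7 / 8) ^+ 1) = 2 * lev j 0 by rewrite expr1; field.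
  case: a a1 => [_|[_|//]]; first by rewrite mul0n /csum big_geq// normr0 mulr_ge0.
  by have := time 0 0 c lj isT c1; rewrite mul0n; lra.
move=> a2 c2.
(* A block of level l is two blocks of level l+1, so the even indices of the finer grid form the
   coarser grid. *)
have tauE : tau j l = (2 * tau j l.+1)%N.
  rewrite /tau -expnS; congr (2 ^ _)%N; rewrite -subSn ?subSS//.
  by rewrite (leq_trans lj)// leq_pmull.
have ah : (a./2 <= 2 ^ l)%N by rewrite -(doubleK (2 ^ l)%N) half_leq// -mul2n -expnS.
have ch : (c./2 <= 2 ^ l)%N by rewrite -(doubleK (2 ^ l)%N) half_leq// -mul2n -expnS.
have := IH a./2 c./2 (ltnW lj) ah ch.
have -> : (a./2 * tau j l)%N = (a./2.*2 * tau j l.+1)%N by rewrite tauE mulnA muln2.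
have -> : node l c./2 = node l.+1 c./2.*2.
  by rewrite /node -muln2 natrM exprS; field; rewrite expf_neq0.
have a2' : (a./2.*2 <= a)%N by rewrite -{2}(odd_double_half a) leq_addl.
have c2' : (c./2.*2 <= c)%N by rewrite -{2}(odd_double_half c) leq_addl.
have levS : lev j l.+1 = lev j 0 * (7 / 8) ^+ l.+1 by rewrite /lev expr0 mulr1.
have Hs : `|csum b Q 0 (a./2.*2 * tau j l.+1) (node l.+1 c) t| <=
  `|csum b Q 0 (a./2.*2 * tau j l.+1) (node l.+1 c./2.*2) t| + lev j l.+1.
  rewrite -{1}(odd_double_half c); case oc: (odd c); last first.
    by rewrite add0n lerDl levS mulr_ge0// exprn_ge0.
  have cl : (c./2.*2 < 2 ^ l.+1)%N.
    by apply: leq_trans c2; rewrite -{2}(odd_double_half c) oc.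
  have /andP[? _] := node01 (ltnW cl); have /andP[_ ?] := node01 cl.
  rewrite add1n (csum2E hb hF hFQ _ _ _ _ (nodeS l.+1 c./2.*2))//.
  apply: le_trans (ler_normD _ _) _; rewrite lerD2l.
  by apply: space => //; exact: leq_trans a2' a2.
have Ht : `|csum b Q 0 (a * tau j l.+1) (node l.+1 c) t| <=
  `|csum b Q 0 (a./2.*2 * tau j l.+1) (node l.+1 c) t| + lev j l.+1.
  rewrite -{1}(odd_double_half a); case: (odd a); last first.
    by rewrite add0n lerDl levS mulr_ge0// exprn_ge0.
  rewrite add1n (@csum_cat _ _ _ b Q 0 (a./2.*2 * tau j l.+1))//; last by rewrite leq_mul2r leqnSn orbT.
  apply: le_trans (ler_normD _ _) _; rewrite lerD2l.
  by apply: time => //; exact: leq_trans a2' a2.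
move=> H; apply: le_trans Ht _; apply: le_trans (lerD Hs (lexx _)) _.
apply: le_trans (lerD (lerD H (lexx _)) (lexx _)) _.
rewrite levS [(7 / 8) ^+ l.+2]exprS; move: ((7 / 8) ^+ l.+1) (lev j 0) => x y.
by rewrite le_eqVlt; apply/orP; left; apply/eqP; field.
Qed.

Let csum_bnd m n (u : R) t : 0 <= u <= 1 -> `|csum b Q m n u t| <= (n - m)%N%:R.
Proof.
move=> /andP[u0 u1]; apply: le_trans (ler_norm_sum _ _ _) _.
rewrite -[leRHS]mulr1 mulr_natl -sumr_const_nat; apply: ler_sum => i _.
by rewrite ler_norml; case: (b i t <= Q u); rewrite /= ?mulr1n ?mulr0n; apply/andP; split; lra.
Qed.

(** At level j the blocks have length 2^j and the cells width 2^-j, so leaving the grid costs at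
    most 2^j in time, trivially, and at most 2^j in space, by monotonicity and n <= 4^j. Hence 130:
    16 times 8 from the chain, plus 2. *)
Lemma csum_sup j t n (u : R) : (196 <= j)%N -> ~ bad j t -> (n <= 4 ^ j)%N -> 0 <= u <= 1 ->
  `|csum b Q 0 n u t| <= 130 * 2 ^+ j * Num.sqrt (ln j%:R).
Proof.
move=> j196 nbad nj /andP[u0 u1].
have l1 := lnj0 j196.
have y1 : 1 <= Num.sqrt (ln j%:R) :> R by rewrite -[leLHS]sqrtr1 ler_wsqrtr.
have p0 : 0 < 2 ^+ j :> R by rewrite exprn_gt0.
have tj : tau j j = (2 ^ j)%N by rewrite /tau mul2n -addnn addnK.
have lev0 : lev j 0 = 8 * 2 ^+ j * Num.sqrt (ln j%:R) by rewrite /lev expr0 mulr1.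
have at_node c : (c <= 2 ^ j)%N ->
    `|csum b Q 0 n (node j c) t| <= 128 * 2 ^+ j * Num.sqrt (ln j%:R) + 2 ^+ j.
  move=> c2; pose a := (n %/ 2 ^ j)%N.
  have n2 : (a * 2 ^ j <= n)%N by exact: leq_divM.
  have a2 : (a <= 2 ^ j)%N.
    by rewrite -[leqRHS](@mulnK _ (2 ^ j)) ?expn_gt0// leq_div2r// -expnMn.
  rewrite (@csum_cat _ _ _ b Q 0 (a * 2 ^ j))//.
  apply: le_trans (ler_normD _ _) (lerD _ _).
    have := chain nbad (leqnn j) a2 c2; rewrite tj lev0 => /le_trans; apply.
    rewrite (_ : 128 * _ * _ = 16 * (8 * 2 ^+ j * Num.sqrt (ln j%:R)) * 1); last by ring.
    by rewrite ler_wpM2l ?gerBl ?exprn_ge0// !mulr_ge0 ?sqrtr_ge0 ?ltW.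
  apply: le_trans (csum_bnd _ _ _ (node01 c2)) _.
  rewrite -natrX ler_nat leq_subLR {1}(divn_eq n (2 ^ j)) leq_add2l.
  by rewrite ltnW// ltn_mod expn_gt0.
suff: `|csum b Q 0 n u t| <= (128 * 2 ^+ j * Num.sqrt (ln j%:R) + 2 ^+ j) + 2 ^+ j.
  by move: (Num.sqrt (ln j%:R) : R) y1 (2 ^+ j) p0 => y y1 x x0 /le_trans; apply; nra.
pose c := Num.truncn (u * 2 ^+ j).
have /andP[cu uc] : c%:R <= u * 2 ^+ j < c.+1%:R.
  by apply: truncn_itv; rewrite mulr_ge0// ltW.
have [c2|c2] := ltnP c (2 ^ j); last first.
  have -> : u = node j (2 ^ j).
    apply/eqP; rewrite eq_le /node natrX divff ?gt_eqF// u1 /=.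
    by rewrite -(ler_pM2r p0) mul1r; apply: le_trans cu; rewrite -natrX ler_nat.
  by apply: le_trans (at_node _ (leqnn _)) _; rewrite lerDl ltW.
have /andP[c0 c1] := node01 (ltnW c2); have /andP[_ c1'] := node01 c2.
have lo : node j c <= u by rewrite ler_pdivrMr.
have hi : u <= node j c.+1 by rewrite ler_pdivlMr// ltW.
(* The indicators can only increase with the level; what may be lost is the centring n (w - v) <=
   2^j. *)
have mono (v w : R) : 0 <= v -> v <= w -> w <= 1 -> w - v <= (2 ^+ j)^-1 ->
    csum b Q 0 n v t - 2 ^+ j <= csum b Q 0 n w t.
  move=> v0 vw w1 wv; rewrite (csum2E hb hF hFQ _ _ _ v0 vw w1) lerD2l.
  rewrite lerNl -sumrN.
  apply: (@le_trans _ _ (\sum_(0 <= i < n) (2 ^+ j)^-1)).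
    apply: ler_sum => i _; rewrite opprB; apply: le_trans wv; rewrite gerBl.
    by case: (_ && _).
  rewrite sumr_const_nat subn0 -[leLHS]mulr_natl ler_pdivrMr// -exprD addnn -mul2n exprM.
  by rewrite -natrX -natrX ler_nat.
have gap : node j c.+1 - node j c = (2 ^+ j)^-1.
  by rewrite /node -mulrBl -natr1 addrAC subrr add0r mul1r.
have A := at_node c (ltnW c2); have B := at_node _ c2.
have M1 := mono _ _ c0 lo u1 _; have M2 := mono _ _ u0 hi c1' _.
rewrite ler_norml; apply/andP; split.
  move: A M1; rewrite ler_norml => /andP[A _] /(_ _) M1.
  have := M1 _; lra.
move: B M2; rewrite ler_norml => /andP[_ B] M2.
have := M2 _; lra.
Qed.

(** Use j = k + 1 where 4^k <= n < 4^(k+1): then 2^j <= 2 sqrt n and log j <= 2 loglog n, and 130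
    times 2 times 3/2 is below 400. *)
Lemma iterated_log_law : {ae P, forall t, \forall n \near \oo, forall u : R, 0 <= u <= 1 ->
  `|csum b Q 0 n u t| <= 400 * Num.sqrt (n%:R * ln (ln n%:R))}.
Proof.
have : {ae P, forall t, \forall j \near \oo, ~ bad j t}.
  by apply: (prob_le_BC (C := 32)); exists 196%N => // j /= j196; exact: prob_bad.
apply: filterS => t [j0 _ Hj0].
exists (4 ^ (maxn 196 j0))%N => // n /= nj u u01.
pose k := trunc_log 4 n.
have n0 : (0 < n)%N by apply: leq_trans nj; rewrite expn_gt0.
have /andP[kn nk] := trunc_log_bounds (isT : 1 < 4)%N n0.
rewrite -/k in kn nk.
have kk : (maxn 196 j0 <= k)%N.
  by apply: trunc_log_max.
move: kk; rewrite geq_max => /andP[k196 kj].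
have k0 : 0 < k%:R :> R by rewrite ltr0n (leq_trans _ k196).
have kR : 196 <= k%:R :> R by rewrite ler_nat.
have nR : 0 < n%:R :> R by rewrite ltr0n.
have nb : ~ bad k.+1 t by apply: Hj0; exact: leqW.
apply: le_trans (csum_sup (leqW k196) nb (ltnW nk) u01) _.
have lnk : k%:R <= ln n%:R :> R.
  have : ln (4 ^+ k) <= ln n%:R :> R.
    by rewrite ler_ln ?posrE ?exprn_gt0// -natrX ler_nat.
  apply: le_trans; rewrite lnXn// -[leRHS]mulr_natl ler_peMr//.
  rewrite -[leLHS]expRK ler_ln ?posrE ?expR_gt0//.
  by apply: le_trans (expR_le_quad _) _; rewrite ?normr1//; lra.
have lnkS : ln k.+1%:R <= 2 * ln (ln n%:R) :> R.
  apply: (@le_trans _ _ (ln (k%:R ^+ 2))).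
    have kS : k.+1%:R <= k%:R ^+ 2 :> R by rewrite -natr1; nra.
    by rewrite ler_ln// posrE ?exprn_gt0.
  rewrite lnXn// -[leLHS]mulr_natl ler_wpM2l// ler_ln ?posrE//; last exact: lt_le_trans lnk.
have l0 : 0 <= ln (ln n%:R) :> R by apply: ln_ge0; lra.
have E : 2 ^+ k.+1 <= 2 * Num.sqrt n%:R :> R.
  rewrite exprS ler_pM2l// -(@ler_pXn2r _ 2)// ?nnegrE ?exprn_ge0 ?sqrtr_ge0//.
  by rewrite sqr_sqrtr// -exprM mulnC exprM -!natrX ler_nat.
have G : Num.sqrt (ln k.+1%:R) <= 3 / 2 * Num.sqrt (ln (ln n%:R)) :> R.
  rewrite -(@ler_pXn2r _ 2)// ?nnegrE ?mulr_ge0 ?sqrtr_ge0//.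
  rewrite exprMn !sqr_sqrtr//; last by rewrite ln_ge0// ler1n.
  by apply: le_trans lnkS _; rewrite ler_wpM2r//; lra.
rewrite sqrtrM//; apply: (@le_trans _ _ (130 * (2 * Num.sqrt n%:R) * (3 / 2 * Num.sqrt (ln (ln n%:R))))).
  by apply: ler_pM; rewrite ?mulr_ge0 ?exprn_ge0 ?sqrtr_ge0// ler_pM2l.
have : 0 <= Num.sqrt n%:R * Num.sqrt (ln (ln n%:R)) :> R by rewrite mulr_ge0 ?sqrtr_ge0.
by lra.
Qed.

End IteratedLogarithm.

(** * Sums supported on a window of integers *)

Section WindowSums.
Context {R : realType}.

Lemma sum_window_ind (x y : R) n : x <= y + 1 ->
  \sum_(0 <= j < n) (x <= j%:R <= y)%R%:R <= y - x + 1.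
Proof.
move=> xy.
(* Truncating y at n - 1 and the bound at 0 gives a statement that holds for every prefix and so
   passes the induction. *)
suff : \sum_(0 <= j < n) (x <= j%:R <= y)%R%:R <= Num.max 0 (Num.min (n%:R - 1) y - x + 1).
  by move/le_trans; apply; rewrite ge_max; apply/andP; split; [lra|];
    rewrite lerD2r lerD2r ge_min lexx orbT.
elim: n => [|n IH]; first by rewrite big_geq// le_max lexx.
rewrite big_nat_recr//=; move: IH; rewrite -natr1 addrK.
move: (\sum_(0 <= i < n) _) => S; rewrite !le_max => H.
case: (leP x n%:R) => xn /=; case: (leP n%:R y) => ny /=; rewrite ?mulr1n ?mulr0n ?addr0.
- move: H; have [a|a] := leP (n%:R - 1) y; last by lra.
  move=> /orP[H|H]; apply/orP; right; lra.
- move: H; have [a|a] := leP (n%:R - 1) y; move=> /orP[->//|H]; apply/orP; right; lra.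
- move: H; have [a|a] := leP (n%:R - 1) y; last by lra.
  by move=> /orP[->//|H]; apply/orP; left; lra.
- move: H; have [a|a] := leP (n%:R - 1) y; move=> /orP[->//|H]; apply/orP; right; lra.
Qed.

Lemma sum_window (f : nat -> R) (c x y : R) n : x <= y + 1 -> 0 <= c ->
  (forall j, (j < n)%N -> `|f j| <= c) ->
  (forall j, (j < n)%N -> f j != 0 -> x <= j%:R <= y) ->
  `|\sum_(0 <= j < n) f j| <= c * (y - x + 1).
Proof.
move=> xy c0 fc fw; apply: le_trans (ler_norm_sum _ _ _) _.
apply: (@le_trans _ _ (\sum_(0 <= j < n) c * (x <= j%:R <= y)%R%:R)).
  apply: ler_sum_nat => j /= jn.
  have [->|f0] := eqVneq (f j) 0; first by rewrite normr0 mulr_ge0.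
  by rewrite fw// mulr1 fc.
by rewrite -mulr_sumr ler_wpM2l// sum_window_ind.
Qed.

End WindowSums.

(** * A sorted uniform sample against the grid, and the kernel averages *)

Section OrderedSample.
Context {R : realType}.
Variables (n : nat) (V : nat -> R).
Hypothesis n0 : (0 < n)%N.
Hypothesis Vmono : forall k l, (k <= l)%N -> (l < n)%N -> V k <= V l.
Hypothesis V0 : forall k, (k < n)%N -> 0 < V k.
Hypothesis V1 : forall k, (k < n)%N -> V k <= 1.

Let nR : 0 < n%:R :> R. Proof. by rewrite ltr0n. Qed.

(** n times the empirical distribution function of the sample, where [V k] stands for U_(k+1).
    [gcnt] restricts it to the grid j/n, where the iterated logarithm and modulus bounds are
    available. *)
Definition cnt (x : R) : R := \sum_(0 <= k < n) (V k <= x)%R%:R.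
Definition gcnt j : R := cnt (j%:R / n%:R).

Lemma cnt_ge k x : (k < n)%N -> V k <= x -> k.+1%:R <= cnt x.
Proof.
move=> kn Vx; rewrite /cnt (big_cat_nat (leq0n k.+1) kn)/=.
rewrite (eq_big_nat _ _ (F2 := fun=> 1)); last first.
  by move=> i; rewrite ltnS => /andP[_ ik]; rewrite (le_trans (Vmono ik kn) Vx).
by rewrite sumr_const_nat subn0 lerDl sumr_ge0.
Qed.

Lemma cnt_le k x : (k < n)%N -> x < V k -> cnt x <= k%:R.
Proof.
move=> kn Vx; rewrite /cnt (big_cat_nat (leq0n k) (ltnW kn))/=.
rewrite [X in _ + X]big1_seq ?addr0; last first.
  move=> i; rewrite mem_index_iota => /andP[_ /andP[ki iN]].
  by rewrite leNgt (lt_le_trans Vx (Vmono ki iN)).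
apply: (@le_trans _ _ (\sum_(0 <= i < k) 1)); last by rewrite sumr_const_nat subn0.
by apply: ler_sum => i _; rewrite lern1 leq_b1.
Qed.

Lemma grid_above (x : R) (m : nat) : (0 < m)%N -> 0 < x -> x <= 1 ->
  exists i, [/\ (i < m)%N, i%:R / m%:R < x & x <= i.+1%:R / m%:R].
Proof.
move=> m0 x0 x1; have mR : 0 < m%:R :> R by rewrite ltr0n.
have ex : exists i, (m%:R * x <= i%:R) by exists m; rewrite ler_piMr// ltW.
case: (ex_minnP ex) => -[|i] mi imin; first by move: mi; rewrite leNgt mulr_gt0.
exists i; split.
- by apply: imin; rewrite ler_piMr// ltW.
- rewrite ltr_pdivrMr// ltNge mulrC; apply/negP => /imin; by rewrite ltnn.
- by rewrite ler_pdivlMr// mulrC.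
Qed.

(** The grid cell containing [V j] encloses its rank between two values of [gcnt]; this replaces
    inverting the empirical distribution function. *)
Lemma rank_cell j : (j < n)%N -> exists i,
  [/\ (i < n)%N, i%:R < n%:R * V j, n%:R * V j <= i.+1%:R, gcnt i <= j%:R
    & j.+1%:R <= gcnt i.+1].
Proof.
move=> jn; have [i [iN iV Vi]] := grid_above n0 (V0 jn) (V1 jn).
exists i; split => //.
- by move: iV; rewrite ltr_pdivrMr// mulrC.
- by move: Vi; rewrite ler_pdivlMr// mulrC.
- exact: cnt_le.
- exact: cnt_ge.
Qed.

Variables (Lam lam : R).
Hypothesis lam1 : 1 <= lam.
Hypothesis Lam0 : 0 <= Lam.
Hypothesis hlil : forall j, (j <= n)%N -> `|gcnt j - j%:R| <= Lam.

Definition osc (x : R) : R := Num.sqrt (32 * (x + 2 * lam) * lam).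
Hypothesis hosc : forall i j, (i <= j <= n)%N ->
  `|gcnt j - gcnt i - (j%:R - i%:R)| <= osc (j%:R - i%:R).

Lemma osc_le x y : x <= y -> osc x <= osc y.
Proof.
have l0 : 0 <= lam by exact: le_trans ler01 lam1.
move=> xy; apply: ler_wsqrtr; rewrite ler_wpM2r//.
by rewrite ler_wpM2l// lerD2r.
Qed.

Lemma hosc_sym i j (D : R) : (i <= n)%N -> (j <= n)%N -> `|j%:R - i%:R| <= D ->
  `|gcnt j - gcnt i - (j%:R - i%:R)| <= osc D.
Proof.
move=> iN jN ijD; have [ij|/ltnW ji] := leqP i j.
  apply: le_trans (hosc _) _; first by rewrite ij.
  by apply: osc_le; apply: le_trans ijD; exact: ler_norm.
rewrite distrC (_ : j%:R - i%:R - _ = gcnt i - gcnt j - (i%:R - j%:R)); last by ring.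
apply: le_trans (hosc _) _; first by rewrite ji.
by apply: osc_le; apply: le_trans ijD; rewrite distrC; exact: ler_norm.
Qed.

Lemma quantile_dev j : (j < n)%N -> `|n%:R * V j - j.+1%:R| <= Lam + 1.
Proof.
move=> jn; have [i [iN iV Vi Nl Nu]] := rank_cell jn.
have := hlil (ltnW iN); have := hlil iN.
rewrite -!natr1 in Vi Nu *.
rewrite !ler_norml => /andP[A1 A2] /andP[B1 B2]; by apply/andP; split; lra.
Qed.

(** If [V j] lies in cell i, then n V j is about i and gcnt i about j, so n V j - j is about -(gcnt
    i - i). As |i - j| <= Lam + 2, replacing i by j costs osc (Lam + 2). *)
Lemma bahadur_kiefer j : (j < n)%N ->
  `|n%:R * V j - j.+1%:R + (gcnt j - j%:R)| <= osc (Lam + 2) + 2.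
Proof.
move=> jn; have [i [iN iV Vi Nl Nu]] := rank_cell jn.
have := hlil (ltnW iN); have := hlil iN.
have iS : i.+1%:R = i%:R + 1 :> R by rewrite natr1.
have jS : j.+1%:R = j%:R + 1 :> R by rewrite natr1.
rewrite !ler_norml iS jS => /andP[A1 A2] /andP[B1 B2].
rewrite iS jS in Vi Nu.
have O1 : `|gcnt i - gcnt j - (i%:R - j%:R)| <= osc (Lam + 2).
  apply: hosc_sym; rewrite ?(ltnW jn) ?(ltnW iN)//.
  by rewrite ler_norml; apply/andP; split; lra.
have O2 : `|gcnt i.+1 - gcnt j - (i.+1%:R - j%:R)| <= osc (Lam + 2).
  apply: hosc_sym; rewrite ?(ltnW jn)// iS.
  by rewrite ler_norml; apply/andP; split; lra.
move: O1 O2; rewrite !ler_norml iS => /andP[C1 C2] /andP[D1 D2].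
by apply/andP; split; lra.
Qed.

Section Kernel.
Variables (g : R -> R) (u h ell : R).
Hypothesis h0 : 0 < h.
Hypothesis hu : h <= u <= 1 - h.
Hypothesis ell0 : 0 <= ell.
Hypothesis g_lip : forall x y, `|g x - g y| <= ell * `|x - y|.
Hypothesis g_supp : forall x, h <= `|x - u| -> g x = 0.

Let gn j := g (j%:R / n%:R).
Let dg j := gn j - gn j.+1.
Let H := n%:R * h.

Definition spacing_avg : R := \sum_(1 <= i < n) gn i * (V i - V i.-1).
Definition density_avg : R := n%:R^-1 * \sum_(0 <= k < n) g (V k).
Definition grid_avg : R := n%:R^-1 * \sum_(0 <= j < n) gn j.+1.
(** The density average with every sample point moved to the right end of its grid cell; being
    expressed through [gcnt], it admits summation by parts on the grid. *)
Definition cell_avg : R := n%:R^-1 * \sum_(0 <= j < n) gn j.+1 * (gcnt j.+1 - gcnt j).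

Let H0 : 0 < H. Proof. by rewrite mulr_gt0. Qed.

Let gn0 : gn 0 = 0.
Proof.
apply: g_supp; rewrite mul0r add0r normrN; move: hu => /andP[? _].
by apply: le_trans (ler_norm _).
Qed.

Let gnn : gn n = 0.
Proof.
apply: g_supp; rewrite divff ?gt_eqF//; move: hu => /andP[_ ?].
by apply: le_trans (ler_norm _); lra.
Qed.

(** No boundary terms appear: u lies in [h, 1 - h], so the kernel vanishes at both ends of the
    grid. *)
Let abel (x : nat -> R) :
  \sum_(0 <= j < n) gn j.+1 * (x j.+1 - x j) = \sum_(0 <= j < n) dg j * x j.
Proof.
apply/eqP; rewrite -subr_eq0 -sumrB; apply/eqP.
rewrite (eq_bigr (fun j => gn j.+1 * x j.+1 - gn j * x j)); last first.
  by move=> j _; rewrite /dg; ring.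
by rewrite telescope_sumr// gn0 gnn !mul0r subrr.
Qed.

Let grid_avgE : grid_avg = \sum_(0 <= j < n) dg j * (j%:R / n%:R).
Proof.
rewrite -abel /grid_avg mulr_sumr; apply: eq_bigr => j _.
by rewrite -mulrBl -natr1 addrAC subrr add0r mul1r mulrC.
Qed.

Let sum_dg : \sum_(0 <= j < n) dg j = 0.
Proof.
rewrite (eq_bigr (fun j => - (gn j.+1 - gn j))); last by move=> j _; rewrite opprB.
by rewrite sumrN telescope_sumr// gn0 gnn subrr oppr0.
Qed.

(** The weights [dg] sum to 0, so their arguments may be recentred freely. This absorbs the shift
    between j and j + 1 and lets increments be measured from a grid point next to u. *)
Let sum_dg_shift (x y : nat -> R) (c : R) : (forall j, x j = y j - c) ->
  \sum_(0 <= j < n) dg j * y j = \sum_(0 <= j < n) dg j * x j.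
Proof.
move=> xy; under [RHS]eq_bigr do rewrite xy mulrBr.
by rewrite sumrB -mulr_suml sum_dg mul0r subr0.
Qed.

Let spacing_avgE : spacing_avg = \sum_(0 <= j < n) dg j * V j.
Proof.
rewrite -abel /spacing_avg; case: n n0 gnn => // m _ gm.
by rewrite big_add1 /= [RHS]big_nat_recr//= gm mul0r addr0.
Qed.

Let cell_avgE : cell_avg = \sum_(0 <= j < n) dg j * (gcnt j / n%:R).
Proof.
rewrite -abel /cell_avg mulr_sumr; apply: eq_bigr => j _; by field; rewrite gt_eqF.
Qed.

Let dg_le j : `|dg j| <= ell / n%:R.
Proof.
apply: le_trans (g_lip _ _) _; apply: ler_wpM2l => //.
rewrite -mulrBl -natr1 opprD addrA subrr add0r mulN1r normrN.
by rewrite ger0_norm.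
Qed.

Let gn_supp j : gn j != 0 -> n%:R * u - H <= j%:R <= n%:R * u + H.
Proof.
apply: contraNT => nj; apply/eqP/g_supp; rewrite leNgt; apply: contra nj.
rewrite ltr_norml => /andP[j1 j2].
have A : (u - h) * n%:R <= j%:R by rewrite -ler_pdivlMr//; lra.
have B : j%:R <= (u + h) * n%:R by rewrite -ler_pdivrMr//; lra.
by rewrite /H; apply/andP; split; lra.
Qed.

Let dg_supp j : dg j != 0 -> n%:R * u - H - 1 <= j%:R <= n%:R * u + H.
Proof.
move=> dj; have : (gn j != 0) || (gn j.+1 != 0).
  by apply: contraNT dj; rewrite negb_or !negbK /dg => /andP[/eqP -> /eqP ->]; rewrite subrr.
by move=> /orP[] /gn_supp; rewrite -?natr1 => /andP[? ?]; apply/andP; split; lra.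
Qed.

Let sum_dg_le (x : nat -> R) (D : R) : 0 <= D ->
  (forall j, (j < n)%N -> dg j != 0 -> `|x j| <= D) ->
  `|\sum_(0 <= j < n) dg j * x j| <= ell / n%:R * D * (2 * H + 2).
Proof.
move=> D0 xD.
rewrite (_ : 2 * H + 2 = (n%:R * u + H) - (n%:R * u - H - 1) + 1); last by ring.
apply: sum_window.
- by have := H0; lra.
- by rewrite !mulr_ge0// invr_ge0 ltW.
- move=> j jn; have [->|dj] := eqVneq (dg j) 0.
    by rewrite mul0r normr0 !mulr_ge0// invr_ge0 ltW.
  by rewrite normrM; apply: ler_pM => //; exact: xD.
- by move=> j jn; rewrite mulf_eq0 negb_or => /andP[/dg_supp].
Qed.

(** Summation by parts gives [dg j] the factor V j + gcnt j / n - 2j/n, which up to the constant 1/n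
    is a sum controlled by [bahadur_kiefer]; at most 2H + 2 of the weights are nonzero. *)
Lemma avg_cancel : `|spacing_avg + cell_avg - 2 * grid_avg| <=
  ell / n%:R * ((osc (Lam + 2) + 2) / n%:R) * (2 * H + 2).
Proof.
have -> : spacing_avg + cell_avg - 2 * grid_avg = \sum_(0 <= j < n) dg j *
    ((n%:R * V j - j.+1%:R + (gcnt j - j%:R)) / n%:R).
  rewrite spacing_avgE cell_avgE grid_avgE mulr_sumr -big_split -sumrB /=.
  rewrite (eq_bigr (fun j => dg j * (V j + gcnt j / n%:R - 2 * (j%:R / n%:R)))); last first.
    by move=> j _; ring.
  apply: (sum_dg_shift (c := n%:R^-1)) => j.
  by rewrite -[j.+1%:R]natr1; field; rewrite gt_eqF.
apply: sum_dg_le; first by rewrite divr_ge0// ?addr_ge0 ?sqrtr_ge0// ltW.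
move=> j jn _; rewrite normrM (@ger0_norm _ n%:R^-1) ?invr_ge0 ?(ltW nR)//.
by rewrite ler_wpM2r ?invr_ge0 ?(ltW nR)// bahadur_kiefer.
Qed.

(** Recentring at the grid point just below u leaves increments over distances at most H + 2,
    bounded by the modulus instead of the global deviation [Lam]. *)
Lemma cell_avg_dev : `|cell_avg - grid_avg| <=
  ell / n%:R * (osc (H + 2) / n%:R) * (2 * H + 2).
Proof.
pose i := Num.truncn (n%:R * u).
have nu0 : 0 <= n%:R * u by move: hu h0 => /andP[? _] ?; rewrite mulr_ge0//; lra.
have /andP[iu ui] : i%:R <= n%:R * u < i.+1%:R by exact: truncn_itv.
have iN : (i <= n)%N.
  rewrite -(ler_nat R); apply: le_trans iu _; rewrite ler_piMr// ?(ltW nR)//.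
  by move: hu h0 => /andP[_ ?] ?; lra.
have -> : cell_avg - grid_avg = \sum_(0 <= j < n) dg j *
    ((gcnt j - gcnt i - (j%:R - i%:R)) / n%:R).
  rewrite cell_avgE grid_avgE -sumrB.
  rewrite (eq_bigr (fun j => dg j * (gcnt j / n%:R - j%:R / n%:R))); last first.
    by move=> j _; ring.
  apply: (sum_dg_shift (c := (gcnt i - i%:R) / n%:R)) => j.
  by field; rewrite gt_eqF.
apply: sum_dg_le; first by rewrite divr_ge0// ?sqrtr_ge0// ltW.
move=> j jn /dg_supp /andP[j1 j2]; rewrite normrM (@ger0_norm _ n%:R^-1) ?invr_ge0 ?(ltW nR)//.
rewrite ler_wpM2r ?invr_ge0 ?(ltW nR)//; apply: hosc_sym => //; first exact: ltnW.
by rewrite -natr1 in ui; rewrite ler_norml; apply/andP; split; lra.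
Qed.

Lemma osc1 : osc 1 <= 10 * lam.
Proof.
have l0 : 0 <= lam by exact: le_trans ler01 lam1.
rewrite -(@ler_pXn2r _ 2)// ?nnegrE ?sqrtr_ge0 ?mulr_ge0//.
rewrite sqr_sqrtr; last by rewrite !mulr_ge0// addr_ge0// mulr_ge0.
by have := lam1; nra.
Qed.

(** Moving a point within its cell changes g by at most ell/n; a cell holds at most 1 + osc 1 <= 11
    lam points, and at most 2H + 2 cells meet the kernel window. *)
Lemma density_cell : `|density_avg - cell_avg| <=
  n%:R^-1 * (ell / n%:R * (11 * lam) * (2 * H + 2)).
Proof.
have l0 : 0 <= lam by exact: le_trans ler01 lam1.
pose ind j k : R := (V k <= j.+1%:R / n%:R)%R%:R - (V k <= j%:R / n%:R)%R%:R.
have le_grid j : j%:R / n%:R <= j.+1%:R / n%:R :> R.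
  by rewrite ler_pM2r ?invr_gt0// ler_nat.
have ind0 j k : 0 <= ind j k.
  rewrite /ind; have [a|a] := leP (V k) (j%:R / n%:R).
    by rewrite (le_trans a (le_grid j)) subrr.
  by rewrite subr0.
have ind_cell j k : ind j k != 0 -> j%:R / n%:R < V k <= j.+1%:R / n%:R.
  apply: contraNT; rewrite negb_and -leNgt -ltNge /ind => /orP[a|a].
    by rewrite a (le_trans a (le_grid j)) subrr.
  by rewrite leNgt a /= leNgt (le_lt_trans (le_grid j) a) subrr.
have sum_ind k : (k < n)%N -> \sum_(0 <= j < n) ind j k = 1.
  move=> kn; rewrite /ind telescope_sumr// divff ?gt_eqF// V1// mul0r.
  by rewrite leNgt V0// subr0.
have cellE j : gcnt j.+1 - gcnt j = \sum_(0 <= k < n) ind j k by rewrite sumrB.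
rewrite -mulrBr normrM (@ger0_norm _ n%:R^-1) ?invr_ge0 ?(ltW nR)//.
rewrite ler_wpM2l ?invr_ge0 ?(ltW nR)//.
have -> : \sum_(0 <= k < n) g (V k) - \sum_(0 <= j < n) gn j.+1 * (gcnt j.+1 - gcnt j) =
    \sum_(0 <= j < n) \sum_(0 <= k < n) ind j k * (g (V k) - gn j.+1).
  rewrite [X in _ = X](eq_bigr (fun j => \sum_(0 <= k < n) ind j k * g (V k) -
     gn j.+1 * (gcnt j.+1 - gcnt j))); last first.
    move=> j _; rewrite cellE mulr_sumr -sumrB; apply: eq_bigr => k _; by ring.
  rewrite sumrB; congr (_ - _); rewrite exchange_big /=; apply: eq_big_nat => k /= kn.
  by rewrite -mulr_suml sum_ind// mul1r.
rewrite (_ : 2 * H + 2 = (n%:R * u + H) - (n%:R * u - H - 1) + 1); last by ring.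
have e0 : 0 <= ell / n%:R by rewrite divr_ge0// ltW.
apply: sum_window.
- by have := H0; lra.
- by rewrite !mulr_ge0.
- move=> j jn; apply: le_trans (ler_norm_sum _ _ _) _.
  apply: (@le_trans _ _ (\sum_(0 <= k < n) ell / n%:R * ind j k)).
    apply: ler_sum_nat => k /= kn; have [->|/ind_cell] := eqVneq (ind j k) 0.
      by rewrite mul0r mulr0 normr0.
    move=> /andP[a c]; rewrite normrM (ger0_norm (ind0 j k)) mulrC ler_wpM2r//.
    apply: le_trans (g_lip _ _) _; apply: ler_wpM2l => //.
    rewrite distrC ger0_norm ?subr_ge0//; move: a c; rewrite -natr1 mulrDl mul1r; lra.
  rewrite -mulr_sumr ler_wpM2l// -cellE.
  have /= := hosc_sym (i := j) (j := j.+1) (D := 1) (ltnW jn) jn.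
  rewrite -natr1 addrAC subrr add0r normr1 => /(_ (lexx _)).
  by have := osc1; have := lam1; rewrite ler_norml => ? ? /andP[_ ?]; lra.
- move=> j jn; apply: contraNT => nj; apply/eqP.
  rewrite big1_seq// => k /= _; have [->|/ind_cell/andP[a c]] := eqVneq (ind j k) 0.
    by rewrite mul0r.
  suff [-> ->] : g (V k) = 0 /\ gn j.+1 = 0 by rewrite subrr mulr0.
  move: a c; rewrite ltr_pdivrMr// ler_pdivlMr// => a c.
  have out x : j%:R < x * n%:R -> x * n%:R <= j.+1%:R -> g x = 0.
    move=> jx xj; apply: g_supp; rewrite leNgt; apply: contra nj.
    rewrite ltr_norml => /andP[p1 p2]; rewrite /H; rewrite -natr1 in xj.
    have : (u - h) * n%:R < x * n%:R by rewrite ltr_pM2r//; lra.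
    have : x * n%:R < (u + h) * n%:R by rewrite ltr_pM2r//; lra.
    by move=> ? ?; apply/andP; split; lra.
  split; first exact: out.
  by apply: out; rewrite divfK ?gt_eqF// ltr_nat.
Qed.

End Kernel.

End OrderedSample.

(** * Lower bounds for spacings and linearization of the quantile function *)

Section SpacingBounds.
Context {R : realType}.
Variables (n : nat) (V : nat -> R).
Hypothesis n0 : (0 < n)%N.
Hypothesis Vmono : forall k l, (k <= l)%N -> (l < n)%N -> V k <= V l.
Hypothesis V0 : forall k, (k < n)%N -> 0 < V k.
Hypothesis V1 : forall k, (k < n)%N -> V k <= 1.

Let nR : 0 < n%:R :> R. Proof. by rewrite ltr0n. Qed.

Let dV i : (i < n)%N -> 0 <= V i - V i.-1.
Proof. by move=> iN; rewrite subr_ge0 Vmono// leq_pred. Qed.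

(** Only the spacings inside a window where g >= m are kept, and they telescope. *)
Lemma spacing_avg_ge (g : R -> R) (m x y : R) : (forall z, 0 <= g z) -> 0 <= m ->
  0 <= x -> x <= y -> y < 1 -> (forall z, x <= z <= y -> m <= g z) ->
  let s := Num.truncn (n%:R * x) in let e := Num.truncn (n%:R * y) in
  [/\ (s <= e)%N, (e < n)%N, n%:R * (y - x) - 1 <= (e - s)%N%:R
    & m * (V e - V s) <= spacing_avg n V g].
Proof.
move=> g0 m0 x0 xy y1 gm s e.
have /andP[s1 s2] : s%:R <= n%:R * x < s.+1%:R by apply: truncn_itv; rewrite mulr_ge0.
have y0 : 0 <= y by lra.
have /andP[e1 e2] : e%:R <= n%:R * y < e.+1%:R by apply: truncn_itv; rewrite mulr_ge0.
have se : (s <= e)%N by apply: le_truncn; rewrite ler_wpM2l.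
have en : (e < n)%N.
  by rewrite -(ltr_nat R); apply: le_lt_trans e1 _; rewrite gtr_pMr.
split => //.
  by rewrite natrB//; move: s1 e2; rewrite -natr1; lra.
rewrite /spacing_avg (@big_cat_nat _ _ _ e.+1)//= (@big_cat_nat _ _ _ s.+1)//=.
rewrite -addrA addrC -addrA; set X := \sum_(s.+1 <= i < e.+1) _.
apply: (@le_trans _ _ X); last first.
  rewrite lerDl addr_ge0// big_nat sumr_ge0// => i /andP[i1 i2]; rewrite mulr_ge0// dV//.
  exact: leq_trans i2 (leq_ltn_trans se en).
rewrite -telescope_sumr// mulr_sumr /X big_add1 /=.
apply: ler_sum_nat => i /andP[si ie]; apply: ler_wpM2r.
  by rewrite (dV (i := i.+1))//; exact: leq_ltn_trans en.
apply: gm; apply/andP; split.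
  rewrite ler_pdivlMr// mulrC ltW//; apply: lt_le_trans s2 _; by rewrite ler_nat.
by rewrite ler_pdivrMr// mulrC; apply: le_trans e1; rewrite ler_nat.
Qed.

(** Were the gap smaller than a cell, the points of ranks s to e, at least 65 of them, would fit in
    two adjacent cells, which together hold fewer than 64. *)
Lemma spacing_gap_cells (G s e : nat) : (0 < G)%N ->
  (forall i, (i < G)%N -> cnt n V (i.+1%:R / G%:R) - cnt n V (i%:R / G%:R) < 32) ->
  (64 <= e - s)%N -> (e < n)%N -> G%:R^-1 <= V e - V s.
Proof.
move=> G0 hG es en; have GR : 0 < G%:R :> R by rewrite ltr0n.
have se : (s <= e)%N by apply: ltnW; rewrite -subn_gt0; exact: leq_trans es.
have sn : (s < n)%N by exact: leq_ltn_trans en.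
have [i [iG i1 i2]] := grid_above G0 (V0 sn) (V1 sn).
have esR : s%:R + 64 <= e%:R :> R by rewrite -natrD ler_nat -leq_subRL.
rewrite leNgt; apply/negP => gap.
have c1 := cnt_le Vmono sn i1.
have hi := hG i iG.
have eS : e.+1%:R = e%:R + 1 :> R by rewrite natr1.
have [iG'|iG'] := ltnP i.+1 G.
  have c2 : e.+1%:R <= cnt n V (i.+2%:R / G%:R).
    apply: cnt_ge => //; move: i2; rewrite -[i.+2%:R]natr1 mulrDl mul1r; lra.
  have := hG i.+1 iG'; lra.
(* The last cell has no right neighbour, but no sample point exceeds 1. *)
have iE : i.+1 = G by apply/eqP; rewrite eqn_leq iG iG'.
have c2 : e.+1%:R <= cnt n V (i.+1%:R / G%:R).
  by apply: cnt_ge => //; rewrite iE divff ?gt_eqF// V1.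
lra.
Qed.

Variables (Lam lam : R).
Hypothesis lam1 : 1 <= lam.
Hypothesis Lam0 : 0 <= Lam.
Hypothesis hlil : forall j, (j <= n)%N -> `|gcnt n V j - j%:R| <= Lam.
Hypothesis hosc : forall i j, (i <= j <= n)%N ->
  `|gcnt n V j - gcnt n V i - (j%:R - i%:R)| <= osc lam (j%:R - i%:R).

Lemma osc_le_lin x : 0 <= x -> osc lam x <= x + 10 * lam.
Proof.
move=> x0; have l0 : 0 <= lam by exact: le_trans ler01 lam1.
rewrite -(@ler_pXn2r _ 2)// ?nnegrE ?sqrtr_ge0 ?addr_ge0 ?mulr_ge0//.
rewrite sqr_sqrtr; last by rewrite !mulr_ge0// addr_ge0// mulr_ge0.
rewrite -subr_ge0 (_ : _ - _ = (x - 6 * lam) ^+ 2); last by ring.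
exact: sqr_ge0.
Qed.

(** The cells of [V s] and [V e] enclose at least e - s + 1 points, while by [osc_le_lin] the
    modulus allows at most twice the number of cells plus 10 lam. *)
Lemma spacing_gap_osc (s e : nat) : (s <= e)%N -> (e < n)%N ->
  (e - s)%N%:R - 4 - 10 * lam <= 2 * (n%:R * (V e - V s)).
Proof.
move=> se en; have sn := leq_ltn_trans se en.
have [i [iN i1 i2 _ i3]] := rank_cell n0 Vmono V0 V1 en.
have [j [jN j1 j2 j3 _]] := rank_cell n0 Vmono V0 V1 sn.
have ji : (j <= i.+1)%N.
  rewrite -(ler_nat R); apply: le_trans (ltW j1) (le_trans _ i2).
  by rewrite ler_wpM2l// Vmono.
have := hosc (i := j) (j := i.+1); rewrite ji iN => /(_ isT).
have iR : j%:R <= i.+1%:R :> R by rewrite ler_nat.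
have D0 : 0 <= i.+1%:R - j%:R :> R by rewrite subr_ge0.
have := osc_le_lin D0; rewrite ler_norml natrB// => + /andP[_].
move: i2 i3 j2 iR; rewrite -[i.+1%:R]natr1 -[j.+1%:R]natr1 -[e.+1%:R]natr1; lra.
Qed.

(** Both sums carry the same nonnegative weights, so the error is relative to the spacing average
    and remains useful when that average is far from 1. [eta] is how far from u the sample points
    involved can lie. *)
Lemma weighted_spacing (g Q : R -> R) (u h qu Lq : R) : 0 < h ->
  (forall x, 0 <= g x) -> (forall x, h <= `|x - u| -> g x = 0) ->
  let eta := h + (Lam + 2) / n%:R in
  (forall x y, 0 <= x -> x <= y -> y <= 1 -> `|x - u| <= eta -> `|y - u| <= eta ->
     `|Q y - Q x - qu * (y - x)| <= Lq * eta * (y - x)) ->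
  `|\sum_(1 <= i < n) g (i%:R / n%:R) * (Q (V i) - Q (V i.-1)) - qu * spacing_avg n V g|
    <= Lq * eta * spacing_avg n V g.
Proof.
move=> h0 g0 gs eta hQ; rewrite /spacing_avg !mulr_sumr -sumrB.
apply: le_trans (ler_norm_sum _ _ _) _; apply: ler_sum_nat => i /andP[i1 iN].
have [->|gi] := eqVneq (g (i%:R / n%:R)) 0; first by rewrite !mul0r !mulr0 subrr normr0.
rewrite (_ : _ - _ = g (i%:R / n%:R) * (Q (V i) - Q (V i.-1) - qu * (V i - V i.-1))); last by ring.
rewrite normrM ger0_norm// mulrCA ler_wpM2l//.
have iN' : (i.-1 < n)%N by exact: leq_ltn_trans (leq_pred _) iN.
have iu : `|i%:R / n%:R - u| < h.
  by rewrite ltNge; apply: contra gi => /gs ->.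
have dev k x : `|n%:R * V k - x| <= Lam + 1 -> `|x - i%:R| <= 1 -> `|V k - u| <= eta.
  move=> Vx xi.
  have -> : V k - u = (n%:R * V k - x) / n%:R + (x - i%:R) / n%:R + (i%:R / n%:R - u).
    by field; rewrite gt_eqF.
  have nn : `|n%:R^-1| = n%:R^-1 :> R by rewrite ger0_norm.
  apply: le_trans (ler_normD _ _) _; rewrite /eta addrC lerD ?(ltW iu)//.
  apply: le_trans (ler_normD _ _) _; rewrite !normrM nn -mulrDl ler_wpM2r//; lra.
apply: hQ.
- exact/ltW/V0.
- by rewrite -subr_ge0 dV.
- exact: V1.
- apply: (dev _ i%:R); last by rewrite subrr normr0.
  by have := quantile_dev n0 Vmono V0 V1 hlil iN'; rewrite prednK.
- apply: (dev _ i.+1%:R); last by rewrite -natr1 addrAC subrr add0r normr1.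
  exact: (quantile_dev n0 Vmono V0 V1 hlil iN).
Qed.

End SpacingBounds.

(** * The kernel: integrals, a window of positivity, Riemann sums *)

Lemma Rintegral_sum_nat d (T : measurableType d) (R : realType)
    (mu : {measure set T -> \bar R}) (D : set T) (f : nat -> T -> R) m :
  measurable D -> (forall j, mu.-integrable D (EFin \o f j)) ->
  mu.-integrable D (EFin \o (fun x => \sum_(0 <= j < m) f j x)) /\
  \int[mu]_(x in D) (\sum_(0 <= j < m) f j x) = \sum_(0 <= j < m) \int[mu]_(x in D) f j x.
Proof.
move=> mD fi; elim: m => [|m [IHi IHe]].
  have -> : (fun x => \sum_(0 <= j < 0) f j x) = cst 0.
    by apply/funext => x; rewrite big_geq.
  by split; [exact: integrable0|rewrite Rintegral_cst// mul0r big_geq].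
have -> : (fun x => \sum_(0 <= j < m.+1) f j x) = (fun x => \sum_(0 <= j < m) f j x + f m x).
  by apply/funext => x; rewrite big_nat_recr.
split; first exact: (integrableD mD IHi (fi m)).
by rewrite RintegralD// IHe big_nat_recr.
Qed.

Section Kernel.
Context {R : realType}.
Local Notation mu := (@lebesgue_measure R).
Variables (K : R -> R) (L : R).
Hypothesis K0 : forall x : R, 0 <= K x.
Hypothesis K1 : (\int[lebesgue_measure]_x (K x)%:E = 1)%E.
Hypothesis Klip : forall x y, `|K x - K y| <= L * `|x - y|.
Hypothesis Ksupp : forall x : R, 1 < `|x| -> K x = 0.

Let L0 : 0 <= L.
Proof. by have := Klip 1 0; rewrite subr0 normr1 mulr1; apply: le_trans. Qed.

(** The support assumption says nothing at |x| = 1, and continuity settles it. For u = h or u = 1 -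
    h an end of [0,1] sits exactly on this boundary. *)
Lemma kernel_boundary (x : R) : 1 <= `|x| -> K x = 0.
Proof.
rewrite le_eqVlt => /predU1P[x1|]; last exact: Ksupp.
apply/eqP; rewrite -normr_le0; apply/ler_addgt0Pr => /= e e0; rewrite add0r.
pose y := x * (1 + e / (L + 1)).
have L1 : 0 < L + 1 by have := L0; lra.
have eL : 0 < e / (L + 1) by rewrite divr_gt0.
have Ky : K y = 0.
  by apply: Ksupp; rewrite normrM -x1 mul1r ger0_norm ?ltrDl ?addr_ge0 ?(ltW eL).
rewrite -[K x]subr0 -{1}Ky; apply: le_trans (Klip _ _) _.
rewrite (_ : x - y = - (x * (e / (L + 1)))); last by rewrite /y; ring.
rewrite normrN normrM -x1 mul1r ger0_norm ?(ltW eL)//.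
rewrite mulrA ler_pdivrMr// mulrC ler_pM2l//; lra.
Qed.

(** A unit integral forces K z > 0 somewhere and the Lipschitz bound spreads it over a window; there
    the kernel weights bound the spacing average from below. *)
Lemma kernel_pos : exists z r kap : R, [/\ 0 < r, 0 < kap, -1 < z - r, z + r < 1
  & forall x, z - r <= x <= z + r -> kap <= K x].
Proof.
have [z Kz] : exists z, 0 < K z.
  apply: contrapT => /forallNP nK; move: K1.
  rewrite (_ : (fun x => (K x)%:E) = cst 0%E).
    by rewrite integral_cst// mul0e => /eqP; rewrite eq_sym onee_eq0.
  apply/funext => x /=; congr EFin; apply/eqP; rewrite eq_le K0 andbT leNgt.
  exact/negP/nK.
have L1 : 0 < 2 * L + 2 by have := L0; lra.
pose r := K z / (2 * L + 2).
have r0 : 0 < r by rewrite divr_gt0.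
have rE : (2 * L + 2) * r = K z by rewrite /r mulrC divfK ?gt_eqF.
have P x : z - r <= x <= z + r -> K z / 2 <= K x.
  move=> /andP[x1 x2]; have := Klip z x; rewrite ler_norml => /andP[_ Kzx].
  have : `|z - x| <= r by rewrite ler_norml; apply/andP; split; lra.
  by move=> /(ler_wpM2l L0); lra.
have inside x : z - r <= x <= z + r -> `|x| < 1.
  by move=> /P Kx; rewrite ltNge; apply/negP => /kernel_boundary E; move: Kx; rewrite E; lra.
exists z, r, (K z / 2); split => //.
- by rewrite divr_gt0.
- have : `|z - r| < 1 by apply: inside; apply/andP; split; lra.
  by rewrite ltr_norml => /andP[].
- have : `|z + r| < 1 by apply: inside; apply/andP; split; lra.
  by rewrite ltr_norml => /andP[].
Qed.

Lemma lip_continuous : continuous K.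
Proof.
move=> x; apply/cvgrPdist_lt => e e0.
have L1 : 0 < L + 1 by have := L0; lra.
near=> y.
apply: le_lt_trans (Klip _ _) _.
have : `|x - y| < e / (L + 1) by near: y; apply: cvgr_dist_lt => //; rewrite divr_gt0.
rewrite ltr_pdivlMr//; have := normr_ge0 (x - y); have := L0; nra.
Unshelve. all: by end_near. Qed.

Let mK : measurable_fun setT K.
Proof. by apply: continuous_measurable_fun; exact: lip_continuous. Qed.

Let intK (D : set R) : measurable D -> mu.-integrable D (EFin \o K).
Proof.
move=> mD; apply: (@integrableS _ _ _ _ setT) => //.
apply/integrableP; split; first exact/measurable_EFinP.
have -> : (fun x => `|(EFin \o K) x|)%E = (fun x => (K x)%:E).
  by apply/funext => x /=; rewrite ger0_norm.
exact: (eq_ind_r (fun x => (x < +oo)%E) (ltry 1) K1).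
Qed.

Let Phi (x : R) := \int[lebesgue_measure]_(t in `]-oo, x]) K t.

Let PhiB (x y : R) : x <= y -> Phi y - Phi x = \int[lebesgue_measure]_(t in `]x, y]) K t.
Proof. by move=> xy; rewrite /Phi Rintegral_itvB ?bnd_simp//; exact: intK. Qed.

Let Phi_lo (x : R) : x <= -1 -> Phi x = 0.
Proof.
move=> x1; rewrite /Phi (@eq_Rintegral _ _ _ _ _ (fun=> 0)); first by rewrite Rintegral_cst// mul0r.
move=> t; rewrite inE /= in_itv /= => tx; apply: kernel_boundary.
by rewrite ler0_norm; lra.
Qed.

Let Phi_hi (x : R) : 1 <= x -> Phi x = 1.
Proof.
move=> x1; rewrite /Phi Rintegral_mkcond (_ : K \_ _ = K); first by rewrite /Rintegral K1.
apply/funext => t; rewrite patchE; case: ifPn => //.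
rewrite notin_setE /= in_itv /= => /negP; rewrite -ltNge => xt.
by rewrite kernel_boundary// ger0_norm; lra.
Qed.

Let Phi_cell (x y : R) : x <= y -> `|Phi y - Phi x - K x * (y - x)| <= L * (y - x) ^+ 2.
Proof.
move=> xy; rewrite PhiB//.
have mu_xy : fine (lebesgue_measure `]x, y]) = y - x.
  rewrite lebesgue_measure_itv /= lte_fin; case: ltP => //.
  by move=> yx /=; lra.
have intc c : mu.-integrable `]x, y] (EFin \o cst c).
  have H : mu.-integrable `[x, y] (EFin \o cst c).
    apply: continuous_compact_integrable; first exact: segment_compact.
    by apply: continuous_subspaceT => t; exact: cst_continuous.
  by apply: integrableS H => //; exact: subset_itv_oc_cc.
rewrite ler_norml; apply/andP; split.
  have : \int[lebesgue_measure]_(t in `]x, y]) (K x - L * (y - x)) <=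
         \int[lebesgue_measure]_(t in `]x, y]) K t.
    apply: le_Rintegral => //; [exact: intc|exact: intK|].
    move=> t /=; rewrite in_itv /= => /andP[xt ty].
    have := Klip x t; rewrite ler_norml => /andP[_].
    by rewrite ler0_norm; have := L0; nra.
  by rewrite Rintegral_cst// mu_xy; nra.
have : \int[lebesgue_measure]_(t in `]x, y]) K t <=
       \int[lebesgue_measure]_(t in `]x, y]) (K x + L * (y - x)).
  apply: le_Rintegral => //; [exact: intK|exact: intc|].
  move=> t /=; rewrite in_itv /= => /andP[xt ty].
  have := Klip t x; rewrite ler_norml => /andP[_].
  by rewrite ger0_norm; have := L0; nra.
by rewrite Rintegral_cst// mu_xy; nra.
Qed.

Section Scaled.
Variables (h u : R).
Hypothesis h0 : 0 < h.
Hypothesis hu : h <= u <= 1 - h.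

Let g x := Kh K h (u - x).

Lemma Kh_ge0 x : 0 <= g x.
Proof. by rewrite mulr_ge0// invr_ge0 ltW. Qed.

Lemma Kh_lip (x y : R) : `|g x - g y| <= L / h ^+ 2 * `|x - y|.
Proof.
rewrite /g /Kh -mulrBr normrM ger0_norm; last by rewrite invr_ge0 ltW.
rewrite [leRHS](_ : _ = h^-1 * (L * `|(u - x) / h - (u - y) / h|)).
  by rewrite ler_wpM2l// invr_ge0 ltW.
rewrite -mulrBl (_ : u - x - (u - y) = y - x); last by ring.
rewrite normrM distrC [`|h^-1|]ger0_norm; last by rewrite invr_ge0 ltW.
by field; rewrite gt_eqF.
Qed.

Lemma Kh_supp (x : R) : h <= `|x - u| -> g x = 0.
Proof.
move=> hx; rewrite /g /Kh kernel_boundary ?mulr0// normrM distrC.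
by rewrite [`|h^-1|]ger0_norm ?invr_ge0 ?(ltW h0)// ler_pdivlMr// mul1r.
Qed.

(** The primitive [Phi] telescopes to exactly 1, since the end nodes are at or beyond the ends of
    [-1, 1]; each of the at most 2Nh + 2 active cells costs L/(Nh)^2. N is the sample size in the
    path estimates and tends to infinity in the expectation. *)
Lemma grid_avg_dev N : (0 < N)%N ->
  `|grid_avg N g - 1| <= L / (N%:R * h) ^+ 2 * (2 * (N%:R * h) + 2).
Proof.
move=> N0; have NR : 0 < N%:R :> R by rewrite ltr0n.
pose z j := (u - j%:R / N%:R) / h.
have zS j : z j - z j.+1 = (N%:R * h)^-1.
  by rewrite /z -[j.+1%:R]natr1; field; rewrite !gt_eqF.
have Nh : 0 < N%:R * h by rewrite mulr_gt0.
have w0 : 0 < (N%:R * h)^-1 by rewrite invr_gt0.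
have -> : grid_avg N g - 1 = \sum_(0 <= j < N) (K (z j.+1) * (N%:R * h)^-1 - (Phi (z j) - Phi (z j.+1))).
  rewrite sumrB; congr (_ - _).
    rewrite /grid_avg mulr_sumr; apply: eq_bigr => j _; rewrite /g /Kh /z.
    by field; rewrite !gt_eqF.
  rewrite (eq_bigr (fun j => - (Phi (z j.+1) - Phi (z j)))); last by move=> j _; rewrite opprB.
  rewrite sumrN telescope_sumr// Phi_lo; last first.
    rewrite /z divff ?gt_eqF// ler_pdivrMr// mulN1r; move: hu => /andP[? ?]; lra.
  rewrite Phi_hi ?sub0r ?opprK//.
  by rewrite /z mul0r subr0 ler_pdivlMr// mul1r; move: hu => /andP[].
have -> : L / (N%:R * h) ^+ 2 * (2 * (N%:R * h) + 2) =
   L * ((N%:R * h)^-1) ^+ 2 * ((N%:R * u + N%:R * h) - (N%:R * u - N%:R * h - 1) + 1).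
  by field; rewrite !gt_eqF.
apply: sum_window.
- lra.
- by rewrite mulr_ge0// exprn_ge0// ltW.
- move=> j jN; rewrite distrC -(zS j).
  by apply: Phi_cell; rewrite -subr_ge0 zS ltW.
- move=> j jN; apply: contraNT => nj.
  have : (1 <= z j.+1) || (z j <= -1).
    move: nj; rewrite negb_and -!ltNge => /orP[nj|nj]; apply/orP; [left|right].
      rewrite /z ler_pdivlMr// mul1r lerBrDr -lerBrDl ler_pdivrMr// -[j.+1%:R]natr1; lra.
    rewrite /z ler_pdivrMr// mulN1r lerBlDr -lerBlDl opprK ler_pdivlMr//; lra.
  have zz : z j.+1 <= z j by rewrite -subr_ge0 zS ltW.
  move=> /orP[a|a].
    by rewrite kernel_boundary ?mul0r ?Phi_hi ?subrr//; [lra|rewrite ger0_norm; lra].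
  by rewrite kernel_boundary ?mul0r ?Phi_lo ?subrr//; [lra|rewrite ler0_norm; lra].
Qed.

End Scaled.
End Kernel.

Lemma eq0_of_le_inv {R : realType} (x C : R) :
  (forall N, (0 < N)%N -> `|x| <= C / N%:R) -> x = 0.
Proof.
move=> xC; apply/eqP; rewrite -normr_eq0 eq_le normr_ge0 andbT leNgt; apply/negP => x0.
have C0 : 0 <= C by have := xC 1 isT; rewrite divr1; lra.
pose N := (Num.truncn (C / `|x|)).+1.
have := xC N isT; rewrite leNgt => /negP; apply.
by rewrite ltr_pdivrMr// mulrC -ltr_pdivrMr//; exact: truncnS_gt.
Qed.

(** * Expectation of the kernel weights *)

Section ExpectedKernel.
Context {d} {T : measurableType d} {R : realType} (P : probability T R).
Variables (b : nat -> T -> R) (F Q : R -> R).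
Hypothesis hb : forall i, measurable_fun setT (b i).
Hypothesis hF : forall i x, P (b i @^-1` `]-oo, x]) = (F x)%:E.
Hypothesis hFc : continuous F.
Hypothesis hFQ : forall u : R, u \in `[0, 1] -> F (Q u) = u.
Variables (g : R -> R) (ell : R).
Hypothesis ell0 : 0 <= ell.
Hypothesis g_lip : forall x y, `|g x - g y| <= ell * `|x - y|.
Hypothesis g0 : g 0 = 0.
Hypothesis g1 : g 1 = 0.

Lemma cdf01 x : 0 <= F x <= 1.
Proof.
rewrite -!lee_fin -(hF 0) measure_ge0 probability_le1//.
by rewrite -[X in measurable X]setTI; exact: hb.
Qed.

Let F0 : F (Q 0) = 0. Proof. by rewrite hFQ// in_itv /= lexx ler01. Qed.
Let F1 : F (Q 1) = 1. Proof. by rewrite hFQ// in_itv /= lexx ler01. Qed.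

Let intf i : P.-integrable setT (EFin \o (fun w => g (F (b i w)))).
Proof.
apply: measurable_bounded_integrable => //.
- by rewrite (le_lt_trans (probability_le1 P measurableT))// ltry.
- apply: (measurableT_comp (f := g)).
    by apply: continuous_measurable_fun; exact: (lip_continuous g_lip).
  by apply: measurableT_comp => //; exact: continuous_measurable_fun.
exists ell; split; first exact: num_real.
move=> x xM w _ /=; apply: ltW; apply: le_lt_trans xM.
rewrite -[g _]subr0 -g0; apply: le_trans (g_lip _ _) _.
have /andP[? ?] := cdf01 (b i w).
by rewrite subr0 ger0_norm// ler_piMr.
Qed.

(** Splitting by N quantile cells of probability 1/N replaces a change of variables: on a cell, g (F
    b) is within ell/N of its value at the right end. *)
Let expect_cells i N : (0 < N)%N ->
  `|\int[P]_w g (F (b i w)) - grid_avg N g| <= ell / N%:R.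
Proof.
move=> N0; have NR : 0 < N%:R :> R by rewrite ltr0n.
have gr01 j : (j <= N)%N -> 0 <= (j%:R / N%:R : R) <= 1.
  by move=> jN; rewrite divr_ge0//= ler_pdivrMr// mul1r ler_nat.
have grS j : j%:R / N%:R <= j.+1%:R / N%:R :> R.
  by rewrite ler_pM2r ?invr_gt0// ler_nat.
pose A j := b i @^-1` `]Q (j%:R / N%:R), Q (j.+1%:R / N%:R)].
have mA j : measurable (A j) by rewrite -[X in measurable X]setTI; exact: hb.
have iA j : P.-integrable setT (EFin \o (\1_(A j) : T -> R)).
  by apply: integrable_indic => //; rewrite setIT -ge0_fin_numE//; exact: fin_num_measure.
pose s w := \sum_(0 <= j < N) g (j.+1%:R / N%:R) * \1_(A j) w.
have isj j : P.-integrable setT (EFin \o (fun w => g (j.+1%:R / N%:R) * \1_(A j) w)).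
  exact: (@integrableZl _ _ _ P setT measurableT _ _ (iA j)).
have [is_ Es] := Rintegral_sum_nat N (mu := P) measurableT isj.
have Es' : \int[P]_w s w = grid_avg N g.
  rewrite /s Es /grid_avg mulr_sumr; apply: eq_big_nat => j /andP[_ jN].
  rewrite RintegralZl// /Rintegral integral_indic// setIT mulrC; congr (_ * _).
  have /andP[j0 _] := gr01 _ (ltnW jN); have /andP[_ j1] := gr01 _ jN.
  apply: etrans (congr1 fine (prob_itv hb hF hFQ i j0 (grS j) j1)) _ => /=.
  by rewrite -mulrBl -natr1 addrAC subrr add0r mul1r.
rewrite -Es' -RintegralB//.
apply: le_trans (le_normr_Rintegral _ _) _ => //.
  exact: (integrableB measurableT (intf i) is_).
have -> : ell / N%:R = \int[P]_(w in setT) (ell / N%:R).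
  have PT : fine (P setT) = 1 by rewrite probability_setT.
  by rewrite Rintegral_cst// -[LHS]mulr1 -PT.
have ic : P.-integrable setT (EFin \o (fun=> ell / N%:R)).
  exact: finite_measure_integrable_cst.
apply: le_Rintegral => //.
  have := integrable_norm (integrableB measurableT (intf i) is_).
  by [].
move=> w _; set c := b i w.
pose I j : R := \1_(A j) w.
have memA j : (w \in A j) = (Q (j%:R / N%:R) < c <= Q (j.+1%:R / N%:R)).
  by apply/idP/idP; rewrite inE /A /= in_itv.
have IE j : (j < N)%N -> I j = (c <= Q (j.+1%:R / N%:R))%R%:R - (c <= Q (j%:R / N%:R))%R%:R.
  move=> jN; have /andP[j0 _] := gr01 _ (ltnW jN); have /andP[_ j1] := gr01 _ jN.
  have QQ := quantile_le hb hF hFQ j0 j1 (grS j).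
  rewrite /I indicE memA.
  have [a|a] := leP c (Q (j%:R / N%:R)); first by rewrite (le_trans a QQ) subrr.
  by rewrite subr0.
have sI : \sum_(0 <= j < N) I j = (c <= Q 1)%R%:R - (c <= Q 0)%R%:R.
  rewrite (eq_big_nat _ _ (fun j Hj => IE j (proj2 (andP Hj)))).
  by rewrite telescope_sumr// mul0r divff// gt_eqF.
have Q01 : Q 0 <= Q 1 by apply: (quantile_le hb hF hFQ).
have /andP[Fc0 Fc1] := cdf01 c.
(* Outside ]Q 0, Q 1] the value of F is 0 or 1, where g vanishes, so the comparison holds for every
   outcome. *)
have fI : g (F c) = g (F c) * \sum_(0 <= j < N) I j.
  rewrite sI; have [a|a] := leP c (Q 0).
    rewrite (le_trans a Q01) subrr mulr0.
    have := cdf_homo hb hF a; rewrite F0 => ?.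
    by have -> : F c = 0 by apply/eqP; rewrite eq_le; apply/andP.
  have [a'|/ltW a'] := leP c (Q 1); first by rewrite subr0 mulr1.
  rewrite subr0 mulr0; have := cdf_homo hb hF a'; rewrite F1 => ?.
  by have -> : F c = 1 by apply/eqP; rewrite eq_le; apply/andP.
rewrite {1}fI mulr_sumr /s -sumrB.
apply: le_trans (ler_norm_sum _ _ _) _.
apply: (@le_trans _ _ (\sum_(0 <= j < N) ell / N%:R * I j)); last first.
  rewrite -mulr_sumr sI ler_piMr ?divr_ge0//.
  by case: (c <= Q 0); case: (c <= Q 1) => //=; rewrite ?mulr1n ?mulr0n; lra.
apply: ler_sum_nat => j /andP[_ jN]; rewrite -mulrBl normrM -/(I j).
rewrite [`|I j|]ger0_norm; last by rewrite /I indicE.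
rewrite /I indicE; have [|] := boolP (w \in A j); last by rewrite !mulr0.
rewrite memA !mulr1 => /andP[a1 a2].
have /andP[j0 j0'] := gr01 _ (ltnW jN); have /andP[j1' j1] := gr01 _ jN.
have b1 := cdf_homo hb hF (ltW a1); have b2 := cdf_homo hb hF a2.
rewrite hFQ ?in_itv/= ?j0// in b1; rewrite hFQ ?in_itv/= ?j1' ?j1// in b2.
apply: le_trans (g_lip _ _) _; apply: ler_wpM2l => //.
rewrite distrC ger0_norm ?subr_ge0//; move: b1; rewrite -natr1 mulrDl mul1r; lra.
Qed.

Lemma expect_limit (c D : R) : (forall N, (0 < N)%N -> `|grid_avg N g - c| <= D / N%:R) ->
  forall i, \int[P]_w g (F (b i w)) = c.
Proof.
move=> gD i; apply/eqP; rewrite -subr_eq0; apply/eqP.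
apply: (@eq0_of_le_inv _ _ (ell + D)) => N N0.
rewrite (_ : _ - c = (\int[P]_w g (F (b i w)) - grid_avg N g) + (grid_avg N g - c)); last by ring.
rewrite mulrDl; apply: le_trans (ler_normD _ _) (lerD _ (gD _ N0)).
exact: expect_cells.
Qed.

End ExpectedKernel.

(** There is no boundary bias on [h, 1 - h]: the centring in [Gnh] subtracts exactly 1. *)
Lemma expect_Kh {d} {T : measurableType d} {R : realType} (P : probability T R)
    (b : nat -> T -> R) (F Q K : R -> R) (L h u : R) i :
  (forall i, measurable_fun setT (b i)) ->
  (forall i x, P (b i @^-1` `]-oo, x]) = (F x)%:E) -> continuous F ->
  (forall u : R, u \in `[0, 1] -> F (Q u) = u) ->
  (forall x : R, 0 <= K x) -> (\int[lebesgue_measure]_x (K x)%:E = 1)%E ->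
  (forall x y, `|K x - K y| <= L * `|x - y|) -> (forall x : R, 1 < `|x| -> K x = 0) ->
  0 < h -> h <= u <= 1 - h ->
  \int[P]_(w in setT) Kh K h (u - F (b i w)) = 1.
Proof.
move=> hb hF hFc hFQ K0 K1 Klip Ksupp h0 hu.
have L0 : 0 <= L by have := Klip 1 0; rewrite subr0 normr1 mulr1; apply: le_trans.
have /andP[hu1 hu2] := hu.
apply: (@expect_limit _ _ _ P b F Q hb hF hFc hFQ (fun x => Kh K h (u - x)) (L / h ^+ 2)
  _ _ _ _ 1 (2 * L / h + 2 * L / h ^+ 2)).
- by rewrite divr_ge0// exprn_ge0// ltW.
- by move=> x y; exact: Kh_lip.
- by apply: (Kh_supp Klip Ksupp h0); rewrite sub0r normrN; apply: le_trans (ler_norm _).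
- by apply: (Kh_supp Klip Ksupp h0); apply: le_trans (ler_norm _); lra.
move=> N N0; apply: le_trans (grid_avg_dev K0 K1 Klip Ksupp h0 hu N0) _.
have NR : 1 <= N%:R :> R by rewrite ler1n.
rewrite -subr_ge0.
have -> : (2 * L / h + 2 * L / h ^+ 2) / N%:R - L / (N%:R * h) ^+ 2 * (2 * (N%:R * h) + 2) =
  2 * L * (N%:R - 1) / (N%:R * h) ^+ 2 by field; rewrite !gt_eqF//; lra.
by rewrite divr_ge0 ?exprn_ge0 ?mulr_ge0// ?(ltW h0)//; lra.
Qed.

(** * Continuity on the unit interval *)

Section WithinContinuity.
Context {R : realType}.
Implicit Types (f g : R -> R) (A : set R).

Lemma within_continuous_mul A f g : {within A, continuous f} -> {within A, continuous g} ->
  {within A, continuous (fun x => f x * g x)}.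
Proof. by move=> cf cg x; apply: continuousM; [exact: cf|exact: cg]. Qed.

Lemma within_continuous_sub A f g : {within A, continuous f} -> {within A, continuous g} ->
  {within A, continuous (fun x => f x - g x)}.
Proof. by move=> cf cg x; apply: continuousB; [exact: cf|exact: cg]. Qed.

Lemma within_continuous_add A f g : {within A, continuous f} -> {within A, continuous g} ->
  {within A, continuous (fun x => f x + g x)}.
Proof. by move=> cf cg x; apply: continuousD; [exact: cf|exact: cg]. Qed.

Lemma within_bounded f : {within `[0, 1], continuous f} ->
  exists2 M : R, 0 < M & forall x : R, 0 <= x <= 1 -> `|f x| <= M.
Proof.
move=> cf.
have cn : {within `[0, 1], continuous (fun x => `|f x|)}.
  by move=> x; apply: continuous_comp; [exact: cf|exact: norm_continuous].
have [c _ cmax] := EVT_max ler01 cn.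
exists (`|f c| + 1) => [|x x01]; first by rewrite ltr_wpDl.
by apply: le_trans (cmax x _) _; rewrite ?in_itv//= lerDl.
Qed.

End WithinContinuity.

(** * The function A and its derivative *)

Section Amap.
Context {R : realType}.
Variables (M : nat) (p : nat -> R).
Hypothesis hA1' : forall u : R, u \in `[0, 1] -> A1' M p u != 0.

Let a2 (u : R) : R := (deriv (deriv (A1poly M p))).[u].
Definition dAfun (u : R) : R :=
  (A1' M p u * A1' M p u - A1 M p u * a2 u) / (A1' M p u) ^+ 2.

Lemma is_derive_Afun (u : R) : 0 <= u <= 1 -> is_derive u 1 (Afun M p) (dAfun u).
Proof.
move=> u01; have n0 : A1' M p u != 0 by apply: hA1'; rewrite in_itv.
have d1 : is_derive u 1 (A1 M p) (A1' M p u) by exact: is_derive_poly.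
have d2 : is_derive u 1 (A1' M p) (a2 u) by exact: is_derive_poly.
have d3 := is_deriveV n0 d2.
have D := is_deriveM d1 d3.
suff -> : dAfun u = A1 M p u *: (- (A1' M p u) ^- 2 *: a2 u) + (A1' M p u)^-1 *: A1' M p u.
  exact: D.
by rewrite /dAfun /GRing.scale /=; field.
Qed.

Let continuous_poly (r : {poly R}) : {within `[0, 1], continuous (fun x => r.[x])}.
Proof. by apply: continuous_subspaceT => x; exact: continuous_horner. Qed.

Let continuous_invA1' : {within `[0, 1], continuous (fun x => (A1' M p x)^-1)}.
Proof.
apply: continuous_in_subspaceT => x; rewrite inE /= => x01.
by apply: continuousV; [exact: hA1'|exact: continuous_horner].
Qed.

Lemma continuous_Afun : {within `[0, 1], continuous (Afun M p)}.
Proof. by apply: within_continuous_mul => //; exact: continuous_poly. Qed.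

Lemma continuous_dAfun : {within `[0, 1], continuous (dAfun)}.
Proof.
rewrite (_ : dAfun = fun u => (A1' M p u * A1' M p u - A1 M p u * a2 u) *
   ((A1' M p u)^-1 * (A1' M p u)^-1)).
  apply: within_continuous_mul; last exact: within_continuous_mul.
  by apply: within_continuous_sub; apply: within_continuous_mul; exact: continuous_poly.
by apply/funext => u; rewrite /dAfun expr2 invfM.
Qed.

End Amap.

(** * Integration by parts and the plug-in functional *)

Section PlugIn.
Context {R : realType}.
Local Notation mu := (@lebesgue_measure R).
Variables (M : nat) (p : nat -> R) (Q q psi dpsi : R -> R).
Hypothesis hA1' : forall u : R, u \in `[0, 1] -> A1' M p u != 0.
Hypothesis hQc : {within `[0, 1], continuous Q}.
Hypothesis hQd : forall u : R, u \in `]0, 1[ -> is_derive u 1 Q (q u).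
Hypothesis hqc : {within `[0, 1], continuous q}.
Hypothesis hpsic : {within `[0, 1], continuous psi}.
Hypothesis hpsid : forall u : R, u \in `]0, 1[ -> is_derive u 1 psi (dpsi u).
Hypothesis hdpsic : {within `[0, 1], continuous dpsi}.

Let A := Afun M p.
Let dA := dAfun M p.
Let X := chi M p psi dpsi.

Let chiE (x : R) : 0 <= x <= 1 -> X x = (1 - dA x) * psi x - A x * dpsi x.
Proof.
move=> x01; rewrite /X /chi derive1E.
by have D := is_derive_Afun hA1' x01; rewrite (@derive_val _ _ _ _ _ _ _ D).
Qed.

Lemma continuous_chi : {within `[0, 1], continuous X}.
Proof.
have H : {within `[0, 1], continuous (fun x => (1 - dA x) * psi x - A x * dpsi x)}.
  apply: within_continuous_sub; apply: within_continuous_mul => //.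
    apply: within_continuous_sub; last exact: continuous_dAfun.
    by apply: continuous_subspaceT => x; exact: cst_continuous.
  exact: continuous_Afun.
apply: subspace_eq_continuous H => x; rewrite inE /= in_itv /= => x01.
exact: (esym (chiE x01)).
Qed.

Section At.
Variable us : R.
Hypothesis us01 : 0 < us < 1.

Let sub01 : `[us, 1]%classic `<=` `[0, 1]%classic.
Proof. by apply: subset_itvr; rewrite bnd_simp ltW//; case/andP: us01. Qed.

Let cW (f : R -> R) : {within `[0, 1], continuous f} -> {within `[us, 1], continuous f}.
Proof. exact: continuous_subspaceW. Qed.

Let int_c (f : R -> R) : {within `[0, 1], continuous f} -> mu.-integrable `[us, 1] (EFin \o f).
Proof.
by move=> /cW cf; apply: continuous_compact_integrable => //; exact: segment_compact.
Qed.

Let oo_c (f df : R -> R) : {within `[0, 1], continuous f} ->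
  (forall u : R, u \in `]0, 1[ -> is_derive u 1 f (df u)) ->
  derivable_oo_LRcontinuous f us 1 /\ {in `]us, 1[, derive1 f =1 df}.
Proof.
have /andP[u0 u1] := us01.
move=> /cW /(continuous_within_itvP _ u1)[_ fl fr] fd.
have in01 x : x \in `]us, 1[ -> x \in `]0, 1[.
  by rewrite !in_itv /= => /andP[a c]; apply/andP; split; lra.
split; first by split => // x /in01/fd D; exact: ex_derive.
by move=> x /in01/fd D; rewrite derive1E; exact: derive_val.
Qed.

(** The term psi A q is integrated by parts; as psi - (psi A)' = chi_psi, the target takes the form
    of [Shat] with Q in place of its estimate. *)
Lemma target_by_parts :
  \int[mu]_(x in `[us, 1]) (psi x * vfun M p Q q x) =
  \int[mu]_(x in `[us, 1]) (X x * Q x) - A us * psi us * Q us + A 1 * psi 1 * Q 1.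
Proof.
have /andP[u0 u1] := us01.
have cA := continuous_Afun hA1'; have cdA := continuous_dAfun hA1'.
pose f x := psi x * A x; pose df x := dpsi x * A x + psi x * dA x.
have cf : {within `[0, 1], continuous f} by exact: within_continuous_mul.
have cdf : {within `[0, 1], continuous df}.
  by apply: within_continuous_add; exact: within_continuous_mul.
have fd (u : R) : u \in `]0, 1[ -> is_derive u 1 f (df u).
  move=> u01; have d1 := hpsid u01.
  have u01' : 0 <= u <= 1 by move: u01; rewrite in_itv /= => /andP[a c]; apply/andP; split; lra.
  have d2 := is_derive_Afun hA1' u01'.
  have D := is_deriveM d1 d2.
  suff -> : df u = psi u *: dA u + A u *: dpsi u by exact: D.
  by rewrite /df /GRing.scale /=; ring.
have [oof ef] := oo_c cf fd; have [ooQ eQ] := oo_c hQc hQd.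
have := Rintegration_by_parts u1 (cW cdf) oof ef (cW hqc) ooQ eQ.
have -> : \int[mu]_(x in `[us, 1]) (psi x * vfun M p Q q x) =
  \int[mu]_(x in `[us, 1]) (psi x * Q x) + \int[mu]_(x in `[us, 1]) (f x * q x).
  rewrite -RintegralD//; [|by apply: int_c; exact: within_continuous_mul..].
  by apply: eq_Rintegral => x _; rewrite /vfun /f /A; ring.
have -> : \int[mu]_(x in `[us, 1]) (X x * Q x) =
  \int[mu]_(x in `[us, 1]) (psi x * Q x) - \int[mu]_(x in `[us, 1]) (df x * Q x).
  rewrite -RintegralB//; [|by apply: int_c; exact: within_continuous_mul..].
  apply: eq_Rintegral => x; rewrite inE /= => /sub01; rewrite /= in_itv /= => x01.
  by rewrite chiE// /df; ring.
by move=> ->; rewrite /f; ring.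
Qed.

(** Monotonicity of Qh makes the integrand measurable. The factor Cx + 2 Ca collects an integral
    over a set of length at most 1 and the two boundary terms. *)
Lemma plugin_dev (Qh : R -> R) (Cx Ca del : R) :
  {homo Qh : x y / x <= y} -> (forall x : R, 0 <= x <= 1 -> `|Qh x - Q x| <= del) ->
  (forall x : R, 0 <= x <= 1 -> `|X x| <= Cx) ->
  (forall x : R, 0 <= x <= 1 -> `|A x * psi x| <= Ca) ->
  `|\int[mu]_(u in `[us, 1]) (X u * Qh u) - A us * psi us * Qh us + A 1 * psi 1 * Qh 1
    - \int[mu]_(x in `[us, 1]) (psi x * vfun M p Q q x)| <= (Cx + 2 * Ca) * del.
Proof.
have /andP[u0 u1] := us01.
move=> Qmono QQ hX hA; rewrite target_by_parts.
have us01' : 0 <= us <= 1 by apply/andP; split; lra.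
have one01 : 0 <= (1 : R) <= 1 by rewrite lexx ler01.
have del0 : 0 <= del by apply: le_trans (QQ us us01').
have Cx0 : 0 <= Cx by apply: le_trans (hX us us01').
have iQh : mu.-integrable `[us, 1] (EFin \o (fun u => X u * Qh u)).
  apply: measurable_bounded_integrable => //.
  - by rewrite /= lebesgue_measure_itv /= lte_fin u1 -EFinB ltry.
  - apply: measurable_funM; last exact: nondecreasing_measurable.
    by apply: subspace_continuous_measurable_fun => //; exact: cW continuous_chi.
  have [CQ _ hCQ] := within_bounded hQc.
  exists (Cx * (CQ + del)); split; first exact: num_real.
  move=> x xM t; move=> /sub01; rewrite /= in_itv /= => t01; apply: ltW; apply: le_lt_trans xM.
  rewrite normrM; apply: ler_pM => //; first exact: hX.
  rewrite (_ : Qh t = Q t + (Qh t - Q t)); last by ring.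
  by apply: le_trans (ler_normD _ _) _; apply: lerD; [exact: hCQ|exact: QQ].
have iQ : mu.-integrable `[us, 1] (EFin \o (fun u => X u * Q u)).
  by apply: int_c; apply: within_continuous_mul => //; exact: continuous_chi.
set I1 := Rintegral _ _ _; set I2 := Rintegral _ _ _.
rewrite (_ : _ - _ = (I1 - I2) + (- (A us * psi us * (Qh us - Q us)) +
  A 1 * psi 1 * (Qh 1 - Q 1))); last by ring.
rewrite mulrDl; apply: le_trans (ler_normD _ _) _; apply: lerD; last first.
  rewrite (_ : 2 * Ca * del = Ca * del + Ca * del); last by ring.
  apply: le_trans (ler_normD _ _) _; rewrite normrN.
  by apply: lerD; rewrite normrM; apply: ler_pM => //; (exact: hA || exact: QQ).
rewrite /I1 /I2 -RintegralB//.
apply: le_trans (le_normr_Rintegral _ _) _ => //.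
  exact: (integrableB _ iQh iQ).
apply: (@le_trans _ _ (\int[mu]_(x in `[us, 1]) (Cx * del))).
  apply: le_Rintegral => //.
  - have := integrable_norm (integrableB _ iQh iQ); exact.
  - by apply: int_c; apply: continuous_subspaceT => x; exact: cst_continuous.
  move=> x /sub01; rewrite /= in_itv /= => x01; rewrite -mulrBr normrM.
  by apply: ler_pM => //; [exact: hX|exact: QQ].
have m1 : fine (mu `[us, 1]) = 1 - us by rewrite lebesgue_measure_itv /= lte_fin u1.
rewrite Rintegral_cst// m1.
by rewrite ler_piMr ?mulr_ge0//; lra.
Qed.

End At.
End PlugIn.

(** * Comparison of the scales in n and h *)

Section Rates.
Context {R : realType}.
Variable n : nat.

Definition log1 : R := ln n%:R.
Definition lil_scale : R := Num.sqrt (n%:R * ln log1).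
(* n^(1/4) ell(n) *)
Definition bk_scale : R := Num.sqrt (lil_scale * log1).

Hypothesis llog1 : 1 <= ln log1.
Hypothesis log_root : log1 ^+ 2 <= root8 n.

Lemma log1_ge2 : 2 <= log1.
Proof.
have l0 : 0 < log1.
  by rewrite ltNge; apply/negP => l0; have := ln_le0 (le_trans l0 ler01); have := llog1; lra.
have := expR_ge1Dx (ln log1); rewrite lnK ?posrE//; have := llog1; lra.
Qed.

Lemma root8_ge4 : 4 <= root8 n :> R.
Proof. by have := log1_ge2; have := log_root; nra. Qed.

Let nE : n%:R = root8 n ^+ 8 :> R. Proof. by rewrite root8_pow. Qed.

Lemma nat_gt0 : 0 < n%:R :> R.
Proof. by rewrite nE exprn_gt0//; have := root8_ge4; lra. Qed.

Lemma sqrtE : Num.sqrt n%:R = root8 n ^+ 4 :> R.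
Proof. by rewrite nE (exprM _ 4 2) sqrtr_sqr ger0_norm// exprn_ge0// root8_ge0. Qed.

Lemma lil_scale_sqr : lil_scale ^+ 2 = n%:R * ln log1.
Proof. by rewrite sqr_sqrtr// mulr_ge0//; have := llog1; lra. Qed.

Lemma lil_scale_ge : root8 n ^+ 4 <= lil_scale.
Proof. by rewrite -sqrtE ler_wsqrtr// ler_peMr. Qed.

Lemma log1_lil : 2 + 2 * log1 <= lil_scale.
Proof.
have := lil_scale_ge; have := root8_ge4; have := log_root; have := log1_ge2.
move: log1 lil_scale (root8 n) => l s x l2 lx x4 xs.
have : x ^+ 2 <= x ^+ 4 by apply: ler_weXn2l => //; lra.
have : 4 * x <= x ^+ 2 by nra.
by nra.
Qed.

Lemma bk_scale_sqr : bk_scale ^+ 2 = lil_scale * log1.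
Proof. by rewrite sqr_sqrtr// mulr_ge0 ?sqrtr_ge0//; have := log1_ge2; lra. Qed.

Lemma bk_scale_ge0 : 0 <= bk_scale. Proof. exact: sqrtr_ge0. Qed.

Lemma log1_bk : log1 <= bk_scale.
Proof.
have := log1_ge2; have := log1_lil => l1 l2.
rewrite -(@ler_pXn2r _ 2)// ?nnegrE ?bk_scale_ge0//; last lra.
by rewrite bk_scale_sqr; nra.
Qed.

Lemma root8_bk : root8 n ^+ 2 <= bk_scale.
Proof.
rewrite -(@ler_pXn2r _ 2)// ?nnegrE ?bk_scale_ge0 ?exprn_ge0 ?root8_ge0//.
rewrite bk_scale_sqr -exprM; apply: le_trans lil_scale_ge _.
by rewrite ler_peMr ?sqrtr_ge0//; have := log1_ge2; lra.
Qed.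

(** By [log1_lil] one unit of [lil_scale] absorbs the lower order terms, and 32 times 401 is below
    114^2. *)
Lemma osc_lil : osc log1 (400 * lil_scale + 2) <= 114 * bk_scale.
Proof.
have := log1_ge2; have := log1_lil => l1 l2.
rewrite -(@ler_pXn2r _ 2)// ?nnegrE ?mulr_ge0 ?bk_scale_ge0 ?sqrtr_ge0//.
rewrite sqr_sqrtr; last by rewrite !mulr_ge0//; lra.
by rewrite exprMn bk_scale_sqr; nra.
Qed.

Lemma lil_root : (400 * lil_scale + 2) / n%:R <= 401 / root8 n.
Proof.
have x4 := root8_ge4; have n0 := nat_gt0; have l2 := log1_ge2.
have ll : ln log1 <= log1 by apply/ltW/ln_sublinear; lra.
have sx : lil_scale * root8 n <= n%:R.
  rewrite -(@ler_pXn2r _ 2)// ?nnegrE ?mulr_ge0 ?sqrtr_ge0 ?root8_ge0 ?(ltW n0)//.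
  rewrite exprMn lil_scale_sqr expr2 -mulrA ler_pM2l//.
  have := log_root; rewrite nE; move: (root8 n) x4 => x x4 lx.
  have : x ^+ 3 <= x ^+ 8 by apply: ler_weXn2l => //; lra.
  apply: le_trans; rewrite (_ : x ^+ 3 = x * (x * x)); last by ring.
  by apply: ler_wpM2r; nra.
rewrite ler_pdivrMr// mulrAC ler_pdivlMr; last lra.
by have := log1_lil; nra.
Qed.

(** With y = bk_scale / (nh), (h + y)^2 >= 4hy, and hy = bk_scale / n no longer depends on h and
    dominates loglog n / n. *)
Lemma lil_rate (h : R) : 0 < h ->
  (400 * lil_scale + 2) / n%:R <= 401 * (h + bk_scale / (n%:R * h)).
Proof.
move=> h0; have n0 := nat_gt0; have l2 := log1_ge2.
have B0 := bk_scale_ge0; have l1 := log1_lil.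
have ll : ln log1 <= log1 by apply/ltW/ln_sublinear; lra.
have lB := log1_bk.
suff H : lil_scale / n%:R <= h + bk_scale / (n%:R * h).
  apply: (@le_trans _ _ (401 * (lil_scale / n%:R))); last lra.
  by rewrite mulrA ler_pM2r ?invr_gt0//; lra.
have y0 : 0 <= bk_scale / (n%:R * h) by rewrite divr_ge0// mulr_ge0// ltW.
rewrite -(@ler_pXn2r _ 2)// ?nnegrE ?divr_ge0 ?sqrtr_ge0 ?addr_ge0 ?(ltW h0) ?(ltW n0)//.
apply: (@le_trans _ _ (4 * (h * (bk_scale / (n%:R * h))))); last first.
  by move: (bk_scale / _) y0 => y y0; rewrite -subr_ge0 (_ : _ - _ = (h - y) ^+ 2) ?sqr_ge0//; ring.
rewrite exprMn lil_scale_sqr -subr_ge0.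
have -> : 4 * (h * (bk_scale / (n%:R * h))) - n%:R * ln log1 * n%:R^-1 ^+ 2 =
  (4 * bk_scale - ln log1) / n%:R by field; rewrite !gt_eqF.
by rewrite divr_ge0 ?(ltW n0)//; lra.
Qed.

(** The two sides differ by exactly sqrt h, the middle term of [rate]. *)
Lemma rate_ge (h : R) : 0 < h ->
  Num.sqrt (n%:R * h) * (h + bk_scale / (n%:R * h)) <= rate n h.
Proof.
move=> h0; have n0 := nat_gt0.
have q4 x : 0 <= x -> powR x (4%:R^-1 : R) = Num.sqrt (Num.sqrt x).
  move=> x0; rewrite -[RHS]powR12_sqrt ?sqrtr_ge0// -powR12_sqrt// -powRrM.
  by congr powR; field.
rewrite /rate /ell -/log1 !powRN q4// q4; last by have := llog1; lra.
rewrite (_ : 3%:R / 2%:R = 1 + 2%:R^-1 :> R); last by field.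
rewrite powRD; last by rewrite gt_eqF ?implybT.
rewrite powRr1 ?(ltW h0)// !powR12_sqrt ?(ltW h0)//.
rewrite /bk_scale /lil_scale !sqrtrM ?sqrtr_ge0 ?(ltW n0)//.
set sn := Num.sqrt n%:R; set sh := Num.sqrt h; set s4 := Num.sqrt sn.
have sn0 : 0 < sn by rewrite sqrtr_gt0.
have sh0 : 0 < sh by rewrite sqrtr_gt0.
have s40 : 0 < s4 by rewrite sqrtr_gt0.
have E1 : n%:R = sn ^+ 2 by rewrite sqr_sqrtr// ltW.
have E2 : h = sh ^+ 2 by rewrite sqr_sqrtr// ltW.
have E3 : sn = s4 ^+ 2 by rewrite sqr_sqrtr// ltW.
rewrite {1 2 3}E2 E1 E3 -subr_ge0.
set X := Num.sqrt (Num.sqrt (ln log1)); set Y := Num.sqrt log1.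
rewrite (_ : _ - _ = sh) ?(ltW sh0)//.
by field; rewrite !gt_eqF.
Qed.

End Rates.

(** * The regimes of small and large error *)

(** Chosen so that a^2 times it is 1/16, which puts E within 1/4 of 1 in the small regime. *)
Definition path_eps {R : realType} (a : R) : R := ((4 * a) ^+ 2)^-1.
(** The lower bound for W be in the large regime: the first term when nh is at least a multiple of
    log n, the second otherwise; 450 is 2 times 15^2. *)
Definition path_low {R : realType} (a kap r : R) : R :=
  Num.min (kap * r * path_eps a / 2) (kap * r ^+ 2 / 450).
(** The terms 24a + 2a^2 serve the small regime, where 1/W <= 2; the others bound E - 1 and 1/W
    separately in the large one. *)
Definition path_const {R : realType} (a kap r : R) : R :=
  24 * a + 2 * a ^+ 2 + (1 + a) / path_eps a + a + (path_low a kap r)^-1.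

Section Regimes.
Context {R : realType}.

Lemma path_eps_gt0 (a : R) : 0 < a -> 0 < path_eps a.
Proof. by move=> a0; rewrite invr_gt0 exprn_gt0// mulr_gt0. Qed.

Lemma path_low_gt0 (a kap r : R) : 0 < a -> 0 < kap -> 0 < r -> 0 < path_low a kap r.
Proof.
move=> a0 kp rp; have e0 := path_eps_gt0 a0.
rewrite lt_min; apply/andP; split; apply: divr_gt0; rewrite ?ltr0n// ?mulr_gt0// exprn_gt0.
Qed.

Lemma path_const_ge0 (a kap r : R) : 0 < a -> 0 < kap -> 0 < r -> 0 <= path_const a kap r.
Proof.
move=> a0 kp rp; have e0 := path_eps_gt0 a0; have l0 := path_low_gt0 a0 kp rp.
have t1 : 0 <= (1 + a) / path_eps a by apply: divr_ge0; [lra|exact: ltW].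
have t2 : 0 <= (path_low a kap r)^-1 by rewrite invr_ge0 ltW.
by have := sqr_ge0 a; rewrite /path_const; lra.
Qed.

(* For small [be] both averages are close to 1 and E W - 1 is of second order;
   for large [be] everything is bounded by a multiple of [be]. *)
Lemma regimes (a kap r be W E : R) : 2 <= a -> 0 <= be -> 0 < path_low a kap r ->
  `|W + E - 2| <= 6 * a * be -> `|E - 1| <= a * (1 + be) ->
  (be <= 1 -> (E - 1) ^+ 2 <= a ^+ 2 * be) ->
  (path_eps a <= be -> path_low a kap r <= W * be) ->
  [/\ 0 < W, `|E - W^-1| <= path_const a kap r * be
    & forall eta : R, 0 <= eta <= 1 -> eta / W <= 2 * eta + path_const a kap r * be].
Proof.
rewrite /path_const; set low := path_low a kap r.
move=> a2 b0 c0 S Dl Dq WB.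
have a0 : 0 < a by lra.
have e0 := path_eps_gt0 a0.
have ea : a ^+ 2 * path_eps a = 1 / 16 by rewrite /path_eps; field; rewrite gt_eqF.
set ce := path_eps a in e0 ea WB *.
have t1 : 0 <= (1 + a) / ce * be.
  by apply: mulr_ge0 => //; apply: divr_ge0; [lra|exact: ltW].
have t2 : 0 <= low^-1 * be by rewrite mulr_ge0 ?invr_ge0 ?(ltW c0).
have t3 : 0 <= a ^+ 2 * be by rewrite mulr_ge0// sqr_ge0.
have t4 : 0 <= a * be by rewrite mulr_ge0// ltW.
have CE : (24 * a + 2 * a ^+ 2 + (1 + a) / ce + a + low^-1) * be =
    24 * (a * be) + 2 * (a ^+ 2 * be) + (1 + a) / ce * be + a * be + low^-1 * be by ring.
rewrite CE {CE}.
have [good|bad] := leP be ce.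
  have ab2 : a ^+ 2 * be <= 1 / 16 by rewrite -ea ler_wpM2l// sqr_ge0.
  have ab : 2 * (a * be) <= a ^+ 2 * be by rewrite mulrA ler_wpM2r//; nra.
  have ab1 : 4 * be <= a ^+ 2 * be by rewrite ler_wpM2r//; nra.
  have be1 : be <= 1 by lra.
  have D := Dq be1.
  have E14 : `|E - 1| <= 1 / 4.
    rewrite -(@ler_pXn2r _ 2)// ?nnegrE// real_normK ?num_real//.
    by apply: le_trans D _; lra.
  have S4 : `|W + E - 2| <= 1 / 4 by apply: le_trans S _; lra.
  have /andP[E1 E2] : - (1 / 4) <= E - 1 <= 1 / 4 by rewrite -ler_norml.
  have /andP[S1 S2] : - (1 / 4) <= W + E - 2 <= 1 / 4 by rewrite -ler_norml.
  have W12 : 1 / 2 <= W by lra.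
  have W0 : 0 < W by lra.
  have iW : W^-1 <= 2 by rewrite -[leRHS]invrK lef_pV2 ?posrE//; lra.
  split => //; last first.
    by move=> eta /andP[eta0 _]; have := ler_wpM2l eta0 iW; lra.
  have -> : E - W^-1 = (E * (W + E - 2) - (E - 1) ^+ 2) / W by field; rewrite gt_eqF.
  rewrite normrM [`|W^-1|]ger0_norm ?invr_ge0 ?(ltW W0)//.
  apply: (@le_trans _ _ ((2 * (6 * a * be) + a ^+ 2 * be) * 2)); last lra.
  apply: ler_pM => //; first by rewrite invr_ge0 ltW.
  apply: le_trans (ler_normD _ _) _; rewrite normrN; apply: lerD; last first.
    by rewrite ger0_norm ?sqr_ge0.
  by rewrite normrM; apply: ler_pM => //; rewrite ler_norml; apply/andP; split; lra.
have {}WB := WB (ltW bad).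
have bp : 0 < be by exact: lt_trans bad.
have W0 : 0 < W by rewrite -(pmulr_lgt0 _ bp); exact: lt_le_trans WB.
have iW : W^-1 <= low^-1 * be.
  by rewrite mulrC ler_pdivlMr// mulrC ler_pdivrMr// mulrC.
split => //; last first.
  move=> eta /andP[eta0 eta1]; have iW0 : 0 <= W^-1 by rewrite invr_ge0 ltW.
  have : eta / W <= 1 * W^-1 by rewrite ler_wpM2r.
  lra.
(* This turns the constant terms of a (1 + be) and of |1 - 1/W| <= 1 + 1/W into multiples of be. *)
have ge1 : 1 <= be / ce by rewrite ler_pdivlMr// mul1r ltW.
have : (1 + a) * 1 <= (1 + a) * (be / ce) by rewrite ler_wpM2l//; lra.
rewrite (_ : (1 + a) * (be / ce) = (1 + a) / ce * be); last by ring.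
move=> T1; rewrite (_ : E - W^-1 = (E - 1) + (1 - W^-1)); last by ring.
have iW0 : 0 <= W^-1 by rewrite invr_ge0 ltW.
apply: le_trans (ler_normD _ _) _.
have : `|1 - W^-1| <= 1 + W^-1 by rewrite ler_norml; apply/andP; split; lra.
lra.
Qed.

End Regimes.

(** * Both averages for one sorted sample and one window *)

Section PathBound.
Context {R : realType}.
Variables (K : R -> R) (L z r kap : R).
Hypothesis K0 : forall x : R, 0 <= K x.
Hypothesis K1 : (\int[lebesgue_measure]_x (K x)%:E = 1)%E.
Hypothesis Klip : forall x y, `|K x - K y| <= L * `|x - y|.
Hypothesis Ksupp : forall x : R, 1 < `|x| -> K x = 0.
Hypothesis r0 : 0 < r.
Hypothesis kap0 : 0 < kap.
Hypothesis zr1 : -1 < z - r.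
Hypothesis zr2 : z + r < 1.
Hypothesis K_ge : forall x, z - r <= x <= z + r -> kap <= K x.

Variables (n : nat) (V : nat -> R).
Hypothesis Vmono : forall k l, (k <= l)%N -> (l < n)%N -> V k <= V l.
Hypothesis V0 : forall k, (k < n)%N -> 0 < V k.
Hypothesis V1 : forall k, (k < n)%N -> V k <= 1.

Local Notation lam := (log1 n : R).
Local Notation Lam := (400 * lil_scale n : R).
Local Notation B := (bk_scale n : R).

Hypothesis llog1 : 1 <= ln lam.
Hypothesis log_root : lam ^+ 2 <= root8 n.
Hypothesis hlil : forall j, (j <= n)%N -> `|gcnt n V j - j%:R| <= Lam.
Hypothesis hosc : forall i j, (i <= j <= n)%N ->
  `|gcnt n V j - gcnt n V i - (j%:R - i%:R)| <= osc lam (j%:R - i%:R).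
Hypothesis hcells : forall i, (i < cells (R := R) n)%N ->
  cnt n V (i.+1%:R / (cells (R := R) n)%:R) - cnt n V (i%:R / (cells (R := R) n)%:R) < 32.

Variables (h u : R).
Hypothesis h0 : 0 < h.
Hypothesis hu : h <= u <= 1 - h.
Local Notation H := (n%:R * h).
Hypothesis H1 : 1 <= H.
Hypothesis rH : 33 <= r * H.

Let g x := Kh K h (u - x).
Let W := spacing_avg n V g.
Let E := density_avg n V g.
Let be := B / H.

Let L0 : 0 <= L.
Proof. by have := Klip 1 0; rewrite subr0 normr1 mulr1; apply: le_trans. Qed.
Let nR := nat_gt0 llog1 log_root.
Let n0 : (0 < n)%N. Proof. by have := nR; rewrite ltr0n. Qed.
Let lam2 := log1_ge2 llog1.
Let lam1 : 1 <= lam. Proof. by have := lam2; lra. Qed.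
Let Lam0 : 0 <= Lam. Proof. exact: mulr_ge0 (ler0n _ 400) (sqrtr_ge0 _). Qed.
Let H0 : 0 < H. Proof. by rewrite mulr_gt0. Qed.
Let ell0 : 0 <= L / h ^+ 2. Proof. by rewrite divr_ge0 ?L0// exprn_ge0// ltW. Qed.
Let lamB : lam <= B. Proof. exact: log1_bk. Qed.
Let be0 : 0 <= be. Proof. by rewrite divr_ge0 ?bk_scale_ge0// ltW. Qed.

Let scale (x : R) : 0 <= x -> L / h ^+ 2 / n%:R * (x / n%:R) * (2 * H + 2) <= 4 * L * (x / H).
Proof.
move=> x0; rewrite -subr_ge0.
have -> : 4 * L * (x / H) - L / h ^+ 2 / n%:R * (x / n%:R) * (2 * H + 2) =
  2 * L * x * (H - 1) / H ^+ 2 by field; rewrite !gt_eqF.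
by rewrite divr_ge0 ?exprn_ge0 ?(ltW H0)// !mulr_ge0 ?L0//; have := H1; lra.
Qed.

Let grid_dev : `|grid_avg n g - 1| <= 4 * L * (1 / H).
Proof.
apply: le_trans (grid_avg_dev K0 K1 Klip Ksupp h0 hu n0) _.
rewrite -subr_ge0.
have -> : 4 * L * (1 / H) - L / H ^+ 2 * (2 * H + 2) = 2 * L * (H - 1) / H ^+ 2.
  by field; rewrite !gt_eqF.
by rewrite divr_ge0 ?exprn_ge0 ?(ltW H0)// !mulr_ge0 ?L0//; have := H1; lra.
Qed.

Let cell_dev : `|E - cell_avg n V g| <= 4 * L * (11 * lam / H).
Proof.
have l0 : 0 <= 11 * lam by have := lam1; lra.
apply: le_trans (scale l0).
rewrite (_ : _ * _ * _ = n%:R^-1 * (L / h ^+ 2 / n%:R * (11 * lam) * (2 * H + 2))); last by ring.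
apply: (density_cell n0 V0 V1 lam1 hosc h0 ell0).
- by move=> x y; exact: Kh_lip.
- by move=> x; exact: Kh_supp.
Qed.

Let to_be (x : R) : x <= B -> x / H <= be.
Proof. by move=> xB; rewrite ler_pM2r ?invr_gt0. Qed.

(** The Bahadur-Kiefer cancellation, the move to cell ends and the Riemann error add up to 4 (116 +
    11 + 2) = 516. *)
Lemma sum_avg : `|W + E - 2| <= 520 * L * be.
Proof.
have C1 : `|W + cell_avg n V g - 2 * grid_avg n g| <= 4 * L * (116 * B / H).
  have o0 : 0 <= osc lam (Lam + 2) + 2 by rewrite addr_ge0// sqrtr_ge0.
  apply: le_trans.
    apply: (avg_cancel n0 Vmono V0 V1 lam1 hlil hosc h0 hu ell0).
    - by move=> x y; exact: Kh_lip.
    - by move=> x; exact: Kh_supp.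
  apply: le_trans (scale o0) _.
  rewrite ler_wpM2l ?mulr_ge0 ?L0// ler_pM2r ?invr_gt0//.
  by have := osc_lil llog1 log_root; have := lamB; have := lam2; lra.
have C2 := cell_dev; have C3 := grid_dev.
have b1 := to_be lamB; have b2 : 1 / H <= be by apply: to_be; have := lamB; have := lam1; lra.
rewrite (_ : W + E - 2 = (W + cell_avg n V g - 2 * grid_avg n g) + (E - cell_avg n V g) +
   2 * (grid_avg n g - 1)); last by ring.
have e1 : 116 * B / H = 116 * be by rewrite /be; ring.
have e2 : 11 * lam / H = 11 * (lam / H) by ring.
rewrite e1 in C1; rewrite e2 in C2.
apply: le_trans (ler_normD _ _) _; rewrite normrM (ger0_norm (_ : 0 <= 2))//.
apply: le_trans (lerD (ler_normD _ _) (lexx _)) _.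
have := ler_wpM2l L0 b1; have := ler_wpM2l L0 b2; have := mulr_ge0 L0 be0.
by move: (lam / H) (1 / H) C2 C3 => x y C2 C3; lra.
Qed.

Lemma density_dev : `|E - 1| <= 4 * L * (12 * lam + osc lam (H + 2)) / H.
Proof.
have C2 := cell_dev; have C3 := grid_dev.
have C4 : `|cell_avg n V g - grid_avg n g| <= 4 * L * (osc lam (H + 2) / H).
  have o0 : 0 <= osc lam (H + 2) by exact: sqrtr_ge0.
  apply: le_trans (scale o0).
  apply: (cell_avg_dev n0 lam1 hosc h0 hu ell0).
  - by move=> x y; exact: Kh_lip.
  - by move=> x; exact: Kh_supp.
rewrite (_ : E - 1 = (E - cell_avg n V g) + (cell_avg n V g - grid_avg n g) + (grid_avg n g - 1)); last by ring.
apply: le_trans (ler_normD _ _) _; apply: le_trans (lerD (ler_normD _ _) (lexx _)) _.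
have b : 1 / H <= lam / H by rewrite ler_pM2r ?invr_gt0// lam1.
have := ler_wpM2l L0 b; have e2 : 11 * lam / H = 11 * (lam / H) by ring.
rewrite e2 in C2.
rewrite (_ : 4 * L * (12 * lam + osc lam (H + 2)) / H =
  4 * L * (12 * (lam / H) + osc lam (H + 2) / H)); last by ring.
by move: (lam / H) (1 / H) (_ / H) C2 C3 C4 => x y w C2 C3 C4; lra.
Qed.

Lemma density_dev_lin : `|E - 1| <= L * (12 + 88 * be).
Proof.
apply: le_trans density_dev _.
have o : osc lam (H + 2) <= H + 2 + 10 * lam.
  by apply: osc_le_lin; [exact: lam1|have := H1; lra].
rewrite (_ : L * (12 + 88 * be) = 4 * L * ((3 * H + 22 * B) / H)); last first.
  by rewrite /be; field; rewrite !gt_eqF.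
rewrite -mulrA ler_wpM2l ?mulr_ge0 ?L0// ler_pM2r ?invr_gt0//.
by have := lamB; have := H1; lra.
Qed.

(** The square is of order log n / (nh), and log n <= [bk_scale]. With lam <= B <= H, expanding
    gives 608 = 288 + 64 + 128 + 128, and 16 times 608 is below 100^2. *)
Lemma density_dev_sqr : be <= 1 -> (E - 1) ^+ 2 <= (100 * (L + 1)) ^+ 2 * be.
Proof.
move=> b1; have BH : B <= H by move: b1; rewrite ler_pdivrMr// mul1r.
have lB := lamB; have l1 := lam1; have hH := H1.
have D := density_dev.
have d0 : 0 <= 4 * L * (12 * lam + osc lam (H + 2)) / H by exact: le_trans D.
rewrite -real_normK ?num_real//; apply: (@le_trans _ _ ((4 * L * (12 * lam + osc lam (H + 2)) / H) ^+ 2)).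
  by apply: lerXn2r => //; rewrite nnegrE.
have o2 : osc lam (H + 2) ^+ 2 = 32 * (H + 2 + 2 * lam) * lam.
  by rewrite sqr_sqrtr// !mulr_ge0//; lra.
have : (12 * lam + osc lam (H + 2)) ^+ 2 <= 608 * (H * B).
  by move: (osc lam (H + 2)) o2 => o o2; have := sqr_ge0 (12 * lam - o); nra.
move=> sq; rewrite (_ : (4 * L * _ / H) ^+ 2 =
  16 * L ^+ 2 / H ^+ 2 * (12 * lam + osc lam (H + 2)) ^+ 2); last by field; rewrite !gt_eqF.
apply: (@le_trans _ _ (16 * L ^+ 2 / H ^+ 2 * (608 * (H * B)))).
  by rewrite ler_wpM2l// divr_ge0 ?sqr_ge0// mulr_ge0 ?sqr_ge0.
rewrite (_ : 16 * L ^+ 2 / H ^+ 2 * (608 * (H * B)) = 16 * 608 * (L ^+ 2 * be)); last first.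
  by rewrite /be; field; rewrite !gt_eqF.
rewrite exprMn -[leRHS]mulrA; apply: ler_pM.
- exact: mulr_ge0 (ler0n _ 16) (ler0n _ 608).
- by rewrite mulr_ge0 ?sqr_ge0 ?be0.
- by rewrite expr2 -!natrM ler_nat.
by rewrite ler_wpM2r ?be0//; have := L0; nra.
Qed.

Lemma spacing_lower (eps : R) : 0 < eps -> eps <= be ->
  Num.min (kap * r * eps / 2) (kap * r ^+ 2 / 450) <= W * be.
Proof.
move=> e0 eb; have rp := r0; have kp := kap0; have hp := h0.
have /andP[hu1 hu2] := hu; have z1 := zr1; have z2 := zr2.
pose x := u - h * (z + r); pose y := u - h * (z - r).
have x0 : 0 <= x by rewrite /x; nra.
have xy : x <= y by rewrite /x /y; nra.
have y1 : y < 1 by rewrite /y; nra.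
have m0 : 0 <= kap / h by rewrite divr_ge0// ltW.
have gge w : x <= w <= y -> kap / h <= g w.
  rewrite /x /y => /andP[w1 w2]; rewrite /g /Kh mulrC ler_pM2l ?invr_gt0//.
  apply: K_ge; rewrite ler_pdivlMr// ler_pdivrMr//; apply/andP; split; nra.
have g0 w : 0 <= g w by exact: Kh_ge0.
have [se en es Wge] := spacing_avg_ge n0 Vmono g0 m0 x0 xy y1 gge.
set s := Num.truncn _ in se es Wge; set e := Num.truncn _ in se en es Wge.
have es' : 2 * (r * H) - 1 <= (e - s)%N%:R.
  apply: le_trans es; rewrite /x /y le_eqVlt; apply/orP; left; apply/eqP; by ring.
(* The window spans at least 2rH - 1 ranks and the modulus costs 4 + 10 lam, so 15 lam <= rH leaves
   n (V e - V s) >= rH/2 and bounds W below by a constant. *)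
have [big|small] := leP (15 * lam) (r * H).
  have gap := spacing_gap_osc n0 Vmono V0 V1 lam1 hosc se en.
  have Wr : kap * r / 2 <= W.
    apply: le_trans Wge.
    rewrite (_ : kap * r / 2 = kap / h * (r * H / (2 * n%:R))); last by field; rewrite !gt_eqF.
    rewrite ler_wpM2l// ler_pdivrMr ?mulr_gt0//.
    by have := lam1; lra.
  rewrite ge_min; apply/orP; left.
  rewrite (_ : kap * r * eps / 2 = kap * r / 2 * eps); last by ring.
  by apply: ler_pM => //; rewrite ?divr_ge0 ?mulr_ge0// ltW.
(* rH >= 33 gives 2rH - 1 >= 65, enough ranks for the cell bound. *)
have es64 : (64 <= e - s)%N by rewrite -(ler_nat R); apply: le_trans es'; have := rH; lra.
pose m : R := (Num.truncn (root8 n : R)).+1%:R.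
have GE : (cells (R := R) n)%:R = n%:R * m by rewrite /cells natrM.
have mpos : 0 < m by rewrite ltr0n.
have G0 : (0 < cells (R := R) n)%N by rewrite muln_gt0 n0.
have gap := spacing_gap_cells Vmono V0 V1 G0 hcells es64 en.
have x4 := root8_ge4 llog1 log_root.
have m2 : m <= 2 * root8 n.
  have /andP[+ _] := truncn_itv (root8_ge0 (R := R) n); rewrite /m -natr1; lra.
have Wm : kap / (H * (2 * root8 n)) <= W.
  apply: le_trans Wge; apply: le_trans (ler_wpM2l m0 gap).
  rewrite GE -subr_ge0.
  have -> : kap / h / (n%:R * m) - kap / (H * (2 * root8 n)) =
    kap * (2 * root8 n - m) / (H * m * (2 * root8 n)) by field; rewrite !gt_eqF//; lra.
  by rewrite divr_ge0 ?mulr_ge0 ?subr_ge0// ?(ltW mpos) ?(ltW h0)//; lra.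
(* W be is at least kap B / (2 n^(1/8) H^2). Since B >= n^(1/4), n^(1/8) >= lam^2 and rH < 15 lam,
   the powers of n and log n cancel. *)
rewrite ge_min; apply/orP; right.
have x2B := root8_bk llog1.
apply: (@le_trans _ _ (kap / (H * (2 * root8 n)) * be)); last first.
  by rewrite ler_wpM2r ?be0.
have lr := log_root; have l1 := lam1; have hH := H1.
rewrite -subr_ge0.
have -> : kap / (H * (2 * root8 n)) * be - kap * r ^+ 2 / 450 =
  kap / (2 * root8 n * H ^+ 2) * (B - root8 n * (r * H) ^+ 2 / 225).
  by rewrite /be; field; rewrite !gt_eqF//; lra.
have x0' : 0 <= root8 n :> R by lra.
apply: mulr_ge0; first by rewrite divr_ge0 ?mulr_ge0 ?exprn_ge0// ltW.
rewrite subr_ge0; apply: le_trans x2B; rewrite expr2 -mulrA ler_wpM2l//.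
apply: le_trans lr; rewrite ler_pdivrMr//.
have : (r * H) ^+ 2 <= (15 * lam) ^+ 2.
  by apply: lerXn2r; rewrite ?nnegrE ?mulr_ge0 ?(ltW small) ?(ltW r0) ?(ltW h0)//; lra.
lra.
Qed.

Lemma path_bound : let C := path_const (100 * (L + 1)) kap r in
  [/\ 0 < W, `|E - W^-1| <= C * be
    & forall eta : R, 0 <= eta <= 1 -> eta / W <= 2 * eta + C * be].
Proof.
have l0 := L0; have b0 := be0; have a0 : 0 < 100 * (L + 1) by lra.
have lb := mulr_ge0 l0 b0.
apply: regimes => //.
- lra.
- exact: path_low_gt0.
- by apply: le_trans sum_avg _; lra.
- by apply: le_trans density_dev_lin _; lra.
- exact: density_dev_sqr.
- by move=> eb; apply: spacing_lower eb; exact: path_eps_gt0.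
Qed.

End PathBound.

(** * From order statistics to the sorted uniform sample *)

Section OrderStatistics.
Context {d} {T : measurableType d} {R : realType} (P : probability T R).
Variables (b : nat -> T -> R) (F Q : R -> R).
Hypothesis hb : forall i, measurable_fun setT (b i).
Hypothesis hF : forall i x, P (b i @^-1` `]-oo, x]) = (F x)%:E.
Hypothesis hFQ : forall u : R, u \in `[0, 1] -> F (Q u) = u.
Hypothesis hQc : {within `[0, 1], continuous Q}.

(** Continuity makes Q onto [Q 0, Q 1], so the relation F (Q u) = u can be reversed there. *)
Lemma quantile_cdf (x : R) : Q 0 <= x <= Q 1 -> Q (F x) = x /\ 0 <= F x <= 1.
Proof.
move=> x01; have Q01 : Q 0 <= Q 1 by apply: (quantile_le hb hF hFQ).
have [c c01 <-] : exists2 c, c \in `[0, 1]%R & Q c = x.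
  by apply: IVT => //; rewrite ge_min le_max; case/andP: x01 => -> ->; rewrite orbT.
by rewrite hFQ//; move: c01; rewrite in_itv.
Qed.

Lemma cdf_le_quantile (x u : R) : Q 0 <= x <= Q 1 -> 0 <= u <= 1 -> (F x <= u) = (x <= Q u).
Proof.
move=> x01 u01; have [QF /andP[F0 F1]] := quantile_cdf x01.
apply/idP/idP => [Fu|/(cdf_homo hb hF)]; last by rewrite hFQ// in_itv.
by rewrite -QF; apply: (quantile_le hb hF hFQ) => //; case/andP: u01.
Qed.

(** The left end is excluded so that every F (b i) is positive and falls in one of the half-open
    cells ]i/n, (i+1)/n]. *)
Lemma ae_in_support : {ae P, forall t, forall i, Q 0 < b i t <= Q 1}.
Proof.
have H i : P.-negligible (~` [set t | Q 0 < b i t <= Q 1]).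
  have m : measurable (b i @^-1` `]Q 0, Q 1]) by rewrite -[X in measurable X]setTI; exact: hb.
  have -> : [set t | Q 0 < b i t <= Q 1] = b i @^-1` `]Q 0, Q 1].
    by apply/seteqP; split => t /=; rewrite in_itv.
  apply/negligibleP; first exact: measurableC.
  apply: etrans (probability_setC P m) _.
  by rewrite (prob_itv hb hF hFQ i)// subr0 subee.
apply: negligibleS (negligible_bigcup H) => t /= /existsNP[i ni]; by exists i.
Qed.

Variables (n : nat) (t : T).
Hypothesis n0 : (0 < n)%N.
Hypothesis supp : forall i, Q 0 < b i t <= Q 1.

Let s := sort <=%R (mkseq (fun i => b i t) n).
Let sz : size s = n. Proof. by rewrite size_sort size_mkseq. Qed.
Let os k := ostat b n t k.
Let V k := F (os k).

Let os_supp k : (k < n)%N -> Q 0 < os k <= Q 1.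
Proof.
move=> kn; have : os k \in s by rewrite /os /ostat mem_nth// sz.
by rewrite mem_sort => /mapP[i _ ->].
Qed.

Let os_supp' k : (k < n)%N -> Q 0 <= os k <= Q 1.
Proof. by move=> /os_supp/andP[/ltW -> ->]. Qed.

Lemma ostat_mono k l : (k <= l)%N -> (l < n)%N -> os k <= os l.
Proof.
move=> kl ln; apply: (sorted_leq_nth le_trans le_refl) => //; rewrite ?inE ?sz//.
  exact: sort_le_sorted.
exact: leq_ltn_trans ln.
Qed.

Lemma ostatE k : (k < n)%N -> ostat b n t k = Q (V k).
Proof. by move=> /os_supp'/quantile_cdf[]. Qed.

Lemma V_mono k l : (k <= l)%N -> (l < n)%N -> V k <= V l.
Proof. by move=> kl ln; apply: (cdf_homo hb hF); exact: ostat_mono. Qed.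

Lemma V_gt0 k : (k < n)%N -> 0 < V k.
Proof.
move=> kn; have [QF /andP[F0 _]] := quantile_cdf (os_supp' kn).
rewrite lt_neqAle F0 andbT; apply/eqP => V0.
by have /andP[+ _] := os_supp kn; rewrite -QF -/(V k) -V0 ltxx.
Qed.

Lemma V_le1 k : (k < n)%N -> V k <= 1.
Proof. by move=> /os_supp'/quantile_cdf[_ /andP[]]. Qed.

Lemma sum_ostat (f : R -> R) : \sum_(0 <= i < n) f (b i t) = \sum_(0 <= k < n) f (os k).
Proof.
have -> : \sum_(0 <= i < n) f (b i t) = \sum_(x <- mkseq (fun i => b i t) n) f x.
  by rewrite big_map /index_iota subn0.
rewrite (perm_big s); last by rewrite perm_sym; exact/permPl/perm_sort.
by rewrite (big_nth 0) sz.
Qed.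

(** Sorting does not change a sum over the sample, and on the support F x <= u means x <= Q u. *)
Lemma cntE (u : R) : 0 <= u <= 1 -> cnt n V u = csum b Q 0 n u t + n%:R * u.
Proof.
move=> u01; rewrite /csum sumrB sumr_const_nat subn0 -[u *+ n]mulr_natl subrK.
rewrite (sum_ostat (fun x => (x <= Q u)%R%:R)); apply: eq_big_nat => k /andP[_ kn].
by rewrite cdf_le_quantile// os_supp'.
Qed.

Lemma cnt_diff (u v : R) : 0 <= u -> u <= v -> v <= 1 ->
  cnt n V v - cnt n V u = csum2 b Q 0 n u v t + n%:R * (v - u).
Proof.
move=> u0 uv v1; rewrite !cntE; [|by apply/andP; split; lra..].
by rewrite (csum2E hb hF hFQ 0 n t u0 uv v1); ring.
Qed.

Lemma cnt_cell (u v : R) : 0 <= u -> u <= v -> v <= 1 ->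
  cnt n V v - cnt n V u = \sum_(0 <= k < n) (Q u < b k t <= Q v)%R%:R.
Proof.
move=> u0 uv v1; rewrite cnt_diff// /csum2 sumrB sumr_const_nat subn0.
by rewrite -[(v - u) *+ n]mulr_natl subrK.
Qed.

Let nR : 0 < n%:R :> R. Proof. by rewrite ltr0n. Qed.

Let grid01 j : (j <= n)%N -> 0 <= (j%:R / n%:R : R) <= 1.
Proof. by move=> jn; rewrite divr_ge0//= ler_pdivrMr// mul1r ler_nat. Qed.

Lemma gcnt_dev j : (j <= n)%N -> gcnt n V j - j%:R = csum b Q 0 n (j%:R / n%:R) t.
Proof.
by move=> jn; rewrite /gcnt cntE ?grid01//; field; rewrite gt_eqF.
Qed.

Lemma gcnt_diff i j : (i <= j <= n)%N -> gcnt n V j - gcnt n V i - (j%:R - i%:R) =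
  csum2 b Q 0 n (i%:R / n%:R) (j%:R / n%:R) t.
Proof.
move=> /andP[ij jn]; have /andP[i0 _] := grid01 (leq_trans ij jn); have /andP[_ j1] := grid01 jn.
rewrite /gcnt cnt_diff//; first by field; rewrite gt_eqF.
by rewrite ler_pM2r ?invr_gt0// ler_nat.
Qed.

Let rank_lt (x : R) : 0 <= x -> x < 1 -> (Num.truncn (n%:R * x) < n)%N.
Proof.
move=> x0 x1; rewrite -(ltr_nat R).
have /andP[+ _] := truncn_itv (mulr_ge0 (ltW nR) x0).
by move/le_lt_trans; apply; rewrite gtr_pMr.
Qed.

(** Stated on the whole line, as measurability of the integrand asks; for negative arguments
    [Num.truncn] returns rank 0. *)
Lemma Qhat_mono : {homo Qhat b n t : x y / x <= y}.
Proof.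
have pn : (n.-1 < n)%N by rewrite prednK.
have tn (x : R) : x < 1 -> (Num.truncn (n%:R * x) < n)%N.
  move=> x1; have [x0|x0] := leP 0 x; first exact: rank_lt.
  suff -> : Num.truncn (n%:R * x) = 0%N by [].
  by apply/eqP; rewrite -leqn0 truncn_le_nat; apply: lt_trans ltr01; rewrite pmulr_rlt0.
move=> x y xy; rewrite /Qhat; case: ifPn => [x1|]; case: ifPn => [y1|] //.
- by apply: ostat_mono; rewrite ?tn//; apply: le_truncn; rewrite ler_pM2l.
- by move=> _; apply: ostat_mono => //; rewrite -ltnS prednK// tn.
- by rewrite (le_lt_trans xy y1).
Qed.

Lemma Qhat_rank (x Lam : R) : 0 <= x <= 1 ->
  (forall j, (j < n)%N -> `|n%:R * V j - j.+1%:R| <= Lam + 1) ->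
  exists2 j, (j < n)%N & Qhat b n t x = Q (V j) /\ `|V j - x| <= (Lam + 2) / n%:R.
Proof.
move=> /andP[x0 x1] dev.
have close j : (j < n)%N -> `|j.+1%:R - n%:R * x| <= 1 -> `|V j - x| <= (Lam + 2) / n%:R.
  move=> jn jx; rewrite ler_pdivlMr// -[n%:R]ger0_norm// -normrM mulrBl.
  rewrite (_ : _ - _ = (n%:R * V j - j.+1%:R) + (j.+1%:R - n%:R * x)); last by ring.
  by apply: le_trans (ler_normD _ _) _; have := dev j jn; lra.
have [x1'|x1'] := ltP x 1.
  have jn := rank_lt x0 x1'; exists (Num.truncn (n%:R * x)) => //.
  split; first by rewrite /Qhat x1' ostatE.
  apply: close => //.
  have /andP[] := truncn_itv (mulr_ge0 (ltW nR) x0); rewrite -natr1 => a c.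
  by rewrite ler_norml; apply/andP; split; lra.
have xE : x = 1 by lra.
have pn : (n.-1 < n)%N by rewrite prednK.
exists n.-1 => //; split; first by rewrite /Qhat xE ltxx ostatE.
by apply: close => //; rewrite prednK// xE mulr1 subrr normr0.
Qed.

End OrderStatistics.

(** * Eventual inequalities and the final algebra *)

Section Assembly.
Context {R : realType}.

Lemma nat_eventually_ge (C : R) : \forall n \near \oo, C <= n%:R.
Proof. by near do apply: ltW; exact: nbhs_infty_gtr. Unshelve. all: by end_near. Qed.

Lemma root8_eventually (C : R) : \forall n \near \oo, C <= root8 n.
Proof.
apply: filterS (nat_eventually_ge (`|C| ^+ 8)) => n Cn.
apply: le_trans (ler_norm _) _.
by rewrite -(@ler_pXn2r _ 8)// ?nnegrE ?root8_ge0// root8_pow.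
Qed.

Lemma log_root_eventually : \forall n \near \oo, (log1 n : R) ^+ 2 <= root8 n.
Proof.
apply: filterS (root8_eventually (32 ^+ 4)) => n Hn.
have x0 : 0 < root8 n :> R by apply: lt_le_trans Hn; rewrite exprn_gt0.
(* y = n^(1/32): once y >= 32, log n = 32 log y <= y^2, and y^4 = n^(1/8). *)
pose y : R := Num.sqrt (Num.sqrt (root8 n)).
have y0 : 0 < y by rewrite 2!sqrtr_gt0.
have xy : root8 n = y ^+ 4 by rewrite (exprM _ 2 2) sqr_sqrtr ?sqrtr_ge0// sqr_sqrtr// ltW.
have y32 : 32 <= y by rewrite -(@ler_pXn2r _ 4)// ?nnegrE ?(ltW y0)// -xy.
have -> : log1 n = 32 * ln y.
  rewrite /log1 -root8_pow xy -exprM lnXn//.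
  by rewrite mulr_natl.
have l0 : 0 <= ln y by apply: ln_ge0; lra.
have ly : ln y <= y by apply/ltW/ln_sublinear.
rewrite xy (exprM _ 2 2); apply: lerXn2r; rewrite ?nnegrE ?sqr_ge0 ?mulr_ge0//.
by rewrite expr2; apply: ler_pM.
Qed.

Lemma llog_eventually : \forall n \near \oo, 1 <= ln (log1 n : R).
Proof.
apply: filterS (nat_eventually_ge (expR (expR 1))) => n Hn.
have e1 : expR 1 <= log1 n :> R.
  rewrite -[leLHS]expRK ler_ln ?posrE ?expR_gt0//.
  by apply: lt_le_trans Hn; rewrite expR_gt0.
rewrite -[leLHS]expRK ler_ln ?posrE ?expR_gt0//.
by apply: lt_le_trans e1; rewrite expR_gt0.
Qed.

Lemma lipschitz_of_derive (f df : R -> R) (M : R) : {within `[0, 1], continuous f} ->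
  (forall x : R, x \in `]0, 1[ -> is_derive x 1 f (df x)) ->
  (forall x : R, 0 <= x <= 1 -> `|df x| <= M) ->
  forall x y : R, 0 <= x <= 1 -> 0 <= y <= 1 -> `|f y - f x| <= M * `|y - x|.
Proof.
move=> fc fd dM.
suff H (x y : R) : 0 <= x -> x <= y -> y <= 1 -> `|f y - f x| <= M * `|y - x|.
  move=> x y /andP[x0 x1] /andP[y0 y1]; have [xy|/ltW yx] := leP x y; first exact: H.
  by rewrite distrC [`|y - x|]distrC; exact: H.
move=> x0 xy y1.
have sub : `[x, y]%classic `<=` `[0, 1]%classic.
  by move=> z /=; rewrite !in_itv /= => /andP[a c]; apply/andP; split; lra.
have fd' (v : R) : v \in `]x, y[%R -> is_derive v 1 f (df v).
  by rewrite in_itv /= => /andP[a c]; apply: fd; rewrite in_itv /=; apply/andP; split; lra.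
have [c cxy ->] := MVT_segment xy fd' (continuous_subspaceW sub fc).
rewrite normrM ler_wpM2r//; apply: dM.
by move: cxy; rewrite in_itv /= => /andP[a e]; apply/andP; split; lra.
Qed.

(** The left-hand side is pA (E - 1/W) + pA (1/W - q/qh) + dd/qh. The relative error bound gives qh
    >= c0 W / 2, so the last two terms are multiples of eta/W. *)
Lemma combine (pA q qh W E dd C be eta c0 Lq CpA Cd : R) :
  0 < W -> 0 < c0 -> c0 <= q -> 0 <= eta -> 0 <= Lq -> 0 <= CpA -> 0 <= Cd ->
  `|qh - q * W| <= Lq * eta * W -> Lq * eta <= c0 / 2 ->
  `|E - W^-1| <= C * be -> eta / W <= 2 * eta + C * be ->
  `|pA| <= CpA -> `|dd| <= Cd * eta ->
  `|(pA * (qh - q) + dd) / qh + pA * (E - 1)| <=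
    CpA * (C * be) + (CpA * (2 * Lq) + 2 * Cd) / c0 * (2 * eta + C * be).
Proof.
move=> W0 c00 cq e0 L0 A0 d0 qhW Lc EW eW pAc ddc.
have qhl : c0 / 2 * W <= qh.
  move: qhW; rewrite ler_norml => /andP[a _].
  have := ler_wpM2r (ltW W0) Lc; have := ler_wpM2r (ltW W0) cq; lra.
have cW : 0 < c0 / 2 * W by rewrite mulr_gt0// divr_gt0.
have qh0 : 0 < qh by exact: lt_le_trans qhl.
have iq : qh^-1 <= (c0 / 2 * W)^-1 by rewrite lef_pV2 ?posrE.
have -> : (pA * (qh - q) + dd) / qh + pA * (E - 1) =
  pA * (E - W^-1) + (pA * ((qh - q * W) / W / qh) + dd / qh).
  by field; rewrite !gt_eqF.
apply: le_trans (ler_normD _ _) (lerD _ _).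
  by rewrite normrM; apply: ler_pM.
have M0 : 0 <= (CpA * (2 * Lq) + 2 * Cd) / c0.
  by rewrite divr_ge0 ?(ltW c00)// addr_ge0// !mulr_ge0.
apply: le_trans (ler_wpM2l M0 eW).
have -> : (CpA * (2 * Lq) + 2 * Cd) / c0 * (eta / W) =
  CpA * (Lq * eta * (c0 / 2 * W)^-1) + Cd * eta * (c0 / 2 * W)^-1.
  by field; rewrite !gt_eqF.
apply: le_trans (ler_normD _ _) (lerD _ _); rewrite normrM.
  apply: ler_pM => //; rewrite normrM [`|qh^-1|]ger0_norm ?invr_ge0 ?(ltW qh0)//.
  apply: ler_pM => //; first by rewrite invr_ge0 ltW.
  by rewrite normrM [`|W^-1|]ger0_norm ?invr_ge0 ?(ltW W0)// ler_pdivrMr.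
rewrite [`|qh^-1|]ger0_norm ?invr_ge0 ?(ltW qh0)//.
by apply: ler_pM => //; rewrite invr_ge0 ltW.
Qed.

End Assembly.

(** * The expansion for one outcome and one sample size *)

Section Pathwise.
Context {d} {T : measurableType d} {R : realType} (P : probability T R).
Variables (b : nat -> T -> R) (F Q q q2 : R -> R).
Hypothesis hb : forall i, measurable_fun setT (b i).
Hypothesis hF : forall i x, P (b i @^-1` `]-oo, x]) = (F x)%:E.
Hypothesis hFc : continuous F.
Hypothesis hFQ : forall u : R, u \in `[0, 1] -> F (Q u) = u.
Hypothesis hQc : {within `[0, 1], continuous Q}.
Hypothesis hQd : forall u : R, u \in `]0, 1[ -> is_derive u 1 Q (q u).
Hypothesis hqc : {within `[0, 1], continuous q}.
Hypothesis hqd : forall u : R, u \in `]0, 1[ -> is_derive u 1 q (q2 u).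
Variables (M : nat) (p : nat -> R) (phi psi dpsi : R -> R).
Hypothesis hA1' : forall u : R, u \in `[0, 1] -> A1' M p u != 0.
Hypothesis hpsic : {within `[0, 1], continuous psi}.
Hypothesis hpsid : forall u : R, u \in `]0, 1[ -> is_derive u 1 psi (dpsi u).
Hypothesis hdpsic : {within `[0, 1], continuous dpsi}.
Variables (K : R -> R) (L z r kap : R).
Hypothesis K0 : forall x : R, 0 <= K x.
Hypothesis K1 : (\int[lebesgue_measure]_x (K x)%:E = 1)%E.
Hypothesis Klip : forall x y, `|K x - K y| <= L * `|x - y|.
Hypothesis Ksupp : forall x : R, 1 < `|x| -> K x = 0.
Hypothesis r0 : 0 < r.
Hypothesis kap0 : 0 < kap.
Hypothesis zr1 : -1 < z - r.
Hypothesis zr2 : z + r < 1.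
Hypothesis K_ge : forall x, z - r <= x <= z + r -> kap <= K x.
Variables (c0 Cq Lq CA Cphi CX Cpsi : R).
Hypothesis c00 : 0 < c0.
Hypothesis hc0 : forall u : R, 0 <= u <= 1 -> c0 <= q u.
Hypothesis hCq : forall u : R, 0 <= u <= 1 -> `|q u| <= Cq.
Hypothesis hLq : forall u : R, 0 <= u <= 1 -> `|q2 u| <= Lq.
Hypothesis hCA : forall u : R, 0 <= u <= 1 -> `|Afun M p u| <= CA.
Hypothesis hCphi : forall u : R, 0 <= u <= 1 -> `|phi u| <= Cphi.
Hypothesis hCX : forall u : R, 0 <= u <= 1 -> `|chi M p psi dpsi u| <= CX.
Hypothesis hCpsi : forall u : R, 0 <= u <= 1 -> `|psi u| <= Cpsi.

(** [Cd] bounds the part linear in Qhat - Q per unit of eta, and 402 comes from eta <= 402 (h +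
    be). *)
Definition main_const : R :=
  let C := path_const (100 * (L + 1)) kap r in
  let Cd := Cphi * Cq + (CX + 2 * (CA * Cpsi)) * Cq in
  Cphi * CA * C + (Cphi * CA * (2 * Lq) + 2 * Cd) / c0 * (2 * 402 + C).

Variables (n : nat) (t : T) (h u : R).
Hypothesis supp : forall i, Q 0 < b i t <= Q 1.
Hypothesis llog1 : 1 <= ln (log1 n : R).
Hypothesis log_root : (log1 n : R) ^+ 2 <= root8 n.
Hypothesis hlil : forall v : R, 0 <= v <= 1 -> `|csum b Q 0 n v t| <= 400 * lil_scale n.
Hypothesis hosc : forall i j, (i <= j <= n)%N ->
  `|csum2 b Q 0 n (i%:R / n%:R) (j%:R / n%:R) t| <= osc (log1 n) ((j - i)%N%:R).
Hypothesis hcells : forall i, (i < cells (R := R) n)%N ->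
  \sum_(0 <= k < n) (Q (i%:R / (cells (R := R) n)%:R) < b k t
     <= Q (i.+1%:R / (cells (R := R) n)%:R))%R%:R < 32 :> R.
Hypothesis h0 : 0 < h.
Hypothesis hu : h <= u <= 1 - h.
Hypothesis H1 : 1 <= n%:R * h.
Hypothesis rH : 33 <= r * (n%:R * h).
Hypothesis small1 : h + 401 / root8 n <= 1.
Hypothesis small2 : Lq * (h + 401 / root8 n) <= c0 / 2.

Let nR := nat_gt0 llog1 log_root.
Let n0 : (0 < n)%N. Proof. by have := nR; rewrite ltr0n. Qed.
Let V k := F (ostat b n t k).
Let g x := Kh K h (u - x).
Let Lam : R := 400 * lil_scale n.
Let eta := h + (Lam + 2) / n%:R.
Let be : R := bk_scale n / (n%:R * h).
Let W := spacing_avg n V g.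
Let E := density_avg n V g.

Let u01 : 0 < u < 1.
Proof. by have := h0; case/andP: hu => ? ? ?; apply/andP; split; lra. Qed.
Let u01' : 0 <= u <= 1. Proof. by case/andP: u01 => /ltW -> /ltW ->. Qed.

Let Vmono := @V_mono _ _ _ P b F hb hF n t.
Let V0 := @V_gt0 _ _ _ P b F Q hb hF hFQ hQc n t supp.
Let V1 := @V_le1 _ _ _ P b F Q hb hF hFQ hQc n t supp.

Let hlilV j : (j <= n)%N -> `|gcnt n V j - j%:R| <= Lam.
Proof.
move=> jn; rewrite (gcnt_dev hb hF hFQ hQc n0 supp jn); apply: hlil.
by rewrite divr_ge0//= ler_pdivrMr ?nR// mul1r ler_nat.
Qed.

Let hoscV i j : (i <= j <= n)%N ->
  `|gcnt n V j - gcnt n V i - (j%:R - i%:R)| <= osc (log1 n) (j%:R - i%:R).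
Proof.
move=> ijn; rewrite (gcnt_diff hb hF hFQ hQc n0 supp ijn) -natrB; first exact: hosc.
by case/andP: ijn.
Qed.

Let hcellsV i : (i < cells (R := R) n)%N ->
  cnt n V (i.+1%:R / (cells (R := R) n)%:R) - cnt n V (i%:R / (cells (R := R) n)%:R) < 32.
Proof.
move=> iG; have GR : 0 < (cells (R := R) n)%:R :> R by rewrite ltr0n (leq_ltn_trans _ iG).
rewrite (cnt_cell hb hF hFQ hQc n supp); first exact: hcells.
- by rewrite divr_ge0.
- by rewrite ler_pM2r ?invr_gt0// ler_nat.
- by rewrite ler_pdivrMr// mul1r ler_nat.
Qed.

Let eta_ge0 : 0 <= eta.
Proof.
apply: addr_ge0; first exact: ltW.
apply: divr_ge0; last exact: ltW nR.
by apply: addr_ge0 => //; exact: mulr_ge0 (ler0n _ 400) (sqrtr_ge0 _).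
Qed.

Let eta_le : eta <= h + 401 / root8 n.
Proof. by rewrite lerD2l; exact: lil_root. Qed.

Let lipQ := lipschitz_of_derive hQc hQd hCq.
Let lipq := lipschitz_of_derive hqc hqd hLq.

Let Lq0 : 0 <= Lq. Proof. exact: le_trans (normr_ge0 _) (hLq u01'). Qed.
Let Cq0 : 0 <= Cq. Proof. exact: le_trans (normr_ge0 _) (hCq u01'). Qed.

Let taylor (x y : R) : 0 <= x -> x <= y -> y <= 1 -> `|x - u| <= eta -> `|y - u| <= eta ->
  `|Q y - Q x - q u * (y - x)| <= Lq * eta * (y - x).
Proof.
move=> x0 xy y1 xu yu.
have sub : `[x, y]%classic `<=` `[0, 1]%classic.
  by move=> v /=; rewrite !in_itv /= => /andP[a c]; apply/andP; split; lra.
have Qd' (v : R) : v \in `]x, y[%R -> is_derive v 1 Q (q v).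
  by rewrite in_itv /= => /andP[a c]; apply: hQd; rewrite in_itv /=; apply/andP; split; lra.
have [c cxy ->] := MVT_segment xy Qd' (continuous_subspaceW sub hQc).
move: cxy; rewrite in_itv /= => /andP[xc cy].
rewrite -mulrBl normrM [`|y - x|]ger0_norm ?subr_ge0// ler_wpM2r ?subr_ge0//.
have c01 : 0 <= c <= 1 by apply/andP; split; lra.
apply: le_trans (lipq u01' c01) _; rewrite ler_wpM2l ?Lq0//.
by move: xu yu; rewrite !ler_norml => /andP[? ?] /andP[? ?]; apply/andP; split; lra.
Qed.

Let qhatE : qhat K b n h t u = \sum_(1 <= i < n) g (i%:R / n%:R) * (Q (V i) - Q (V i.-1)).
Proof.
apply: eq_big_nat => i /andP[i1 iN].
have iN' : (i.-1 < n)%N by exact: leq_ltn_trans (leq_pred _) iN.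
by congr (_ * (_ - _)); exact: (ostatE hb hF hFQ hQc supp).
Qed.

Let Qhat_dev (x : R) : 0 <= x <= 1 -> `|Qhat b n t x - Q x| <= Cq * eta.
Proof.
move=> x01.
have [j jn [-> Vx]] := Qhat_rank hb hF hFQ hQc n0 supp x01
  (fun j => quantile_dev n0 Vmono V0 V1 hlilV (j := j)).
have V01 : 0 <= V j <= 1 by rewrite (ltW (V0 jn)) V1.
apply: le_trans (lipQ x01 V01) _; rewrite ler_wpM2l ?Cq0//.
by apply: le_trans Vx _; rewrite lerDr ltW.
Qed.

Let GnhE : Gnh P K F b n h t u = Num.sqrt (n%:R * h) * (E - 1).
Proof.
rewrite /Gnh; congr (_ * _).
under eq_bigr => i _ do rewrite (expect_Kh i hb hF hFc hFQ K0 K1 Klip Ksupp h0 hu).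
rewrite sumrB sumr_const card_ord mulrBr -[1 *+ n]mulr_natl mulr1 mulVf ?gt_eqF ?nR//.
congr (_ * _ - _); rewrite -(big_mkord xpredT (fun i => Kh K h (u - F (b i t)))).
by rewrite (sum_ostat b n t (fun x => Kh K h (u - F x))).
Qed.

Lemma pathwise_bound :
  `| Num.sqrt (n%:R * h)
       * (That M p K phi psi dpsi b n h t u - Tcf M p Q q phi psi u)
       / qhat K b n h t u
     - (- (phi u * Afun M p u * Gnh P K F b n h t u)) | <= main_const * rate n h.
Proof.
have [W0 EW etaW] := path_bound K0 K1 Klip Ksupp r0 kap0 zr1 zr2 K_ge Vmono V0 V1
  llog1 log_root hlilV hoscV hcellsV h0 hu H1 rH.
rewrite -/V -/g -/W -/E -/be in W0 EW etaW.
set C := path_const _ _ _ in EW etaW.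
have eta1 : 0 <= eta <= 1 by rewrite eta_ge0 (le_trans eta_le small1).
have Lqe : Lq * eta <= c0 / 2 by apply: le_trans small2; rewrite ler_wpM2l ?Lq0 ?eta_le.
have qW := weighted_spacing n0 Vmono V0 V1 hlilV h0 (fun x => Kh_ge0 K0 u h0 x)
  (fun x => Kh_supp Klip Ksupp h0 (u := u) (x := x)) taylor.
rewrite -qhatE -/W in qW.
have CA0 : 0 <= CA by exact: le_trans (normr_ge0 _) (hCA u01').
have Cphi0 : 0 <= Cphi by exact: le_trans (normr_ge0 _) (hCphi u01').
have CX0 : 0 <= CX by exact: le_trans (normr_ge0 _) (hCX u01').
have Cpsi0 : 0 <= Cpsi by exact: le_trans (normr_ge0 _) (hCpsi u01').
have Aps (x : R) : 0 <= x <= 1 -> `|Afun M p x * psi x| <= CA * Cpsi.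
  by move=> x01; rewrite normrM; apply: ler_pM => //; [exact: hCA|exact: hCpsi].
have Sdev := plugin_dev hA1' hQc hQd hqc hpsic hpsid hdpsic u01
  (Qhat_mono b t n0) Qhat_dev hCX Aps.
set A := Afun M p u in Sdev *; set qh := qhat K b n h t u in qW *.
pose dd := phi u * (Qhat b n t u - Q u) + (Shat M p psi dpsi b n t u -
  \int[lebesgue_measure]_(x in `[u, 1]) (psi x * vfun M p Q q x)).
pose Cd := Cphi * Cq + (CX + 2 * (CA * Cpsi)) * Cq.
have ddc : `|dd| <= Cd * eta.
  apply: le_trans (ler_normD _ _) _; rewrite /Cd mulrDl; apply: lerD.
    by rewrite -mulrA normrM; apply: ler_pM => //; [exact: hCphi|exact: Qhat_dev].
  by apply: le_trans Sdev _; rewrite mulrA.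
have Tdiff : That M p K phi psi dpsi b n h t u - Tcf M p Q q phi psi u =
    phi u * A * (qh - q u) + dd.
  by rewrite /That /Tcf /vhat /dd /vfun -/A -/qh; ring.
have Cd0 : 0 <= Cd by rewrite addr_ge0 ?mulr_ge0 ?addr_ge0 ?mulr_ge0 ?Cq0.
have pAc : `|phi u * A| <= Cphi * CA.
  by rewrite normrM; apply: ler_pM => //; [exact: hCphi|exact: hCA].
have := combine W0 c00 (hc0 u01') eta_ge0 Lq0 (mulr_ge0 Cphi0 CA0) Cd0 qW Lqe EW
  (etaW _ eta1) pAc ddc.
rewrite -Tdiff GnhE => D.
set Z := That _ _ _ _ _ _ _ _ _ _ _ - _ in D *.
rewrite (_ : _ - _ = Num.sqrt (n%:R * h) * (Z / qh + phi u * A * (E - 1))); last by ring.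
rewrite normrM ger0_norm ?sqrtr_ge0//.
have be0 : 0 <= be by rewrite divr_ge0 ?bk_scale_ge0// mulr_ge0// ltW.
have H0 := h0.
have eta402 : eta <= 402 * (h + be).
  by have := lil_rate llog1 log_root h0; rewrite /eta -/Lam -/be; lra.
have C0 : 0 <= C.
  by apply: path_const_ge0 => //; have := Klip 1 0; rewrite subr0 normr1 mulr1 => /(le_trans (normr_ge0 _)) L0; lra.
have Cbe : C * be <= C * (h + be) by rewrite ler_wpM2l//; lra.
apply: le_trans (ler_wpM2l (sqrtr_ge0 _) D) _.
set M' := (Cphi * CA * (2 * Lq) + 2 * Cd) / c0.
have M0 : 0 <= M'.
  by rewrite divr_ge0 ?(ltW c00)// addr_ge0 ?mulr_ge0 ?Lq0.
have mcE : main_const = Cphi * CA * C + M' * (2 * 402 + C) by [].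
have bnd : Cphi * CA * (C * be) + M' * (2 * eta + C * be) <= main_const * (h + be).
  rewrite mcE [leRHS]mulrDl; apply: lerD.
    by rewrite -[leRHS]mulrA ler_wpM2l ?mulr_ge0.
  by rewrite -[leRHS]mulrA ler_wpM2l// [leRHS]mulrDl; lra.
have mc0 : 0 <= main_const.
  rewrite mcE; apply: addr_ge0; first by rewrite !mulr_ge0.
  by apply: (mulr_ge0 M0); apply: addr_ge0 C0; exact: mulr_ge0 (ler0n _ 2) (ler0n _ 402).
apply: le_trans (ler_wpM2l (sqrtr_ge0 _) bnd) _.
by rewrite mulrCA ler_wpM2l// rate_ge.
Qed.

End Pathwise.

(** * The almost sure uniform expansion *)

Unset Implicit Arguments.

Theorem mainTheorem7 (R : realType) (d : measure_display) (T : measurableType d)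
  (P : probability T R) (b : nat -> T -> R)
  (F Q q q2 : R -> R) (M : nat) (p : nat -> R) (K : R -> R)
  (phi dphi psi dpsi : R -> R) (h : nat -> R)
  (* standing assumption: b_1, b_2, ... i.i.d. with continuous CDF F *)
  (hbmeas : forall i, measurable_fun setT (b i))
  (hind : mutually_independent P b)
  (hF : forall i x, P (b i @^-1` `]-oo, x]) = (F x)%:E)
  (hFc : continuous F)
  (* Q = F^{-1} on [0,1], twice continuously differentiable, q = Q' > 0 *)
  (hFQ : forall u : R, u \in `[0, 1] -> F (Q u) = u)
  (hQc : {within `[0, 1], continuous Q})
  (hQd : forall u : R, u \in `]0, 1[ -> is_derive u 1 Q (q u))
  (hqc : {within `[0, 1], continuous q})
  (hqd : forall u : R, u \in `]0, 1[ -> is_derive u 1 q (q2 u))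
  (hq2c : {within `[0, 1], continuous q2})
  (hqpos : forall u : R, u \in `[0, 1] -> 0 < q u)
  (* p_1, ..., p_M nonnegative, A_1' <> 0 on [0,1] *)
  (hp : forall m, (1 <= m <= M)%N -> 0 <= p m)
  (hA1' : forall u : R, u \in `[0, 1] -> A1' M p u != 0)
  (* phi, psi continuously differentiable on [0,1] *)
  (hphic : {within `[0, 1], continuous phi})
  (hphid : forall u : R, u \in `]0, 1[ -> is_derive u 1 phi (dphi u))
  (hdphic : {within `[0, 1], continuous dphi})
  (hpsic : {within `[0, 1], continuous psi})
  (hpsid : forall u : R, u \in `]0, 1[ -> is_derive u 1 psi (dpsi u))
  (hdpsic : {within `[0, 1], continuous dpsi})
  (* Assumption 2 on the kernel K *)
  (hK0 : forall x : R, 0 <= K x)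
  (hK1 : (\int[lebesgue_measure]_x (K x)%:E = 1)%E)
  (hK2 : (\int[lebesgue_measure]_x ((K x) ^+ 2)%:E < +oo)%E)
  (hKlip : exists L : R, forall x y, `|K x - K y| <= L * `|x - y|)
  (hKsupp : forall x : R, 1 < `|x| -> K x = 0)
  (* bandwidth *)
  (hpos : forall n, 0 < h n)
  (hh0 : h @ \oo --> 0)
  (hnh : (fun n => n%:R * h n) @ \oo --> +oo) :
  {ae P, forall t, exists C : R, \forall n \near \oo,
     forall us : R, h n <= us <= 1 - h n ->
     `| Num.sqrt (n%:R * h n)
          * (That M p K phi psi dpsi b n (h n) t us - Tcf M p Q q phi psi us)
          / qhat K b n (h n) t us
        - (- (phi us * Afun M p us * Gnh P K F b n (h n) t us)) |
     <= C * rate n (h n)}.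
Proof.
have [L Klip] := hKlip.
have [z [r [kap [r0 kap0 zr1 zr2 K_ge]]]] := kernel_pos hK0 hK1 Klip hKsupp.
have [CA _ hCA] := within_bounded (continuous_Afun hA1').
have [CX _ hCX] := within_bounded (continuous_chi hA1' hpsic hdpsic).
have [Cq _ hCq] := within_bounded hqc.
have [Lq Lq0 hLq] := within_bounded hq2c.
have [Cphi _ hCphi] := within_bounded hphic.
have [Cpsi _ hCpsi] := within_bounded hpsic.
have [v0 v01 qmin] := EVT_min ler01 hqc.
have c00 := hqpos _ v01.
(* Keeping h + 401 n^(-1/8) below [eps] gives eta <= 1 and Lq eta <= q v0 / 2, where q v0 is the
   minimum of q; the latter keeps qhat above W q v0 / 2. *)
pose eps : R := Num.min 1 (q v0 / (2 * Lq)).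
have eps0 : 0 < eps by rewrite lt_min ltr01 divr_gt0// mulr_gt0.
apply: filterS (filterI (ae_in_support hbmeas hF hFQ)
  (filterI (iterated_log_law hbmeas hind hF hFQ)
  (filterI (oscillation hbmeas hind hF hFQ) (spacing hbmeas hind hF hFQ)))).
move=> t [supp [lil [osct spt]]].
(* This constant does not depend on the outcome t, which only decides from which n on the bound
   holds. *)
exists (main_const L r kap (q v0) Cq Lq CA Cphi CX Cpsi).
near=> n => us hus.
have hn1 : h n <= eps / 2.
  by near: n; apply: (cvgr_le (0 : R)) => //; rewrite divr_gt0.
have hn2 : 802 / eps <= root8 n by near: n; exact: root8_eventually.
have x0 : 0 < root8 n :> R by apply: lt_le_trans hn2; rewrite divr_gt0 ?ltr0n.
have small : h n + 401 / root8 n <= eps.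
  have : 401 / root8 n <= eps / 2.
    rewrite ler_pdivrMr//; move: hn2; rewrite ler_pdivrMr//; lra.
  by lra.
have [e1 e2] : eps <= 1 /\ Lq * eps <= q v0 / 2.
  split; first by rewrite ge_min lexx.
  apply: (@le_trans _ _ (Lq * (q v0 / (2 * Lq)))).
    by rewrite ler_wpM2l ?(ltW Lq0)// ge_min lexx orbT.
  by rewrite le_eqVlt; apply/orP; left; apply/eqP; field; rewrite gt_eqF.
have l1 : 1 <= ln (log1 n : R) by near: n; exact: llog_eventually.
have l2 : (log1 n : R) ^+ 2 <= root8 n by near: n; exact: log_root_eventually.
have H1 : 1 <= n%:R * h n by near: n; move/cvgryPge: hnh; exact.
have H33 : 33 / r <= n%:R * h n by near: n; move/cvgryPge: hnh; exact.
have liln : forall v : R, 0 <= v <= 1 ->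
  `|csum b Q 0 n v t| <= 400 * Num.sqrt (n%:R * ln (ln n%:R)) by near: n.
have oscn : forall i j, (i <= j <= n)%N ->
  `|csum2 b Q 0 n (i%:R / n%:R) (j%:R / n%:R) t| <=
    Num.sqrt (32 * ((j - i)%N%:R + 2 * ln n%:R) * ln n%:R) by near: n.
have spn : forall i, (i < cells (R := R) n)%N ->
  \sum_(0 <= k < n) (Q (i%:R / (cells (R := R) n)%:R) < b k t
    <= Q (i.+1%:R / (cells (R := R) n)%:R))%R%:R < 32 :> R by near: n.
apply: (@pathwise_bound _ _ _ P b F Q q q2 hbmeas hF hFc hFQ hQc hQd hqc hqd M p phi psi dpsi
  hA1' hpsic hpsid hdpsic K L z r kap hK0 hK1 Klip hKsupp r0 kap0 zr1 zr2 K_ge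
  (q v0) Cq Lq CA Cphi CX Cpsi c00 _ hCq hLq hCA hCphi hCX hCpsi n t (h n) us supp l1 l2
  liln oscn spn (hpos n) hus H1).
- by move=> w w01; apply: qmin; rewrite in_itv.
- by move: H33; rewrite ler_pdivrMr// mulrC.
- exact: le_trans small e1.
- by apply: le_trans e2; rewrite ler_wpM2l// ltW.
Unshelve. all: by end_near.
Qed.
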